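(* Let $X$ be a nonempty completely regular space, $\mu$ a $\sigma$-finite Borel measure on $X$ with support equal to the whole of $X$, $E\ne\{0\}$ a Banach space, $1<p<\infty$ and $D=L^p_\mu(X,E)$. Let $A=C(X,L(E))\subset L(D)$ act by multiplication, $(af)(x)=a(x)f(x)$. Let $G$ be a discrete group and $\{t_g\}_{g\in G}$ a group of homeomorphisms of $X$ ($t_{gh}=t_g\circ t_h$) preserving the equivalence class of $\mu$, and let $T_g$ be the isometry of $D$ given by $$(T_gf)(x)=\Big[\frac{d\,t_g^{-1}(\mu)}{d\mu}(x)\Big]^{1/p}f(t_g^{-1}(x)).$$ Let $B(A,T_g)\subset L(D)$ be the algebra generated by $A$ and $\{T_g\}_{g\in G}$, and let $B(\bar A,V_g)$ be the regular representation corresponding to $A$ and $\{\hat T_g\}_{g\in G}$ in the space $H=l^p(G,L^p_\mu(X,E))$. If $G$ is amenable and acts topologically freely on $X$, then $$B(A,T_g)\cong B(\bar A,V_g),$$ where the isomorphism is given by $$b=\sum_{g\in F}a_gT_g\ \longleftrightarrow\ \sum_{g\in F}\bar a_gV_g=\bar b,\qquad F\subset G \text{ finite},\ a_g\in A;$$ in particular, the algebra $B(A,T_g)$ possesses the properties ( * ) and ( ** ) and the property that for every finite $F\subset G$, all $a_g\in A$ and every character $\chi$ of $G$, $\|\sum_{g\in F}a_gT_g\|=\|\sum_{g\in F}a_g\chi(g)T_g\|$.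
   Context: All Banach spaces are complex, completely regular spaces are Hausdorff. $L(E)$ is the algebra of bounded linear operators on $E$; $C(X,B)$ is the space of bounded continuous functions $X\to B$ with the sup norm; $L^p_\mu(X,E)$ is the Bochner space. $t_g^{-1}(\mu)$ denotes the measure $Q\mapsto\mu(t_g^{-1}(Q))$; preserving the equivalence class of $\mu$ means that for each $g\in G$ this measure is absolutely continuous with respect to $\mu$. A character of $G$ is a homomorphism from $G$ to the unit circle. $\hat T_g(a)=T_gaT_g^{-1}$, so $(\hat T_g(a))(x)=a(t_g^{-1}(x))$. $B(A,T_g)$ is the norm closure in $L(D)$ of the finite sums $\sum_{g\in F}a_gT_g$, $a_g\in A$. Regular representation in a space $H$ of $D$-valued functions on $G$ (here $H=l^p(G,D)$): $(V_{g_0}\xi)(g)=\xi(gg_0)$, and for $a\in A$, $(\bar a\xi)(g)=\hat T_g(a)\xi(g)$; $\bar A=\{\bar a:a\in A\}\subset L(H)$; $B(\bar A,V_g)$ is the norm closure in $L(H)$ of the finite sums $\sum\bar a_gV_g$. ''$\cong$'' is isometric isomorphism of Banach algebras. Topologically free action: for every $g\ne e$ the set $\{x\in X:t_g(x)=x\}$ has empty interior. Amenable: there is a left invariant mean on $l^\infty(G)$ ($G$ regarded as a discrete group). Property ( * ): $\|\sum a_gT_g\|\ge\|a_e\|$ for every finite sum with $a_g\in A$. Then for each $g_0\in G$ the map $N_{g_0}:\sum a_gT_g\mapsto a_{g_0}$ is well defined on finite sums and extends by continuity to $N_{g_0}:B(A,T_g)\to A$. Property ( ** ): ( * ) holds and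 for $b\in B(A,T_g)$, $b=0$ iff $N_g(b)=0$ for every $g\in G$. *)

(* Defs.v *)
From HB Require Import structures.
From mathcomp Require Import all_boot all_order all_algebra finmap complex.
From mathcomp Require Import all_classical all_reals all_analysis.
From mathcomp Require Import measurable_realfun ring.

Set Implicit Arguments.
Unset Strict Implicit.
Unset Printing Implicit Defensive.

Import Order.TTheory GRing.Theory Num.Theory.
Import numFieldNormedType.Exports.

Local Open Scope classical_set_scope.
Local Open Scope ring_scope.
Local Open Scope complex_scope.

(* The norm of a [normedModType R[i]] takes its values in [R[i]]; [rnorm] is
   the same norm, read as a real number. *)
Definition rnorm (R : realType) (V : normedModType R[i]) (v : V) : R :=
  complex.Re `|v|.

(* The modulus of a complex number, as a real number. *)
Definition cabs (R : realType) (c : R[i]) : R := complex.Re `|c|.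

Section Modulus.
Context (R : realType).
Implicit Types c : R[i].

Lemma cabsC c : (cabs c)%:C = `|c|.
Proof. by rewrite RRe_real// normr_real. Qed.

Lemma cabs_ge0 c : 0 <= cabs c.
Proof. by rewrite -ler0c cabsC. Qed.

Lemma cabs0 : cabs (0 : R[i]) = 0.
Proof. by rewrite /cabs normr0. Qed.

Lemma cabs_eq0 c : cabs c = 0 -> c = 0.
Proof. by move=> c0; apply: normr0_eq0; rewrite -cabsC c0. Qed.

Lemma cabsV c : cabs c^-1 = (cabs c)^-1.
Proof. by apply: complexI; rewrite fmorphV/= !cabsC normfV. Qed.

Lemma cabs_real (x : R) : cabs x%:C = `|x|.
Proof. by rewrite /cabs normc_def/= expr0n/= addr0 sqrtr_sqr. Qed.

End Modulus.

Section RealNorm.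
Context (R : realType) (V : normedModType R[i]).
Implicit Types (u v : V) (c : R[i]).

Lemma rnormC v : (rnorm v)%:C = `|v|.
Proof. by rewrite RRe_real// normr_real. Qed.

Lemma rnorm_ge0 v : 0 <= rnorm v.
Proof. by rewrite -ler0c rnormC. Qed.

Lemma ler_rnormD u v : rnorm (u + v) <= rnorm u + rnorm v.
Proof. by rewrite -lecR rmorphD/= !rnormC ler_normD. Qed.

Lemma rnormZ c v : rnorm (c *: v) = cabs c * rnorm v.
Proof.
apply: complexI; rewrite rmorphM/= !rnormC cabsC normrZ; reflexivity.
Qed.

Lemma rnorm0 : rnorm (0 : V) = 0.
Proof. by apply: complexI; rewrite rnormC normr0. Qed.

Lemma rnorm0_eq0 v : rnorm v = 0 -> v = 0.
Proof. by move=> v0; apply: normr0_eq0; rewrite -rnormC v0. Qed.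

Lemma rnormN v : rnorm (- v) = rnorm v.
Proof. by rewrite /rnorm normrN. Qed.

Lemma ler_rnorm_dist u v : `|rnorm u - rnorm v| <= rnorm (u - v).
Proof.
have H (a b : V) : rnorm a - rnorm b <= rnorm (a - b).
  by have := ler_rnormD (a - b) b; rewrite subrK -lerBlDr.
by rewrite ler_norml H andbT lerNl opprB -(rnormN (u - v)) opprB H.
Qed.

End RealNorm.

Section BoundedOperators.
Context (R : realType) (V : normedModType R[i]).

Definition bounded_linear (f : V -> V) : Prop :=
  linear f /\ exists M : R, forall v, rnorm (f v) <= M * rnorm v.

Definition bop_pred : {pred V -> V} := [pred f | `[< bounded_linear f >]].

Record bop := Bop { bop_fun :> V -> V; _ : bop_fun \in bop_pred }.

HB.instance Definition _ := [isSub for bop_fun].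
HB.instance Definition _ := [Choice of bop by <:].

Lemma bopP (u : bop) : bounded_linear u.
Proof. by have /asboolP := valP u. Qed.

Lemma bop_submod_closed : submod_closed bop_pred.
Proof.
split.
  apply/asboolP; split=> [c x y|]; first by rewrite /= scaler0 addr0.
  by exists 0 => v; rewrite rnorm0 mul0r.
move=> c f g /asboolP[lf [M fM]] /asboolP[lg [N gN]].
apply/asboolP; split=> [d x y|].
  rewrite !fctE lf lg !scalerDr !scalerA (mulrC d).
  by rewrite addrACA.
exists (cabs c * M + N) => v; rewrite !fctE (le_trans (ler_rnormD _ _))//.
by rewrite mulrDl lerD// rnormZ -mulrA ler_wpM2l// cabs_ge0.
Qed.

HB.instance Definition _ :=
  GRing.isSubmodClosed.Build _ _ bop_pred bop_submod_closed.
HB.instance Definition _ := [SubChoice_isSubLmodule of bop by <:].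

Lemma bopD (u v : bop) x : (u + v) x = u x + v x. Proof. by []. Qed.
Lemma bopZ c (u : bop) x : (c *: u) x = c *: u x. Proof. by []. Qed.
Lemma bop0 x : (0 : bop) x = 0. Proof. by []. Qed.

Lemma bop_inj (u v : bop) : u =1 v -> u = v.
Proof. by move=> uv; apply: val_inj; apply/funext. Qed.

Lemma bop_id_subproof : idfun \in bop_pred.
Proof. by apply/asboolP; split=> //; exists 1 => v; rewrite mul1r. Qed.

Definition bop_id : bop := Bop bop_id_subproof.

Lemma bop_comp_subproof (u v : bop) : u \o v \in bop_pred.
Proof.
have [[lu [M uM]] [lv [N vN]]] := (bopP u, bopP v).
apply/asboolP; split=> [c x y|]; first by rewrite /= lv lu.
exists (`|M| * N) => x /=; rewrite (le_trans (uM _))//.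
rewrite (le_trans (ler_wpM2r (rnorm_ge0 _) (ler_norm M)))//.
by rewrite -mulrA ler_wpM2l.
Qed.

Definition bop_comp (u v : bop) : bop := Bop (bop_comp_subproof u v).

Lemma bop_compA : associative bop_comp.
Proof. by move=> u v w; apply: bop_inj. Qed.

Lemma bop_comp1l : left_id bop_id bop_comp.
Proof. by move=> u; apply: bop_inj. Qed.

Lemma bop_comp1r : right_id bop_id bop_comp.
Proof. by move=> u; apply: bop_inj. Qed.

Lemma bop_compDl : left_distributive bop_comp +%R.
Proof. by move=> u v w; apply: bop_inj. Qed.

Lemma bop_compDr : right_distributive bop_comp +%R.
Proof.
move=> u v w; apply: bop_inj => x /=.
have [lu _] := bopP u.
by have := lu 1 (v x) (w x); rewrite !scale1r.
Qed.

HB.instance Definition _ := GRing.Zmodule_isPzRing.Build bop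
  bop_compA bop_comp1l bop_comp1r bop_compDl bop_compDr.

Definition opnorm (u : bop) : R :=
  sup [set rnorm (u x) | x in [set x | rnorm x <= 1]].

Lemma opnorm_has_sup (u : bop) :
  has_sup [set rnorm (u x) | x in [set x | rnorm x <= 1]].
Proof.
split; first by exists (rnorm (u 0)), 0 => //=; rewrite rnorm0.
have [_ [M uM]] := bopP u; exists `|M| => _ [x /= x1 <-].
rewrite (le_trans (uM _))// (le_trans (ler_wpM2r (rnorm_ge0 _) (ler_norm M)))//.
by rewrite ler_piMr.
Qed.

Lemma opnorm_ub (u : bop) x : rnorm x <= 1 -> rnorm (u x) <= opnorm u.
Proof. by move=> x1; apply: (sup_upper_bound (opnorm_has_sup u)); exists x. Qed.

Lemma opnorm_lub (u : bop) (M : R) :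
  (forall x, rnorm x <= 1 -> rnorm (u x) <= M) -> opnorm u <= M.
Proof.
move=> uM; apply: ge_sup; first by have [] := opnorm_has_sup u.
by move=> _ [x /= x1 <-]; exact: uM.
Qed.

Lemma opnorm_ge0 (u : bop) : 0 <= opnorm u.
Proof. by rewrite (le_trans (rnorm_ge0 (u 0)))// opnorm_ub// rnorm0. Qed.

Lemma bop_map0 (u : bop) : u 0 = 0.
Proof.
have [lu _] := bopP u.
have := lu 1 0 0; rewrite !scale1r addr0 => /eqP.
by rewrite -[X in X == _]addr0 => /eqP/addrI/esym.
Qed.

Lemma bop_mapZ (u : bop) c x : u (c *: x) = c *: u x.
Proof.
by have [lu _] := bopP u; have := lu c x 0; rewrite !addr0 bop_map0 addr0.
Qed.

Lemma le_opnorm (u : bop) x : rnorm (u x) <= opnorm u * rnorm x.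
Proof.
have [/rnorm0_eq0->|x0] := eqVneq (rnorm x) 0.
  by rewrite bop_map0 !rnorm0 mulr0.
have xp : 0 < rnorm x by rewrite lt_def x0 rnorm_ge0.
have nx : cabs (rnorm x)^-1%:C = (rnorm x)^-1.
  by rewrite cabs_real ger0_norm// invr_ge0 ltW.
rewrite -ler_pdivrMr// mulrC -nx -rnormZ -bop_mapZ opnorm_ub// rnormZ nx.
by rewrite mulVf.
Qed.

Definition bop_cnorm (u : bop) : R[i] := (opnorm u)%:C.

Lemma bop_cnormD u v : bop_cnorm (u + v) <= bop_cnorm u + bop_cnorm v.
Proof.
rewrite -rmorphD/= lecR; apply: opnorm_lub => x x1.
by rewrite (le_trans (ler_rnormD _ _))// lerD// opnorm_ub.
Qed.

Lemma bop_cnormZ c u : bop_cnorm (c *: u) = `|c| * bop_cnorm u.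
Proof.
have H d w : opnorm (d *: w) <= cabs d * opnorm w.
  apply: opnorm_lub => x x1; rewrite bopZ rnormZ.
  by rewrite ler_wpM2l ?cabs_ge0// opnorm_ub.
suff -> : bop_cnorm (c *: u) = (cabs c * opnorm u)%:C.
  by rewrite rmorphM/= cabsC.
congr (_%:C); apply/eqP; rewrite eq_le H/=.
have [->|c0] := eqVneq c 0; first by rewrite cabs0 mul0r opnorm_ge0.
have nc0 : 0 < cabs c.
  by rewrite lt_def cabs_ge0 andbT; apply: contra_neq c0 => /cabs_eq0.
rewrite -ler_pdivlMl// -cabsV -[X in opnorm X <= _](scalerK c0 u).
exact: H.
Qed.

Lemma bop_cnorm0_eq0 u : bop_cnorm u = 0 -> u = 0.
Proof.
move=> /complexI u0; apply: bop_inj => x; apply: rnorm0_eq0.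
by apply: le_anti; rewrite rnorm_ge0 andbT (le_trans (le_opnorm _ _))// u0 mul0r.
Qed.

HB.instance Definition _ := @Lmodule_isNormed.Build R[i] bop bop_cnorm
  bop_cnormD bop_cnormZ bop_cnorm0_eq0.

End BoundedOperators.

Section BoundedContinuous.
Context (R : realType) (X : ptopologicalType) (V : normedModType R[i]).

Definition bounded_continuous (f : X -> V) : Prop :=
  continuous f /\ exists M : R, forall x, rnorm (f x) <= M.

Definition bcont_pred : {pred X -> V} := [pred f | `[< bounded_continuous f >]].

Record bcont := Bcont { bcont_fun :> X -> V; _ : bcont_fun \in bcont_pred }.

HB.instance Definition _ := [isSub for bcont_fun].
HB.instance Definition _ := [Choice of bcont by <:].

Lemma bcontP (f : bcont) : bounded_continuous f.
Proof. by have /asboolP := valP f. Qed.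

Lemma bcont_submod_closed : submod_closed bcont_pred.
Proof.
split.
  apply/asboolP; split=> [x|]; first exact: cvg_cst.
  by exists 0 => x; rewrite rnorm0.
move=> c f g /asboolP[cf [M fM]] /asboolP[cg [N gN]].
apply/asboolP; split=> [x|].
  by apply: cvgD; [apply: cvgZr; exact: cf|exact: cg].
exists (cabs c * M + N) => x; rewrite !fctE (le_trans (ler_rnormD _ _))//.
by rewrite lerD// rnormZ ler_wpM2l// cabs_ge0.
Qed.

HB.instance Definition _ :=
  GRing.isSubmodClosed.Build _ _ bcont_pred bcont_submod_closed.
HB.instance Definition _ := [SubChoice_isSubLmodule of bcont by <:].

Lemma bcont_inj (f g : bcont) : f =1 g -> f = g.
Proof. by move=> fg; apply: val_inj; apply/funext. Qed.

Definition supnorm (f : bcont) : R := sup (range (fun x => rnorm (f x))).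

Lemma supnorm_has_sup (f : bcont) : has_sup (range (fun x => rnorm (f x))).
Proof.
split; first by exists (rnorm (f point)), point.
by have [_ [M fM]] := bcontP f; exists M => _ [x _ <-].
Qed.

Lemma supnorm_ub (f : bcont) x : rnorm (f x) <= supnorm f.
Proof. by apply: (sup_upper_bound (supnorm_has_sup f)); exists x. Qed.

Lemma supnorm_lub (f : bcont) (M : R) :
  (forall x, rnorm (f x) <= M) -> supnorm f <= M.
Proof.
move=> fM; apply: ge_sup; first by have [] := supnorm_has_sup f.
by move=> _ [x _ <-].
Qed.

Lemma supnorm_ge0 (f : bcont) : 0 <= supnorm f.
Proof. by rewrite (le_trans (rnorm_ge0 (f point)))// supnorm_ub. Qed.

Definition bcont_cnorm (f : bcont) : R[i] := (supnorm f)%:C.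

Lemma bcont_cnormD f g : bcont_cnorm (f + g) <= bcont_cnorm f + bcont_cnorm g.
Proof.
rewrite -rmorphD/= lecR; apply: supnorm_lub => x.
by rewrite (le_trans (ler_rnormD _ _))// lerD// supnorm_ub.
Qed.

Lemma bcont_cnormZ c f : bcont_cnorm (c *: f) = `|c| * bcont_cnorm f.
Proof.
have H d h : supnorm (d *: h) <= cabs d * supnorm h.
  by apply: supnorm_lub => x; rewrite rnormZ ler_wpM2l ?cabs_ge0// supnorm_ub.
suff -> : bcont_cnorm (c *: f) = (cabs c * supnorm f)%:C.
  by rewrite rmorphM/= cabsC.
congr (_%:C); apply/eqP; rewrite eq_le H/=.
have [->|c0] := eqVneq c 0; first by rewrite cabs0 mul0r supnorm_ge0.
have nc0 : 0 < cabs c.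
  by rewrite lt_def cabs_ge0 andbT; apply: contra_neq c0 => /cabs_eq0.
rewrite -ler_pdivlMl// -cabsV -[X in supnorm X <= _](scalerK c0 f).
exact: H.
Qed.

Lemma bcont_cnorm0_eq0 f : bcont_cnorm f = 0 -> f = 0.
Proof.
move=> /complexI f0; apply: bcont_inj => x; apply: rnorm0_eq0.
by apply: le_anti; rewrite rnorm_ge0 andbT (le_trans (supnorm_ub _ _))// f0.
Qed.

HB.instance Definition _ := @Lmodule_isNormed.Build R[i] bcont bcont_cnorm
  bcont_cnormD bcont_cnormZ bcont_cnorm0_eq0.

End BoundedContinuous.

(* [Lp mu V p1] is the Bochner space.  Strong measurability is taken in the
   everywhere sense (pointwise limit of simple functions): each class of almost
   everywhere limits of simple functions has such a representative, and
   [x |-> `|f x|] is then measurable although [mu] need not be complete. *)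

Section StronglyMeasurable.
Context d (T : measurableType d) (R : realType) (V : normedModType R[i]).
Implicit Types f g : T -> V.

Definition simple_fun f : Prop :=
  finite_set (range f) /\ forall y, measurable (f @^-1` [set y]).

Definition strongly_measurable f : Prop :=
  exists s : nat -> T -> V, (forall n, simple_fun (s n)) /\
    forall x, s n x @[n --> \oo] --> f x.

Lemma simple_fun_preimage f (Y : set V) :
  simple_fun f -> measurable (f @^-1` Y).
Proof.
move=> [ff mf]; have -> : f @^-1` Y =
    \bigcup_(y in range f `&` Y) (f @^-1` [set y]).
  apply/seteqP; split=> [x Yfx|x [y [_ Yy] /= ->]]//.
  by exists (f x) => //; split=> //; exists x.
by apply: fin_bigcup_measurable => [|y _]; [exact: finite_setIl|exact: mf].
Qed.

Lemma simple_fun_lin c f g :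
  simple_fun f -> simple_fun g -> simple_fun (c *: f + g).
Proof.
move=> sf sg; split.
  apply: (@sub_finite_set _ _
      [set c *: u + v | u in range f & v in range g]).
    by move=> _ [x _ <-]; exists (f x); [exists x|exists (g x); [exists x|]].
  by apply: finite_image2; [exact: sf.1|exact: sg.1].
move=> y; have -> : (c *: f + g) @^-1` [set y] =
    \bigcup_(v in range g) (g @^-1` [set v] `&`
      (f @^-1` [set u | c *: u + v = y])).
  apply/seteqP; split=> [x /= <-|x [v _ [/= <- <-]]]//.
  by exists (g x) => //; exists x.
apply: fin_bigcup_measurable => [|v _]; first exact: sg.1.
by apply: measurableI; exact: simple_fun_preimage.
Qed.

Lemma strongly_measurable0 : strongly_measurable (0 : T -> V).
Proof.
exists (fun=> 0); split=> [n|x]; last exact: cvg_cst.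
split=> [|y]; first by apply: (sub_finite_set _ (finite_set1 0)) => _ [x _ <-].
have [<-|/eqP y0] := eqVneq 0 y.
  by rewrite (_ : _ @^-1` _ = setT)//; apply/seteqP; split.
by rewrite (_ : _ @^-1` _ = set0)//; apply/seteqP; split.
Qed.

Lemma strongly_measurable_lin c f g : strongly_measurable f ->
  strongly_measurable g -> strongly_measurable (c *: f + g).
Proof.
move=> [s [ss sf]] [t [st tg]]; exists (fun n => c *: s n + t n); split=> [n|x].
  exact: simple_fun_lin.
by apply: cvgD; [apply: cvgZr; exact: sf|exact: tg].
Qed.

Lemma measurable_rnorm f : strongly_measurable f ->
  measurable_fun [set: T] (fun x => rnorm (f x)).
Proof.
move=> [s [ss sf]].
apply: (@measurable_realfun.measurable_fun_cvg _ _ _ _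
  (fun n x => rnorm (s n x))) => [n _ Y mY|x _].
  by rewrite setTI; apply: (simple_fun_preimage (fun v => Y (rnorm v)) (ss n)).
apply/cvgrPdist_lt => e e0; near=> n.
rewrite (le_lt_trans (ler_rnorm_dist _ _))// -ltcR rnormC.
near: n; have /cvgrPdist_lt := sf x; apply.
by rewrite ltcR.
Unshelve. all: by end_near. Qed.

End StronglyMeasurable.

Section Bochner.
Context d (T : measurableType d) (R : realType).
Context (mu : {measure set T -> \bar R}) (V : normedModType R[i]).
Context (p : R) (p1 : 1 < p).
Implicit Types f g : T -> V.

Definition Bochner_norm (f : T -> V) : \bar R :=
  'N[mu]_(p%:E)[EFin \o (fun x => rnorm (f x))].

Definition Lp_fun (f : T -> V) : Prop :=
  strongly_measurable f /\ (Bochner_norm f < +oo)%E.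

Let p_gt0 : 0 < p. Proof. exact: lt_trans p1. Qed.

Lemma Bochner_normE f : Bochner_norm f =
  ((\int[mu]_x ((rnorm (f x)) `^ p)%:E) `^ p^-1)%E.
Proof.
rewrite /Bochner_norm unlock; congr (_ `^ _)%E; apply: eq_integral => x _ /=.
by rewrite ger0_norm ?rnorm_ge0.
Qed.

Let measurable_rnormp f : strongly_measurable f ->
  measurable_fun [set: T] (EFin \o ((fun x => rnorm (f x) `^ p) : T -> R)).
Proof.
move=> mf; apply/measurable_EFinP.
apply: (@measurableT_comp _ _ _ _ _ _ (@powR R ^~ p)) => //; exact: measurable_rnorm.
Qed.

Lemma Bochner_normD f g : strongly_measurable f -> strongly_measurable g ->
  (Bochner_norm (f + g)%R <= Bochner_norm f + Bochner_norm g)%E.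
Proof.
move=> mf mg.
apply: le_trans (minkowski_EFin mu (measurable_rnorm mf) (measurable_rnorm mg)
  (ltW p1)).
have mfg : strongly_measurable (f + g).
  by have := strongly_measurable_lin 1 mf mg; rewrite scale1r.
have -> : 'N[mu]_(p%:E)[EFin \o
      ((fun x => rnorm (f x)) \+ (fun x => rnorm (g x)))%R]%E =
    ((\int[mu]_x ((rnorm (f x) + rnorm (g x)) `^ p)%:E) `^ p^-1)%E.
  rewrite unlock; congr (_ `^ _)%E; apply: eq_integral => x _ /=.
  by rewrite ger0_norm// addr_ge0 ?rnorm_ge0.
rewrite Bochner_normE; apply: gt0_ler_poweR.
- by rewrite invr_ge0 ltW.
- by rewrite in_itv/= leey andbT integral_ge0// => x _; rewrite lee_fin powR_ge0.
- rewrite in_itv/= leey andbT integral_ge0// => x _.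
  by rewrite lee_fin powR_ge0.
- apply: ge0_le_integral => //.
  + by move=> x _; rewrite lee_fin powR_ge0.
  + exact: measurable_rnormp.
  + apply/measurable_EFinP.
    apply: (@measurableT_comp _ _ _ _ _ _ (@powR R ^~ p)) => //.
    by apply: measurable_funD; exact: measurable_rnorm.
  + move=> x _ /=; rewrite lee_fin ge0_ler_powR ?nnegrE ?rnorm_ge0//.
    * exact: ltW.
    * by rewrite addr_ge0 ?rnorm_ge0.
    * exact: ler_rnormD.
Qed.

Lemma Bochner_normZ c f : strongly_measurable f ->
  Bochner_norm (c *: f) = ((cabs c)%:E * Bochner_norm f)%E.
Proof.
move=> mf; rewrite !Bochner_normE.
under eq_integral => x _ do
  rewrite rnormZ powRM ?rnorm_ge0 ?cabs_ge0// EFinM.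
rewrite ge0_integralZl_EFin ?powR_ge0//.
- rewrite poweRM ?lee_fin ?powR_ge0//; last first.
    by apply: integral_ge0 => x _; rewrite lee_fin powR_ge0.
  by rewrite poweR_EFin -powRrM mulfV ?gt_eqF// powRr1// cabs_ge0.
- by move=> x _; rewrite lee_fin powR_ge0.
- exact: measurable_rnormp.
Qed.

Lemma Bochner_norm_ge0 f : (0 <= Bochner_norm f)%E.
Proof. exact: Lnorm_ge0. Qed.

Lemma Bochner_norm_eq0 f : strongly_measurable f ->
  Bochner_norm f = 0%E -> {ae mu, forall x, f x = 0}.
Proof.
move=> mf f0.
have := @Lnorm_eq0_eq0 _ _ _ mu (EFin \o (fun x => rnorm (f x))) p%:E.
have mf' : measurable_fun [set: T] (EFin \o (fun x => rnorm (f x))).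
  by apply/measurable_EFinP; exact: measurable_rnorm.
rewrite lte_fin => /(_ mf' p_gt0 f0); apply: filterS => x /(_ I) [].
exact: rnorm0_eq0.
Qed.

Lemma ae_Bochner_norm f g : strongly_measurable f -> strongly_measurable g ->
  {ae mu, forall x, f x = g x} -> Bochner_norm f = Bochner_norm g.
Proof.
move=> mf mg fg; rewrite !Bochner_normE; congr (_ `^ _)%E.
apply: ae_eq_integral => //; [exact: measurable_rnormp|exact: measurable_rnormp|].
by apply: filterS fg => x -> _.
Qed.

(* [p1] is a parameter of the type, as its vector space structure needs it. *)
Definition Lp_fun_pred : {pred T -> V} :=
  let _ := p1 in [pred f | `[< Lp_fun f >]].

Record LpFun := MkLpFun { LpFun_fun :> T -> V; _ : LpFun_fun \in Lp_fun_pred }.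

HB.instance Definition _ := [isSub for LpFun_fun].
HB.instance Definition _ := [Choice of LpFun by <:].

Lemma LpFunP (f : LpFun) : Lp_fun f.
Proof. by have /asboolP := valP f. Qed.

Lemma Lp_fun_submod_closed : submod_closed Lp_fun_pred.
Proof.
split.
  apply/asboolP; split; first exact: strongly_measurable0.
  have := Bochner_normZ 0 (@strongly_measurable0 _ T _ V).
  by rewrite scale0r => ->; rewrite cabs0 mul0e ltry.
move=> c f g /asboolP[mf fy] /asboolP[mg gy]; apply/asboolP; split.
  exact: strongly_measurable_lin.
have mcf : strongly_measurable (c *: f).
  have := strongly_measurable_lin c mf (@strongly_measurable0 _ T _ V).
  by rewrite addr0.
rewrite (le_lt_trans (Bochner_normD mcf mg))// lte_add_pinfty//.
by rewrite Bochner_normZ// lte_mul_pinfty// lee_fin cabs_ge0.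
Qed.

HB.instance Definition _ :=
  GRing.isSubmodClosed.Build _ _ Lp_fun_pred Lp_fun_submod_closed.
HB.instance Definition _ := [SubChoice_isSubLmodule of LpFun by <:].

Lemma LpFunDE (f g : LpFun) x : (f + g) x = f x + g x. Proof. by []. Qed.
Lemma LpFunNE (f : LpFun) x : (- f) x = - f x. Proof. by []. Qed.
Lemma LpFunZE c (f : LpFun) x : (c *: f) x = c *: f x. Proof. by []. Qed.

Definition Lp_eq (f g : LpFun) : bool := `[< {ae mu, forall x, f x = g x} >].

Lemma Lp_eq_refl : reflexive Lp_eq.
Proof. by move=> f; apply/asboolP; exact: nearW. Qed.

Lemma Lp_eq_sym : symmetric Lp_eq.
Proof.
by move=> f g; apply/asboolP/asboolP; apply: filterS => x.
Qed.

Lemma Lp_eq_trans : transitive Lp_eq.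
Proof.
move=> f g h /asboolP gf /asboolP fh; apply/asboolP.
by apply: filterS2 gf fh => x -> ->.
Qed.

Canonical Lp_eq_equiv := EquivRel Lp_eq Lp_eq_refl Lp_eq_sym Lp_eq_trans.

Local Open Scope quotient_scope.

Definition Lp : Type := {eq_quot Lp_eq}.
HB.instance Definition _ := Choice.on Lp.
HB.instance Definition _ := EqQuotient.on Lp.

Lemma Lp_piP (f g : LpFun) :
  \pi_Lp f = \pi_Lp g <-> {ae mu, forall x, f x = g x}.
Proof.
split=> [/eqP|fg]; first by rewrite eqmodE => /asboolP.
by apply/eqP; rewrite eqmodE; exact/asboolP.
Qed.

Lemma Lp_repr (f : LpFun) : {ae mu, forall x, repr (\pi_Lp f) x = f x}.
Proof. by apply/Lp_piP; rewrite reprK. Qed.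

Lemma LpW (P : Lp -> Prop) : (forall f : LpFun, P (\pi_Lp f)) -> forall F, P F.
Proof. by move=> Pf F; rewrite -[F]reprK. Qed.

Definition Lp_zero : Lp := \pi_Lp 0.
Definition Lp_add (F G : Lp) : Lp := \pi_Lp (repr F + repr G).
Definition Lp_opp (F : Lp) : Lp := \pi_Lp (- repr F).
Definition Lp_scale (c : R[i]) (F : Lp) : Lp := \pi_Lp (c *: repr F).

Lemma pi_LpD (f g : LpFun) : Lp_add (\pi_Lp f) (\pi_Lp g) = \pi_Lp (f + g).
Proof.
apply/Lp_piP; apply: filterS2 (Lp_repr f) (Lp_repr g) => x fx gx.
by rewrite !LpFunDE fx gx.
Qed.

Lemma pi_LpN (f : LpFun) : Lp_opp (\pi_Lp f) = \pi_Lp (- f).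
Proof.
apply/Lp_piP; apply: filterS (Lp_repr f) => x fx.
by rewrite !LpFunNE fx.
Qed.

Lemma pi_LpZ c (f : LpFun) : Lp_scale c (\pi_Lp f) = \pi_Lp (c *: f).
Proof.
apply/Lp_piP; apply: filterS (Lp_repr f) => x fx.
by rewrite !LpFunZE fx.
Qed.

Lemma Lp_addA : associative Lp_add.
Proof. 
by move=> F G H; elim/LpW: F => f; elim/LpW: G => g; elim/LpW: H => h;
  rewrite !pi_LpD addrA. Qed.

Lemma Lp_addC : commutative Lp_add.
Proof. by move=> F G; elim/LpW: F => f; elim/LpW: G => g; rewrite !pi_LpD addrC. Qed.

Lemma Lp_add0 : left_id Lp_zero Lp_add.
Proof. by move=> F; elim/LpW: F => f; rewrite pi_LpD add0r. Qed.

Lemma Lp_addN : left_inverse Lp_zero Lp_opp Lp_add.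
Proof. by move=> F; elim/LpW: F => f; rewrite pi_LpN pi_LpD addNr. Qed.

HB.instance Definition _ := GRing.isZmodule.Build Lp
  Lp_addA Lp_addC Lp_add0 Lp_addN.

Lemma Lp_scaleA a b (F : Lp) : Lp_scale a (Lp_scale b F) = Lp_scale (a * b) F.
Proof. by elim/LpW: F => f; rewrite !pi_LpZ scalerA. Qed.

Lemma Lp_scale1 : left_id 1 Lp_scale.
Proof. by move=> F; elim/LpW: F => f; rewrite pi_LpZ scale1r. Qed.

Lemma Lp_scaleDr : right_distributive Lp_scale +%R.
Proof.
move=> c F G; elim/LpW: F => f; elim/LpW: G => g.
by rewrite /GRing.add/= !(pi_LpD, pi_LpZ) scalerDr.
Qed.

Lemma Lp_scaleDl (F : Lp) : {morph Lp_scale^~ F : a b / a + b}.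
Proof.
move=> a b; elim/LpW: F => f.
by rewrite [RHS]/GRing.add/= !pi_LpZ pi_LpD scalerDl.
Qed.

HB.instance Definition _ := GRing.Zmodule_isLmodule.Build R[i] Lp
  Lp_scaleA Lp_scale1 Lp_scaleDr Lp_scaleDl.

Definition Lp_cnorm (F : Lp) : R[i] := (fine (Bochner_norm (repr F)))%:C.

Lemma Lp_cnorm_pi (f : LpFun) : Lp_cnorm (\pi_Lp f) = (fine (Bochner_norm f))%:C.
Proof.
rewrite /Lp_cnorm (@ae_Bochner_norm _ f)//; last exact: Lp_repr.
- exact: (LpFunP _).1.
- exact: (LpFunP _).1.
Qed.

Let fin_Bochner_norm (f : LpFun) : Bochner_norm f \is a fin_num.
Proof. by rewrite ge0_fin_numE ?Bochner_norm_ge0//; exact: (LpFunP f).2. Qed.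

Lemma Lp_cnormD F G : Lp_cnorm (F + G) <= Lp_cnorm F + Lp_cnorm G.
Proof.
elim/LpW: F => f; elim/LpW: G => g.
rewrite [X in Lp_cnorm X](_ : _ = \pi_Lp (f + g)); last exact: pi_LpD.
rewrite !Lp_cnorm_pi -rmorphD/= lecR -fineD ?fin_Bochner_norm//.
rewrite fine_le ?fin_numD ?fin_Bochner_norm//.
  exact: (fin_Bochner_norm (f + g)).
exact: (Bochner_normD (LpFunP f).1 (LpFunP g).1).
Qed.

Lemma Lp_cnormZ c F : Lp_cnorm (c *: F) = `|c| * Lp_cnorm F.
Proof.
elim/LpW: F => f.
rewrite [X in Lp_cnorm X](_ : _ = \pi_Lp (c *: f)); last exact: pi_LpZ.
rewrite !Lp_cnorm_pi.
have -> := Bochner_normZ c (LpFunP f).1 : Bochner_norm (c *: f : LpFun) = _.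
by rewrite fineM ?fin_Bochner_norm// rmorphM/= cabsC.
Qed.

Lemma Lp_cnorm0_eq0 F : Lp_cnorm F = 0 -> F = 0.
Proof.
elim/LpW: F => f; rewrite Lp_cnorm_pi => /complexI f0.
apply/Lp_piP; apply: Bochner_norm_eq0; first exact: (LpFunP _).1.
by rewrite -[LHS]fineK ?fin_Bochner_norm// f0.
Qed.

HB.instance Definition _ := @Lmodule_isNormed.Build R[i] Lp Lp_cnorm
  Lp_cnormD Lp_cnormZ Lp_cnorm0_eq0.

End Bochner.

Section EllP.
Context (R : realType) (I : choiceType) (V : normedModType R[i]).
Context (p : R) (p1 : 1 < p).

Definition ellp_sum (xi : I -> V) : \bar R :=
  \esum_(i in [set: I]) ((rnorm (xi i)) `^ p)%:E.

Definition ellp_fun (xi : I -> V) : Prop := (ellp_sum xi < +oo)%E.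

Let p_gt0 : 0 < p. Proof. exact: lt_trans p1. Qed.

Let pterm_ge0 (xi : I -> V) i : (0 <= (rnorm (xi i) `^ p)%:E)%E.
Proof. by rewrite lee_fin powR_ge0. Qed.

Lemma ellp_sum_ge0 xi : (0 <= ellp_sum xi)%E.
Proof. exact: esum_ge0. Qed.

Let esumZ_le (k : R) (a : I -> \bar R) : 0 <= k -> (forall i, 0 <= a i)%E ->
  (\esum_(i in [set: I]) (k%:E * a i) <= k%:E * \esum_(i in [set: I]) a i)%E.
Proof.
move=> k0 a0; apply: ge_ereal_sup => _ [X FX <-].
rewrite -ge0_mule_fsumr//; apply: lee_wpmul2l; first by rewrite lee_fin.
by apply: ereal_sup_ubound; exists X.
Qed.

Let convex_bound (a b x y : R) : 0 < a -> 0 < b -> 0 <= x -> 0 <= y ->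
  (x + y) `^ p <=
  (a + b) `^ p * (a / (a + b) / a `^ p) * x `^ p +
  (a + b) `^ p * (b / (a + b) / b `^ p) * y `^ p.
Proof.
move=> a0 b0 x0 y0; have ab0 : 0 < a + b by rewrite addr_gt0.
have t0 : 0 <= a / (a + b) by rewrite divr_ge0// ltW.
have t1 : a / (a + b) <= 1 by rewrite ler_pdivrMr// mul1r lerDl ltW.
have tE : 1 - a / (a + b) = b / (a + b).
  by field; rewrite gt_eqF.
have xa : x / a \in (`[0, +oo[%classic : set R).
  by rewrite inE/= in_itv/= andbT divr_ge0// ltW.
have yb : y / b \in (`[0, +oo[%classic : set R).
  by rewrite inE/= in_itv/= andbT divr_ge0// ltW.
have := convex_powR (ltW p1) (Itv01 t0 t1) xa yb.
rewrite !convRE/= /unstable.onem tE => H.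
have -> : x + y = (a + b) * (a / (a + b) * (x / a) + b / (a + b) * (y / b)).
  have [an0 bn0 abn0] : [/\ a != 0, b != 0 & a + b != 0] by rewrite !gt_eqF.
  by field; rewrite bn0 abn0.
have {}H : (a / (a + b) * (x / a) + (1 - a / (a + b)) * (y / b)) `^ p <=
    a / (a + b) * (x / a) `^ p + b / (a + b) * (y / b) `^ p := H.
rewrite tE in H.
have pV (u v : R) : 0 < u -> 0 <= v -> (v / u) `^ p = (u `^ p)^-1 * v `^ p.
  move=> u0 v0; rewrite powRM ?invr_ge0 ?(ltW u0)// mulrC; congr (_ * _).
  by rewrite -powR_inv1 ?ltW// -powRrM mulN1r powRN.
rewrite powRM ?(ltW ab0)//; last first.
  by rewrite addr_ge0// mulr_ge0// divr_ge0// ltW.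
rewrite -[X in _ <= X + _]mulrA -[X in _ <= _ + X]mulrA -mulrDr.
apply: ler_wpM2l; first exact: powR_ge0.
by rewrite (le_trans H)// !pV// !mulrA.
Qed.

Lemma ellp_sumZ c xi :
  (ellp_sum (c *: xi)%R <= (cabs c `^ p)%:E * ellp_sum xi)%E.
Proof.
apply: le_trans (esumZ_le (powR_ge0 _ _) (pterm_ge0 xi)).
by apply: le_esum => i _; rewrite rnormZ powRM ?rnorm_ge0 ?cabs_ge0// EFinM.
Qed.

Lemma ellp_sum_bound (a b : R) xi eta : 0 < a -> 0 < b ->
  (ellp_sum xi <= (a `^ p)%:E)%E -> (ellp_sum eta <= (b `^ p)%:E)%E ->
  (ellp_sum (xi + eta)%R <= ((a + b) `^ p)%:E)%E.
Proof.
move=> a0 b0 xa yb; have ab0 : 0 < a + b by rewrite addr_gt0.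
pose k1 := (a + b) `^ p * (a / (a + b) / a `^ p).
pose k2 := (a + b) `^ p * (b / (a + b) / b `^ p).
have k10 : 0 <= k1.
  by rewrite mulr_ge0 ?powR_ge0// !divr_ge0 ?powR_ge0// ltW.
have k20 : 0 <= k2.
  by rewrite mulr_ge0 ?powR_ge0// !divr_ge0 ?powR_ge0// ltW.
apply: (@le_trans _ _ (\esum_(i in [set: I])
    (k1%:E * (rnorm (xi i) `^ p)%:E + k2%:E * (rnorm (eta i) `^ p)%:E))%E).
  apply: le_esum => i _; rewrite -!EFinM -EFinD lee_fin.
  apply: le_trans (convex_bound a0 b0 (rnorm_ge0 _) (rnorm_ge0 _)).
  rewrite ge0_ler_powR ?nnegrE ?rnorm_ge0 ?addr_ge0 ?rnorm_ge0//.
    exact: ltW.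
  exact: ler_rnormD.
rewrite esumD; last 2 first.
- by move=> i _; rewrite mule_ge0// lee_fin.
- by move=> i _; rewrite mule_ge0// lee_fin.
apply: (@le_trans _ _ (k1%:E * (a `^ p)%:E + k2%:E * (b `^ p)%:E)%E).
  apply: leeD.
    apply: (le_trans (esumZ_le k10 (pterm_ge0 xi))).
    by apply: lee_wpmul2l => //; rewrite lee_fin.
  apply: (le_trans (esumZ_le k20 (pterm_ge0 eta))).
  by apply: lee_wpmul2l => //; rewrite lee_fin.
rewrite -!EFinM -EFinD lee_fin /k1 /k2 -!mulrA !mulVf ?gt_eqF ?powR_gt0//.
by rewrite !mulr1 -mulrDr -mulrDl mulfV ?mulr1// gt_eqF.
Qed.

Definition ellp_pred : {pred I -> V} :=
  let _ := p1 in [pred xi | `[< ellp_fun xi >]].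

Record ellp := MkEllp { ellp_val :> I -> V; _ : ellp_val \in ellp_pred }.

HB.instance Definition _ := [isSub for ellp_val].
HB.instance Definition _ := [Choice of ellp by <:].

Lemma ellpP (xi : ellp) : ellp_fun xi.
Proof. by have /asboolP := valP xi. Qed.

Definition ellp_norm (xi : I -> V) : R := (fine (ellp_sum xi)) `^ p^-1.

Let ellp_normK xi : ellp_fun xi -> ((ellp_norm xi) `^ p)%:E = ellp_sum xi.
Proof.
move=> xioo; rewrite /ellp_norm -powRrM mulVf ?gt_eqF// powRr1.
  by rewrite fineK// ge0_fin_numE// ellp_sum_ge0.
by rewrite fine_ge0// ellp_sum_ge0.
Qed.

Let ellp_sum_le (a : R) xi : 0 <= a ->
  (ellp_sum xi <= (a `^ p)%:E)%E -> ellp_norm xi <= a.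
Proof.
move=> a0 xia; rewrite /ellp_norm.
have -> : a = (a `^ p) `^ p^-1 by rewrite -powRrM mulfV ?gt_eqF// powRr1.
rewrite ge0_ler_powR ?nnegrE ?powR_ge0 ?invr_ge0 ?(ltW p_gt0)//.
  by rewrite fine_ge0// ellp_sum_ge0.
rewrite -lee_fin fineK// ge0_fin_numE ?ellp_sum_ge0//.
by rewrite (le_lt_trans xia)// ltry.
Qed.

Lemma ellp_norm_ge0 xi : 0 <= ellp_norm xi.
Proof. exact: powR_ge0. Qed.

Lemma ellp_normD xi eta : ellp_fun xi -> ellp_fun eta ->
  ellp_fun (xi + eta) /\ ellp_norm (xi + eta) <= ellp_norm xi + ellp_norm eta.
Proof.
move=> xioo etaoo.
have H e : 0 < e -> (ellp_sum (xi + eta)%R <=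
    (((ellp_norm xi + e) + (ellp_norm eta + e)) `^ p)%:E)%E.
  move=> e0; apply: ellp_sum_bound; rewrite ?ltr_wpDl ?ellp_norm_ge0//.
    rewrite -ellp_normK// lee_fin ge0_ler_powR ?nnegrE ?lerDl ?(ltW e0)//.
    - exact: ltW.
    - exact: ellp_norm_ge0.
    - by rewrite addr_ge0 ?ellp_norm_ge0// ltW.
  rewrite -ellp_normK// lee_fin ge0_ler_powR ?nnegrE ?lerDl ?(ltW e0)//.
  - exact: ltW.
  - exact: ellp_norm_ge0.
  - by rewrite addr_ge0 ?ellp_norm_ge0// ltW.
split; first by rewrite /ellp_fun (le_lt_trans (H 1 _))// ltry.
apply/ler_addgt0Pr => e e0.
have e20 : 0 < e / 2 by rewrite divr_gt0.
rewrite [e]splitr addrACA; apply: ellp_sum_le; last exact: H.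
by rewrite !addr_ge0 ?ellp_norm_ge0// ltW.
Qed.

Lemma ellp_normZ_le c xi : ellp_fun xi ->
  ellp_fun (c *: xi) /\ ellp_norm (c *: xi) <= cabs c * ellp_norm xi.
Proof.
move=> xioo; have H := ellp_sumZ c xi; split.
  by rewrite /ellp_fun (le_lt_trans H)// lte_mul_pinfty// lee_fin powR_ge0.
apply: ellp_sum_le; first by rewrite mulr_ge0 ?cabs_ge0 ?ellp_norm_ge0.
by rewrite powRM ?cabs_ge0 ?ellp_norm_ge0// EFinM ellp_normK.
Qed.

Lemma ellp_submod_closed : submod_closed ellp_pred.
Proof.
split.
  apply/asboolP; rewrite /ellp_fun /ellp_sum esum1 ?ltry// => i _.
  by rewrite rnorm0 powR0// gt_eqF.
move=> c f g /asboolP lf /asboolP lg; apply/asboolP.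
exact: (ellp_normD (ellp_normZ_le c lf).1 lg).1.
Qed.

HB.instance Definition _ :=
  GRing.isSubmodClosed.Build _ _ ellp_pred ellp_submod_closed.
HB.instance Definition _ := [SubChoice_isSubLmodule of ellp by <:].

Definition ellp_cnorm (xi : ellp) : R[i] := (ellp_norm xi)%:C.

Lemma ellp_cnormD xi eta :
  ellp_cnorm (xi + eta) <= ellp_cnorm xi + ellp_cnorm eta.
Proof.
rewrite -rmorphD/= lecR.
exact: (ellp_normD (ellpP xi) (ellpP eta)).2.
Qed.

Lemma ellp_cnormZ c xi : ellp_cnorm (c *: xi) = `|c| * ellp_cnorm xi.
Proof.
have H d (h : ellp) : ellp_norm (d *: h : ellp) <= cabs d * ellp_norm h.
  exact: (ellp_normZ_le d (ellpP h)).2.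
suff -> : ellp_cnorm (c *: xi) = (cabs c * ellp_norm xi)%:C.
  by rewrite rmorphM/= cabsC.
congr (_%:C); apply/eqP; rewrite eq_le H/=.
have [->|c0] := eqVneq c 0; first by rewrite cabs0 mul0r ellp_norm_ge0.
have nc0 : 0 < cabs c.
  by rewrite lt_def cabs_ge0 andbT; apply: contra_neq c0 => /cabs_eq0.
rewrite -ler_pdivlMl// -cabsV.
by have := H c^-1 (c *: xi); rewrite scalerK.
Qed.

Lemma ellp_cnorm0_eq0 xi : ellp_cnorm xi = 0 -> xi = 0.
Proof.
move=> /complexI xi0; apply: val_inj; apply/funext => i; apply: rnorm0_eq0.
have : (ellp_sum xi = 0)%E by rewrite -ellp_normK ?xi0 ?powR0 ?gt_eqF//; exact: ellpP.
move=> s0; have : ((rnorm (xi i) `^ p)%:E <= 0)%E.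
  rewrite -s0; apply: esum_ge; exists [set i]; last by rewrite fsbig_set1.
  by split=> //; exact: finite_set1.
rewrite lee_fin => h; have /eqP : rnorm (xi i) `^ p = 0.
  by apply: le_anti; rewrite h powR_ge0.
by rewrite powR_eq0 => /andP[/eqP].
Qed.

HB.instance Definition _ := @Lmodule_isNormed.Build R[i] ellp ellp_cnorm
  ellp_cnormD ellp_cnormZ ellp_cnorm0_eq0.

End EllP.

(* [to_bop], [to_Lp] and [to_ellp] return [0] when the given map is not a
   bounded operator, not in [L^p] or not p-summable.  For the multiplication and
   weighted shift operators below this default is never reached when [mu] is
   sigma-finite with full support (disjoint nonempty open sets are then at most
   countably many, so that continuous functions into normed spaces are strongly
   measurable) and its class is preserved by the homeomorphisms. *)

Definition to_bop (R : realType) (V : normedModType R[i]) (f : V -> V) : bop V :=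
  insubd (0 : bop V) f.

Definition to_Lp d (T : measurableType d) (R : realType)
    (mu : {measure set T -> \bar R}) (V : normedModType R[i]) (p : R)
    (p1 : 1 < p) (f : T -> V) : Lp mu V p1 :=
  (\pi_(Lp mu V p1) (insubd (0 : LpFun mu V p1) f))%qT.

Definition to_ellp (R : realType) (I : choiceType) (V : normedModType R[i])
    (p : R) (p1 : 1 < p) (xi : I -> V) : ellp I V p1 :=
  insubd (0 : ellp I V p1) xi.

(* The two-sided inverse of [u], if there is one. *)
Definition bop_inv (R : realType) (V : normedModType R[i]) (u : bop V) : bop V :=
  xget 0 [set v | v * u = 1 /\ u * v = 1].

Definition borelType (X : ptopologicalType) : Type :=
  g_sigma_algebraType (@open X).

HB.instance Definition _ (X : ptopologicalType) :=
  Measurable.on (borelType X).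

Definition msupport (R : realType) (X : ptopologicalType)
    (mu : {measure set (borelType X) -> \bar R}) : set X :=
  [set x | forall U : set X, open U -> U x -> (0 < mu U)%E].

Definition is_density d (T : measurableType d) (R : realType)
    (mu : {measure set T -> \bar R}) (nu : set T -> \bar R) (h : T -> R) : Prop :=
  [/\ measurable_fun [set: T] h, forall x, 0 <= h x &
      forall Q, measurable Q -> nu Q = (\int[mu]_(x in Q) (h x)%:E)%E].

(* A version of the Radon-Nikodym derivative of [nu] with respect to [mu]; the
   library's ['d nu '/d mu] is restricted to finite [nu]. *)
Definition density d (T : measurableType d) (R : realType)
    (mu : {measure set T -> \bar R}) (nu : set T -> \bar R) : T -> R :=
  xget (fun=> 0) [set h | is_density mu nu h].

Section Groups.
Context (R : realType) (G : groupType).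

Definition bounded_family (f : G -> R[i]) : Prop :=
  exists M : R, forall g, cabs (f g) <= M.

Definition left_invariant_mean (m : (G -> R[i]) -> R[i]) : Prop :=
  [/\ forall (c : R[i]) f h, bounded_family f -> bounded_family h ->
        m (fun g => c * f g + h g) = c * m f + m h,
      m (fun=> 1) = 1,
      forall f, bounded_family f -> (forall g, 0 <= f g) -> 0 <= m f &
      forall g0 f, bounded_family f -> m (fun g => f (g0 * g)%g) = m f].

Definition amenable : Prop := exists m, left_invariant_mean m.

Definition group_character (chi : G -> R[i]) : Prop :=
  (forall g h, chi (g * h)%g = chi g * chi h) /\ (forall g, `|chi g| = 1).

End Groups.

Definition topologically_free (G : groupType) (X : topologicalType)
    (t : G -> X -> X) : Prop :=
  forall g, g != 1%g -> interior [set x | t g x = x] = set0.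

(* The coefficients in [A] act on [W] through [M]. *)

Section GeneratedAlgebra.
Context (R : realType) (G : groupType) (A W : normedModType R[i]).
Context (M : A -> bop W) (T : G -> bop W).

Definition fin_sum (F : {fset G}) (a : G -> A) : bop W :=
  \sum_(g <- F) M (a g) * T g.

Definition fin_coef (F : {fset G}) (a : G -> A) (g : G) : A :=
  if g \in F then a g else 0.

Definition gen_algebra : set (bop W) :=
  closure [set b | exists F a, b = fin_sum F a].

Definition prop_star : Prop :=
  forall F a, `|fin_coef F a 1%g| <= `|fin_sum F a|.

(* [N g] is the continuous extension to [gen_algebra] of the map sending a finite
   sum to its coefficient at [g]; its values off [gen_algebra] are irrelevant. *)
Definition prop_star_star : Prop :=
  prop_star /\
  exists N : G -> bop W -> A,
    [/\ forall g, {within gen_algebra, continuous (N g)},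
        forall g F a, N g (fin_sum F a) = fin_coef F a g &
        forall b, gen_algebra b -> (b = 0 <-> forall g, N g b = 0)].

End GeneratedAlgebra.

Definition isometric_isomorphism (R : realType) (V W : normedModType R[i])
    (B1 : set (bop V)) (B2 : set (bop W)) (Phi : bop V -> bop W) : Prop :=
  [/\ set_bij B1 B2 Phi,
      forall c u v, B1 u -> B1 v -> Phi (c *: u + v) = c *: Phi u + Phi v,
      forall u v, B1 u -> B1 v -> Phi (u * v) = Phi u * Phi v &
      forall u, B1 u -> `|Phi u| = `|u|].

Section WeightedShifts.
Context (R : realType) (X : ptopologicalType).
Context (mu : {measure set (borelType X) -> \bar R}).
Context (E : normedModType R[i]) (p : R) (p1 : 1 < p).
Context (G : groupType) (t : G -> X -> X).

Local Notation D := (Lp mu E p1).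
Local Notation A := (bcont X (bop E)).
Local Notation H := (ellp G D p1).

Definition mul_op (a : A) : bop D :=
  to_bop (fun f : D => to_Lp mu p1 (fun x => a x (repr f x))).

(* [pushforward mu (t g)] is the measure [Q |-> mu (t g @^-1` Q)]. *)
Definition shift_op (g : G) : bop D :=
  to_bop (fun f : D => to_Lp mu p1 (fun x =>
    (density mu (pushforward mu (t g : borelType X -> borelType X)) x
       `^ p^-1)%:C *: repr f (t g^-1%g x))).

Definition hat_op (g : G) (u : bop D) : bop D :=
  shift_op g * u * bop_inv (shift_op g).

Definition bar_op (a : A) : bop H :=
  to_bop (fun xi : H => to_ellp p1 (fun g => hat_op g (mul_op a) (xi g))).

Definition regular_op (g0 : G) : bop H :=
  to_bop (fun xi : H => to_ellp p1 (fun g => xi (g * g0)%g)).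

End WeightedShifts.

(* Main.v *)
Require Import Defs.
From HB Require Import structures.
From mathcomp Require Import all_boot all_order all_algebra finmap complex.
From mathcomp Require Import all_classical all_reals all_analysis.
From mathcomp Require Import measurable_realfun ring lra.

Set Implicit Arguments.
Unset Strict Implicit.
Unset Printing Implicit Defensive.

Import Order.TTheory GRing.Theory Num.Theory.
Import numFieldNormedType.Exports.

Local Open Scope classical_set_scope.
Local Open Scope ring_scope.
Local Open Scope complex_scope.

(** A finite sum b = sum_g a_g T_g acts on D, and its regular representation
bb = sum_g abar_g V_g acts on families xi : G -> D by

  (bb xi)(h) = sum_g (a_g o t_h^-1) xi(h g).

Everything follows from the equality of norms |b| = |bb| on finite sums and from
the estimate |a_g| <= |b|.

The inequality |b| <= |bb| uses amenability ([opnorm_le_bar]).  Given f in D and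
a nonnegative finitely supported c on G with sum_h c(h)^p = 1, the family
xi(h) = c(h) T_h f has norm |f| because the T_h are isometries, and
c(h) T_h (b f) differs from (bb xi)(h) by the terms (c(h) - c(h g)) T_h a_g T_g f.
Reiter functions, that is, nonnegative functions of sum one that are almost
invariant under right translation by finitely many given g, make the error
arbitrarily small when c is their p-th root.  They exist ([reiter]) because
otherwise a Hahn-Banach argument would give bounded functions u_g with
sum_g (u_g(x g^-1) - u_g(x)) >= c > 0 for all x, and an invariant mean
annihilates the left side.

The inequality |bb| <= |b| uses topological freeness ([bar_bound]).  Over a point
x, the operator bb acts on finitely supported eta : G -> E through its symbol
h |-> sum_g a_g(t_h^-1 x) eta(h g).  Near any point there is an open set W whose
translates t_h^-1 W, for h in a given finite set, are disjoint; choosing in W a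
set S of finite positive measure, the function f = sum_k T_k^-1 (1_S eta(k))
consists of pieces with disjoint supports, so that its norm is known, and
T_h (b f) is the symbol on S.  Comparing |b f| with |f| bounds an average of the
symbol over S, and continuity turns this into a bound at the point
([pointwise_bound]).  Integrating it over X gives |bb| <= |b|, and evaluating
it on an eta with a single nonzero value gives |a_g| <= |b| ([coef_bound]).

The correspondence of b with bb and the coefficient maps are thus contractive on
finite sums and extend to the norm closures by completeness of L(D), of L(H) and
of A ([graph_ext]), which rests on the Riesz-Fischer theorem for the Bochner
space ([Lp_seq_complete]).  If all coefficients of b vanish, then so do the
matrix entries of bb, hence bb = 0 and b = 0 ([coef_eq0]).  Multiplying a_g by
chi(g) conjugates bb by the diagonal isometry with entries chi(h), which leaves
its norm, and so the norm of b, unchanged ([covariant_character]).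

That the T_g are isometries with T_(gh) = T_g T_h is the change of variables for
Radon-Nikodym derivatives, together with their almost everywhere uniqueness.
Multiplication by a in A is defined on D because continuous functions on X are
strongly measurable: for a sigma-finite measure of full support, a disjoint
family of nonempty open sets is countable. *)

(** * Convergence, completeness and operator norms *)

Section RealNormConvergence.
Context (R : realType) (V : normedModType R[i]).
Implicit Types (u v : V).

Lemma rnorm_le (u : V) (e : R) : (`|u| <= e%:C) = (rnorm u <= e).
Proof. by rewrite -rnormC lecR. Qed.

Lemma rnorm_lt (u : V) (e : R) : (`|u| < e%:C) = (rnorm u < e).
Proof. by rewrite -rnormC ltcR. Qed.

Lemma rnormB u v : rnorm (u - v) = rnorm (v - u).
Proof. by rewrite -rnormN opprB. Qed.

Lemma ler_rnorm_sum (I : Type) (s : seq I) (P : pred I) (F : I -> V) :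
  rnorm (\sum_(i <- s | P i) F i) <= \sum_(i <- s | P i) rnorm (F i).
Proof.
elim/big_rec2: _ => [|i y x _ xy]; first by rewrite rnorm0.
by rewrite (le_trans (ler_rnormD _ _))// lerD.
Qed.

Lemma rnorm_dist3 w u v : rnorm (u - v) <= rnorm (u - w) + rnorm (w - v).
Proof. by rewrite -[u - v](subrKA w) ler_rnormD. Qed.

Lemma pos_complex (e : R[i]) : 0 < e -> e = (complex.Re e)%:C /\ 0 < complex.Re e.
Proof.
case: e => a b; rewrite ltcE /= => /andP[/eqP b0 a0]; split => //.
by rewrite b0.
Qed.

Lemma closureRP (S : set V) b :
  closure S b <-> forall e : R, 0 < e -> exists2 s, S s & rnorm (b - s) <= e.
Proof.
split=> [clS e e0|clS].
  have eC0 : 0 < e%:C by rewrite ltcR.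
  have [s [Ss bs]] := clS _ (nbhsx_ballx b e%:C eC0).
  by exists s => //; move: bs; rewrite -ball_normE /ball_/= rnorm_lt => /ltW.
move=> B /nbhs_ballP[e /= /pos_complex[eE e0]] ballB.
have [s Ss bs] := clS _ (divr_gt0 e0 (@ltr0n R 2)).
exists s; split => //; apply: ballB; rewrite -ball_normE /ball_/= eE rnorm_lt.
by rewrite (le_lt_trans bs)// ltr_pdivrMr// ltr_pMr// ltr1n.
Qed.

(** Convergence and completeness are used only along sequences, with real
bounds; this avoids transporting filters through the complex-valued norm. *)
Definition rlim (u : nat -> V) (l : V) : Prop :=
  forall e : R, 0 < e -> exists N, forall n, (N <= n)%N -> rnorm (u n - l) <= e.

Definition rcauchy (u : nat -> V) : Prop :=
  forall e : R, 0 < e -> exists N, forall m n, (N <= m)%N -> (N <= n)%N ->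
    rnorm (u m - u n) <= e.

Lemma rlimP (u : nat -> V) l : rlim u l <-> u n @[n --> \oo] --> l.
Proof.
split=> [ul|ul e e0].
  apply/cvgrPdist_le => e /pos_complex[-> e0].
  have [N Nu] := ul _ e0; near=> n.
  by rewrite rnorm_le rnormB Nu//; near: n; exists N.
have /cvgrPdist_le/(_ e%:C) := ul; rewrite ltcR => /(_ e0)[N _ Nu].
by exists N => n Nn; rewrite rnormB -rnorm_le; exact: Nu.
Unshelve. all: by end_near. Qed.

Lemma rlim_dist_le (u : nat -> V) l c (e : R) N : rlim u l ->
  (forall n, (N <= n)%N -> rnorm (u n - c) <= e) -> rnorm (l - c) <= e.
Proof.
move=> ul uc; apply/ler_addgt0Pr => d d0; have [N' N'u] := ul _ d0.
rewrite (le_trans (rnorm_dist3 (u (maxn N N')) _ _))// addrC lerD//.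
  by rewrite uc// leq_maxl.
by rewrite rnormB N'u// leq_maxr.
Qed.

Lemma rlim_unique (u : nat -> V) l l' : rlim u l -> rlim u l' -> l = l'.
Proof.
move=> ul ul'; apply/eqP; rewrite -subr_eq0; apply/eqP/rnorm0_eq0/le_anti.
rewrite rnorm_ge0 andbT; apply/ler_addgt0Pr => e e0; rewrite add0r.
by have [N Nu] := ul' _ e0; exact: (rlim_dist_le ul Nu).
Qed.

Lemma rlim_lin c (u v : nat -> V) l l' : rlim u l -> rlim v l' ->
  rlim (fun n => c *: u n + v n) (c *: l + l').
Proof.
move=> ul vl e e0.
have c1 : 0 < cabs c + 1 by rewrite ltr_wpDl ?cabs_ge0.
have [N Nu] := ul _ (divr_gt0 (divr_gt0 e0 (ltr0n _ 2)) c1).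
have [N' N'v] := vl _ (divr_gt0 e0 (@ltr0n R 2)).
exists (maxn N N') => n; rewrite geq_max => /andP[Nn N'n].
rewrite opprD addrACA -scalerBr (le_trans (ler_rnormD _ _))// [e]splitr.
rewrite lerD ?N'v// rnormZ (le_trans (ler_wpM2l (cabs_ge0 _) (Nu _ Nn)))//.
rewrite mulrA ler_pdivrMr// mulrC ler_wpM2l ?divr_ge0 ?(ltW e0)//.
by rewrite lerDl.
Qed.

End RealNormConvergence.

Definition seq_complete (R : realType) (V : normedModType R[i]) : Prop :=
  forall u : nat -> V, rcauchy u -> exists l, rlim u l.

Lemma completeNormed_seq_complete (R : realType) (E : completeNormedModType R[i]) :
  seq_complete E.
Proof.
move=> u cu.
suff : cvg (u n @[n --> \oo]) by move=> /cvg_ex[l ul]; exists l; apply/rlimP.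
apply: cauchy_cvg; apply/cauchyP => e /pos_complex[-> e0].
have [N Nu] := cu _ (divr_gt0 e0 (@ltr0n R 2)).
exists (u N); exists N => // n /= Nn.
rewrite -ball_normE /ball_/= rnorm_lt (le_lt_trans (Nu _ _ _ Nn))//.
by rewrite ltr_pdivrMr// ltr_pMr// ltr1n.
Qed.

Section OperatorNorm.
Context (R : realType) (V : normedModType R[i]).
Implicit Types u v : bop V.

Lemma rnorm_bop u : rnorm u = opnorm u. Proof. by []. Qed.

Lemma bop_mapD u x y : u (x + y) = u x + u y.
Proof. by have [lu _] := bopP u; have := lu 1 x y; rewrite !scale1r. Qed.

Lemma bop_mapN u x : u (- x) = - u x.
Proof. by rewrite -scaleN1r bop_mapZ scaleN1r. Qed.

Lemma bop_mapB u x y : u (x - y) = u x - u y.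
Proof. by rewrite bop_mapD bop_mapN. Qed.

Lemma bop_map_sum u (I : Type) (s : seq I) (P : pred I) (F : I -> V) :
  u (\sum_(i <- s | P i) F i) = \sum_(i <- s | P i) u (F i).
Proof. by apply: (big_morph u (bop_mapD u) (bop_map0 u)). Qed.

Lemma bopN u x : (- u : bop V) x = - u x. Proof. by []. Qed.

Lemma bop_sumE (I : Type) (s : seq I) (P : pred I) (F : I -> bop V) x :
  (\sum_(i <- s | P i) F i : bop V) x = \sum_(i <- s | P i) F i x.
Proof. by apply: (big_morph (fun u : bop V => u x)). Qed.

Lemma bopM u v x : (u * v : bop V) x = u (v x). Proof. by []. Qed.

Lemma opnorm_le u (c : R) : 0 <= c ->
  (forall x, rnorm (u x) <= c * rnorm x) -> opnorm u <= c.
Proof.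
move=> c0 uc; apply: opnorm_lub => x x1; rewrite (le_trans (uc x))//.
by rewrite ler_piMr.
Qed.

Lemma opnormM u v : opnorm (u * v) <= opnorm u * opnorm v.
Proof.
apply: opnorm_le => [|x]; first by rewrite mulr_ge0 ?opnorm_ge0.
rewrite bopM (le_trans (le_opnorm _ _))// -mulrA ler_wpM2l ?opnorm_ge0//.
exact: le_opnorm.
Qed.

Lemma bop_seq_complete : seq_complete V -> seq_complete (bop V).
Proof.
move=> Vc u cu.
have cux x : rcauchy (fun n => u n x).
  move=> e e0; have x1 : 0 < rnorm x + 1 by rewrite ltr_wpDl ?rnorm_ge0.
  have [N Nu] := cu _ (divr_gt0 e0 x1); exists N => m n Nm Nn.
  rewrite (le_trans (le_opnorm (u m - u n) x))//.
  have := Nu _ _ Nm Nn; rewrite rnorm_bop => /(ler_wpM2r (rnorm_ge0 x)).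
  move=> /le_trans; apply; rewrite -mulrAC ler_pdivrMr// ler_wpM2l ?(ltW e0)//.
  by rewrite lerDl.
have [L uL] := choice (fun x => Vc _ (cux x)).
have [N1 N1u] := cu 1 ltr01.
have Lb : bounded_linear L.
  split=> [c x y|].
    apply: rlim_unique (uL _) _.
    rewrite (_ : (fun n => _) = fun n => c *: u n x + u n y).
      exact: rlim_lin.
    by apply/funext => n; rewrite bop_mapD bop_mapZ.
  exists (opnorm (u N1) + 1) => x.
  rewrite mulrDl -[L x](subrK (u N1 x)) addrC (le_trans (ler_rnormD _ _))//.
  rewrite lerD ?le_opnorm//.
  apply: (rlim_dist_le (N := N1) (uL x)) => n Nn.
  rewrite (le_trans (le_opnorm (u n - u N1) x))// ler_wpM2r ?rnorm_ge0//.
  by apply: N1u.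
have Lp : L \in @bop_pred R V by apply/asboolP.
exists (Bop Lp) => e e0; have [N Nu] := cu _ e0; exists N => n Nn.
apply: opnorm_le => [|x]; first exact: ltW.
change (rnorm (u n x - L x) <= e * rnorm x); rewrite rnormB.
apply: (rlim_dist_le (N := N) (uL x)) => m Nm.
rewrite (le_trans (le_opnorm (u m - u n) x))// ler_wpM2r ?rnorm_ge0//.
by apply: Nu.
Qed.

End OperatorNorm.

Section BcontComplete.
Context (R : realType) (X : ptopologicalType) (V : normedModType R[i]).

Lemma bcont_seq_complete : seq_complete V -> seq_complete (bcont X V).
Proof.
move=> Vc u cu.
have cux x : rcauchy (fun n => u n x).
  move=> e e0; have [N Nu] := cu _ e0; exists N => m n Nm Nn.
  exact: le_trans (supnorm_ub (u m - u n) x) (Nu _ _ Nm Nn).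
have [L uL] := choice (fun x => Vc _ (cux x)).
have uLx (e : R) : 0 < e ->
    exists N, forall n, (N <= n)%N -> forall x, rnorm (L x - u n x) <= e.
  move=> e0; have [N Nu] := cu _ e0; exists N => n Nn x.
  apply: (rlim_dist_le (N := N) (uL x)) => m Nm.
  exact: le_trans (supnorm_ub (u m - u n) x) (Nu _ _ Nm Nn).
have Lb : bounded_continuous L.
  split.
    move=> x; apply/cvgrPdist_le => e /pos_complex[-> e0].
    have e30 : 0 < complex.Re e / 3 by rewrite divr_gt0.
    have [N /(_ N (leqnn N)) Nu] := uLx _ e30.
    have [cN _] := bcontP (u N).
    have /cvgrPdist_le /(_ (complex.Re e / 3)%:C) := cN x.
    rewrite ltcR => /(_ e30); apply: filterS => y; rewrite !rnorm_le => uxy.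
    rewrite (le_trans (rnorm_dist3 (u N x) _ _))//.
    have -> : complex.Re e =
        complex.Re e / 3 + (complex.Re e / 3 + complex.Re e / 3) by field.
    rewrite lerD//.
    by rewrite (le_trans (rnorm_dist3 (u N y) _ _))// lerD// rnormB.
  have [N /(_ N (leqnn N)) Nu] := uLx _ ltr01.
  exists (1 + supnorm (u N)) => x; rewrite -[L x](subrK (u N x)).
  by rewrite (le_trans (ler_rnormD _ _))// lerD// supnorm_ub.
have Lp : L \in @bcont_pred R X V by apply/asboolP.
exists (Bcont Lp) => e e0; have [N Nu] := uLx _ e0; exists N => n Nn.
by apply: supnorm_lub => x; rewrite rnormB; exact: Nu.
Qed.

End BcontComplete.

(** * Extending contractive linear relations to closures *)

(** The maps to be extended are given on finite sums through their coefficients,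
which the sum does not visibly determine.  Taking a linear relation in place of a
function postpones that question: the bound [Gr_le] makes the closed relation
single-valued, and completeness of the target makes it total on the closure of
the domain. *)
Section GraphExtension.
Context (R : realType) (U W : normedModType R[i]) (Gr : U -> W -> Prop).
Hypothesis Gr_lin : forall c u v u' v',
  Gr u u' -> Gr v v' -> Gr (c *: u + v) (c *: u' + v').
Hypothesis Gr_le : forall u u', Gr u u' -> rnorm u' <= rnorm u.

Definition graph_closure (u : U) (u' : W) : Prop :=
  forall e : R, 0 < e ->
    exists v v', [/\ Gr v v', rnorm (u - v) <= e & rnorm (u' - v') <= e].

Lemma graph_closure_sub u u' : Gr u u' -> graph_closure u u'.
Proof.
by move=> uu e e0; exists u, u'; split; rewrite // subrr rnorm0 ltW.
Qed.

Lemma graph_closure_le u u' : graph_closure u u' -> rnorm u' <= rnorm u.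
Proof.
move=> uu; apply/ler_addgt0Pr => e e0.
have [v [v' [vv uv uv']]] := uu _ (divr_gt0 e0 (@ltr0n R 2)).
rewrite -[u'](subrK v') (le_trans (ler_rnormD _ _))// [e]splitr addrA addrC.
rewrite lerD// (le_trans (Gr_le vv))// -[v](subrK u) addrC.
by rewrite (le_trans (ler_rnormD _ _))// lerD// rnormB.
Qed.

Lemma graph_closure_lin c u v u' v' : graph_closure u u' ->
  graph_closure v v' -> graph_closure (c *: u + v) (c *: u' + v').
Proof.
move=> uu vv e e0; have c1 : 0 < cabs c + 1 by rewrite ltr_wpDl ?cabs_ge0.
have e2 := divr_gt0 e0 (@ltr0n R 2).
have [a [a' [aa ua ua']]] := uu _ (divr_gt0 e2 c1).
have [b [b' [bb vb vb']]] := vv _ e2.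
have H (Z : normedModType R[i]) (x y s t : Z) :
    rnorm (x - s) <= e / 2 / (cabs c + 1) -> rnorm (y - t) <= e / 2 ->
    rnorm (c *: x + y - (c *: s + t)) <= e.
  move=> xs yt; rewrite opprD addrACA -scalerBr (le_trans (ler_rnormD _ _))//.
  rewrite [leRHS]splitr lerD// rnormZ.
  rewrite (le_trans (ler_wpM2l (cabs_ge0 _) xs))//.
  rewrite mulrA ler_pdivrMr// mulrC ler_wpM2l ?divr_ge0 ?(ltW e0)//.
  by rewrite lerDl.
by exists (c *: a + b), (c *: a' + b'); split; [exact: Gr_lin|exact: H|exact: H].
Qed.

(** By linearity the difference of two values is related to [0]. *)
Lemma graph_closure_unique u u' u'' :
  graph_closure u u' -> graph_closure u u'' -> u' = u''.
Proof.
move=> uu' uu''; have := graph_closure_le (graph_closure_lin (-1) uu' uu'').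
rewrite !scaleN1r addNr rnorm0 => h; apply/esym/eqP; rewrite -subr_eq0 addrC.
by apply/eqP/rnorm0_eq0/le_anti; rewrite h rnorm_ge0.
Qed.

Lemma graph_closure_ex u : seq_complete W ->
  closure [set v | exists v', Gr v v'] u -> exists u', graph_closure u u'.
Proof.
move=> Wc /closureRP clu.
have /choice[s sP] n : exists v : U * W, Gr v.1 v.2 /\ rnorm (u - v.1) <= n.+1%:R^-1.
  have n0 : 0 < n.+1%:R^-1 :> R by rewrite invr_gt0 ltr0n.
  have [v [v' vv] uv] := clu _ n0.
  by exists (v, v').
have small (e : R) : 0 < e -> exists N, forall n, (N <= n)%N ->
    rnorm (u - (s n).1) <= e.
  move=> e0; have [N Ne] : exists N : nat, N.+1%:R^-1 < e.
    have /ltr_add_invr[N] := e0; rewrite add0r => ?; exists N => //.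
  exists N => n Nn; rewrite (le_trans (sP n).2)// (le_trans _ (ltW Ne))//.
  by rewrite lef_pV2 ?posrE ?ltr0n// ler_nat.
have [l sl] : exists l, rlim (fun n => (s n).2) l.
  apply: Wc => e e0; have [N Nu] := small _ (divr_gt0 e0 (@ltr0n R 2)).
  exists N => m n Nm Nn; have := Gr_le (Gr_lin (-1) (sP n).1 (sP m).1).
  rewrite !scaleN1r addrC => /le_trans; apply; rewrite addrC.
  rewrite (le_trans (rnorm_dist3 u _ _))// [leRHS]splitr lerD ?Nu//.
  by rewrite rnormB Nu.
exists l => e e0; have [N Nu] := small _ e0; have [N' N'l] := sl _ e0.
exists (s (maxn N N')).1, (s (maxn N N')).2; split; first exact: (sP _).1.
  by rewrite Nu// leq_maxl.
by rewrite rnormB N'l// leq_maxr.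
Qed.

Lemma graph_closure_dom u u' :
  graph_closure u u' -> closure [set v | exists v', Gr v v'] u.
Proof.
by move=> uu; apply/closureRP => e /uu[v [v' [vv uv _]]]; exists v => //; exists v'.
Qed.

Definition graph_ext (u : U) : W := xget 0 [set u' | graph_closure u u'].

Lemma graph_extP u : seq_complete W ->
  closure [set v | exists v', Gr v v'] u -> graph_closure u (graph_ext u).
Proof.
move=> Wc /(graph_closure_ex Wc)[u' uu'].
by have := @xgetI W 0 [set u' | graph_closure u u'] u' uu'.
Qed.

Lemma graph_extE u u' : graph_closure u u' -> graph_ext u = u'.
Proof.
move=> uu; apply/esym/(graph_closure_unique uu).
by have := @xgetI W 0 [set u' | graph_closure u u'] u' uu.
Qed.

End GraphExtension.

(** * The space of p-summable families *)

Section SummableFamilies.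
Context (R : realType) (I : choiceType) (V : normedModType R[i]).
Context (p : R) (p1 : 1 < p).
Local Notation H := (ellp I V p1).
Implicit Types xi eta : H.

Let p_gt0 : 0 < p. Proof. exact: lt_trans p1. Qed.

Lemma powR_inj_ge0 (a b : R) : 0 <= a -> 0 <= b -> a `^ p <= b `^ p -> a <= b.
Proof.
move=> a0 b0; apply: contraTT; rewrite -!ltNge => ba.
by apply: gt0_ltr_powR => //; rewrite nnegrE.
Qed.

Lemma powR_mono (a b : R) : 0 <= a -> a <= b -> a `^ p <= b `^ p.
Proof.
move=> a0 ab; apply: ge0_ler_powR => //; first exact: ltW.
by rewrite nnegrE (le_trans a0 ab).
Qed.

Lemma powR_invK (a : R) : 0 <= a -> (a `^ p^-1) `^ p = a.
Proof. by move=> a0; rewrite -powRrM mulVf ?gt_eqF// powRr1. Qed.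

Lemma powRK_inv (a : R) : 0 <= a -> (a `^ p) `^ p^-1 = a.
Proof. by move=> a0; rewrite -powRrM mulfV ?gt_eqF// powRr1. Qed.

Lemma rnorm_ellp xi : rnorm xi = ellp_norm p xi. Proof. by []. Qed.

Lemma ellp_sumE xi : ellp_sum p xi = (rnorm xi `^ p)%:E.
Proof.
rewrite rnorm_ellp /ellp_norm powR_invK ?fine_ge0 ?ellp_sum_ge0//.
by rewrite fineK// ge0_fin_numE ?ellp_sum_ge0//; exact: ellpP.
Qed.

Lemma ellp_fset_le xi (K : {fset I}) :
  \sum_(i <- K) rnorm (xi i) `^ p <= rnorm xi `^ p.
Proof.
rewrite -lee_fin -ellp_sumE -sumEFin.
rewrite (@fsbig_seq _ _ _ _ _ _ (fset_uniq K)).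
by apply: ereal_sup_ubound; exists [set` K].
Qed.

Lemma ellp_coord_le xi i : rnorm (xi i) <= rnorm xi.
Proof.
apply: powR_inj_ge0; rewrite ?rnorm_ge0//.
by have := ellp_fset_le xi [fset i]%fset; rewrite big_seq_fset1.
Qed.

Lemma ellp_bound (f : I -> V) (c : R) : 0 <= c ->
  (forall K : {fset I}, \sum_(i <- K) rnorm (f i) `^ p <= c `^ p) ->
  ellp_fun p f /\ ellp_norm p f <= c.
Proof.
move=> c0 fc.
have fcE : (ellp_sum p f <= (c `^ p)%:E)%E.
  apply: ge_ereal_sup => _ [K [fK _] <-].
  by rewrite fsbig_finite//= sumEFin lee_fin fc.
split; first by rewrite /ellp_fun (le_lt_trans fcE)// ltry.
rewrite -(powRK_inv c0); apply: ge0_ler_powR.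
- by rewrite invr_ge0 ltW.
- by rewrite nnegrE fine_ge0// ellp_sum_ge0.
- by rewrite nnegrE powR_ge0.
rewrite -lee_fin fineK// ge0_fin_numE ?ellp_sum_ge0//.
by rewrite (le_lt_trans fcE)// ltry.
Qed.

Lemma ellp_norm_bound xi (c : R) : 0 <= c ->
  (forall K : {fset I}, \sum_(i <- K) rnorm (xi i) `^ p <= c `^ p) ->
  rnorm xi <= c.
Proof. by move=> c0 /(ellp_bound c0)[]. Qed.

Lemma to_ellpE (f : I -> V) : ellp_fun p f -> (to_ellp p1 f : I -> V) = f.
Proof.
by move=> ff; rewrite /to_ellp /insubd insubT//=; apply/asboolP.
Qed.

Lemma ellp_ext xi eta : (forall i, xi i = eta i) -> xi = eta.
Proof. by move=> xe; apply: val_inj; apply/funext. Qed.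

Lemma ellpBE xi eta i : (xi - eta) i = xi i - eta i. Proof. by []. Qed.
Lemma ellpDE xi eta i : (xi + eta) i = xi i + eta i. Proof. by []. Qed.
Lemma ellpZE c xi i : (c *: xi) i = c *: xi i. Proof. by []. Qed.
Lemma ellp_sumfE (J : Type) (s : seq J) (P : pred J) (F : J -> H) i :
  (\sum_(j <- s | P j) F j) i = \sum_(j <- s | P j) F j i.
Proof. by apply: (big_morph (fun xi : H => xi i)). Qed.

Lemma ellp_of_finite_support (f : I -> V) (K : {fset I}) :
  (forall i, i \notin K -> f i = 0) ->
  ellp_fun p f /\ rnorm (to_ellp p1 f) `^ p = \sum_(i <- K) rnorm (f i) `^ p.
Proof.
move=> f0; have s0 : 0 <= \sum_(i <- K) rnorm (f i) `^ p.
  by apply: sumr_ge0 => i _; rewrite powR_ge0.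
have fle (K' : {fset I}) :
    \sum_(i <- K') rnorm (f i) `^ p <= \sum_(i <- K) rnorm (f i) `^ p.
  have f0' i : i \notin K -> rnorm (f i) `^ p = 0.
    by move=> /f0->; rewrite rnorm0 powR0 ?gt_eqF.
  rewrite (big_fsetID _ (mem K))/= [X in _ + X]big1_fset ?addr0; last first.
    by move=> i; rewrite !inE/= => /andP[_ /f0'].
  rewrite [leRHS](big_fsetID _ (mem K'))/=.
  rewrite (_ : [fset x in K' | x \in K] = [fset x in K | x \in K'])%fset.
    by rewrite lerDl sumr_ge0// => i _; rewrite powR_ge0.
  by apply/fsetP => i; rewrite !inE/= andbC.
have ff : ellp_fun p f /\
    ellp_norm p f <= (\sum_(i <- K) rnorm (f i) `^ p) `^ p^-1.
  by apply: ellp_bound => [|K']; rewrite ?powR_ge0// powR_invK.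
split; first exact: ff.1.
apply/le_anti/andP; split; last first.
  by have := ellp_fset_le (to_ellp p1 f) K; rewrite to_ellpE//; exact: ff.1.
rewrite -[leRHS](powR_invK s0) powR_mono ?rnorm_ge0//.
by rewrite rnorm_ellp to_ellpE ?ff.2//; exact: ff.1.
Qed.

(** The triangle inequality of [ellp], for families cut off outside [K]. *)
Lemma minkowski_fset (K : {fset I}) (f g : I -> V) (c d : R) :
  0 <= c -> 0 <= d ->
  \sum_(i <- K) rnorm (f i) `^ p <= c `^ p ->
  \sum_(i <- K) rnorm (g i) `^ p <= d `^ p ->
  \sum_(i <- K) rnorm (f i + g i) `^ p <= (c + d) `^ p.
Proof.
move=> c0 d0 fc gd.
pose cut (f : I -> V) i := if i \in K then f i else 0.
have cut0 (k : I -> V) i : i \notin K -> cut k i = 0.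
  by rewrite /cut => /negbTE->.
have cutK (k : I -> V) i : i \in K -> cut k i = k i by rewrite /cut => ->.
have cutE (k : I -> V) : rnorm (to_ellp p1 (cut k)) `^ p =
    \sum_(i <- K) rnorm (k i) `^ p.
  rewrite (ellp_of_finite_support (cut0 k)).2; apply: eq_big_seq => i iK.
  by rewrite cutK.
have cutD : to_ellp p1 (cut (fun i => f i + g i)) =
    to_ellp p1 (cut f) + to_ellp p1 (cut g).
  apply: ellp_ext => i; rewrite ellpDE.
  rewrite (to_ellpE (ellp_of_finite_support (cut0 f)).1).
  rewrite (to_ellpE (ellp_of_finite_support (cut0 g)).1).
  rewrite (to_ellpE (ellp_of_finite_support (cut0 (fun i => f i + g i))).1).
  by rewrite /cut; case: ifP => // _; rewrite addr0.
move: fc gd; rewrite -!cutE => fc gd; rewrite cutD.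
apply: powR_mono; first exact: rnorm_ge0.
rewrite (le_trans (ler_rnormD _ _))// lerD//.
  exact: powR_inj_ge0 (rnorm_ge0 _) c0 fc.
exact: powR_inj_ge0 (rnorm_ge0 _) d0 gd.
Qed.

(** The limit is taken coordinatewise.  On a finite set [K] of coordinates, the
distance of the limit to [u n] is at most that of a late [u m] to [u n] plus an
error [d] coming from the finitely many coordinates in [K]. *)
Lemma ellp_seq_complete : seq_complete V -> seq_complete H.
Proof.
move=> Vc u cu.
have cui i : rcauchy (fun n => u n i).
  move=> e e0; have [N Nu] := cu _ e0; exists N => m n Nm Nn.
  exact: le_trans (ellp_coord_le (u m - u n) i) (Nu _ _ Nm Nn).
have [L uL] := choice (fun i => Vc _ (cui i)).
have uLx (e : R) : 0 < e -> exists N, forall n, (N <= n)%N ->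
    forall K : {fset I}, \sum_(i <- K) rnorm (L i - u n i) `^ p <= e `^ p.
  move=> e0; have [N Nu] := cu _ e0; exists N => n Nn K.
  apply/ler_addgt0Pr => d' d'0.
  (* d is chosen so that enlarging e to d + e costs at most d' after taking p-th
     powers. *)
  have [d d0 dle] : exists2 d : R, 0 < d & (d + e) `^ p <= e `^ p + d'.
    have : (e `^ p + d') `^ p^-1 - e > 0.
      rewrite subr_gt0 -[ltLHS](powRK_inv (ltW e0)).
      by apply: gt0_ltr_powR; rewrite ?invr_gt0 ?nnegrE ?addr_ge0 ?powR_ge0
        ?ltrDl// ltW.
    move=> h; exists ((e `^ p + d') `^ p^-1 - e) => //.
    by rewrite subrK powR_invK// addr_ge0 ?powR_ge0// ltW.
  apply: le_trans dle.
  pose k := #|`K|.+1%:R : R.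
  have k0 : 0 < k by rewrite ltr0n.
  have dk : 0 < d / k by rewrite divr_gt0.
  have [M Mu] : exists M, forall i, i \in K -> forall m, (M <= m)%N ->
      rnorm (u m i - L i) <= d / k.
    have [Mi MiP] := choice (fun i => uL i _ dk).
    exists (\max_(i <- K) Mi i) => i iK m mM; apply: MiP.
    by apply: leq_trans mM; rewrite (big_fsetD1 i)//= leq_maxl.
  pose m := maxn N M.
  have -> : \sum_(i <- K) rnorm (L i - u n i) `^ p =
      \sum_(i <- K) rnorm ((L i - u m i) + (u m i - u n i)) `^ p.
    by apply: eq_bigr => i _; rewrite subrKA.
  apply: minkowski_fset; [exact: ltW|exact: ltW| |].
    have -> : d `^ p = k `^ p * (d / k) `^ p.
      by rewrite -powRM ?(ltW k0) ?(ltW dk)// mulrC divfK// gt_eqF.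
    have kp : #|`K|%:R <= k `^ p.
      rewrite (le_trans (_ : _ <= k))// ?ler_nat//.
      rewrite -[leLHS]powRr1 ?(ltW k0)// ler_powR// ?(ltW p1)//.
      by rewrite /k ler1n.
    apply: (@le_trans _ _ (\sum_(i <- K) (d / k) `^ p)).
      rewrite big_seq [leRHS]big_seq; apply: ler_sum => i iK; rewrite powR_mono ?rnorm_ge0// rnormB.
      by rewrite Mu// leq_maxr.
    rewrite big_const_seq count_predT iter_addr_0 -mulr_natl.
    by rewrite ler_wpM2r ?powR_ge0// -cardfE.
  apply: le_trans (ellp_fset_le (u m - u n) K) _.
  apply: powR_mono; first exact: rnorm_ge0.
  by apply: Nu => //; exact: leq_maxl.
have [N1 /(_ N1 (leqnn _)) N1u] := uLx _ ltr01.
have Lf : ellp_fun p L.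
  pose f i := L i - u N1 i.
  have [ff _] := ellp_bound ler01 N1u.
  have := ellp_normD p1 ff (ellpP (u N1)); case=> + _.
  by congr ellp_fun; apply/funext => i; rewrite fctE subrK.
have Lp : L \in @ellp_pred R I V p p1 by apply/asboolP.
exists (MkEllp Lp) => e e0; have [N Nu] := uLx _ e0; exists N => n Nn.
rewrite rnormB; apply: ellp_norm_bound; first exact: ltW.
by move=> K; exact: Nu.
Qed.

Lemma ellp_finite_approx xi (e : R) : 0 < e -> exists K : {fset I},
  rnorm (xi - to_ellp p1 (fun i => if i \in K then xi i else 0)) <= e.
Proof.
move=> e0; have ep0 : 0 < e `^ p by rewrite powR_gt0.
have : ((rnorm xi `^ p - e `^ p)%:E < ellp_sum p xi)%E.
  by rewrite ellp_sumE lte_fin ltrBlDr ltrDl.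
move=> /ereal_sup_gt[_ [A [fA _] <-]]; rewrite fsbig_finite//= sumEFin lte_fin.
set K := fset_set A => Kxi; exists K.
set f := (fun i => if i \in K then xi i else 0).
have f0 i : i \notin K -> f i = 0 by rewrite /f => /negbTE->.
have [ff fE] := ellp_of_finite_support f0.
apply: ellp_norm_bound; first exact: ltW.
have rE i : (xi - to_ellp p1 f) i = if i \in K then 0 else xi i.
  by rewrite ellpBE (to_ellpE ff) /f; case: ifP; rewrite ?subrr ?subr0.
move: (xi - to_ellp p1 f) rE => r rE K'.
have -> : \sum_(i <- K') rnorm (r i) `^ p =
    \sum_(i <- (K' `\` K)%fset) rnorm (xi i) `^ p.
  rewrite (big_fsetID _ (mem K))/= big1_fset ?add0r.
    rewrite (_ : [fset x in K' | x \notin K] = K' `\` K)%fset; last first.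
      by apply/fsetP => i; rewrite !inE/= andbC.
    apply: eq_big_seq => i; rewrite !inE => /andP[/negbTE iK _].
    by rewrite rE iK.
  move=> i; rewrite !inE/= => /andP[_ iK] _.
  by rewrite rE iK rnorm0 powR0 ?gt_eqF.
have := ellp_fset_le xi (K `|` K')%fset.
rewrite (big_fsetID _ (mem K))/=.
rewrite (_ : [fset x in (K `|` K') | x \in K] = K)%fset; last first.
  by apply/fsetP => i; rewrite !inE/= andb_idl// => ->.
rewrite (_ : [fset x in (K `|` K') | x \notin K] = K' `\` K)%fset; last first.
  by apply/fsetP => i; rewrite !inE/= andbC; case: (i \in K).
by move=> h; move: Kxi; rewrite ltrBlDr => /ltW/(le_trans h); rewrite lerD2l.
Qed.

End SummableFamilies.

(** * A linear functional below a sublinear one *)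

Section LinearBelowSublinear.
Context (R : realType) (V : lmodType R).

Definition sublinear (q : V -> R) : Prop :=
  (forall x y, q (x + y) <= q x + q y) /\
  (forall t x, 0 <= t -> q (t *: x) <= t * q x).

Lemma sublinear_lb q x : sublinear q -> - q (- x) <= q x.
Proof.
move=> [qD qZ]; have q0 : 0 <= q 0.
  by have := qD 0 0; rewrite addr0 -[leLHS]addr0 lerD2l.
by rewrite -subr_ge0 opprK (le_trans q0)//; have := qD x (- x); rewrite subrr.
Qed.

Lemma inf_le_in (A : set R) (a b : R) : lbound A b -> A a -> inf A <= a.
Proof. by move=> Ab Aa; apply: ge_inf => //; exists b. Qed.

(** The Hahn-Banach theorem in its minimality form: by Zorn there is a minimal
sublinear [m] below [q].  For fixed [y], the functional
r(z) = inf over t >= 0 of m(z + t y) - t m(y) is sublinear and below [m], so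
equals [m]; at t = 1 this reads m(x) <= m(x + y) - m(y), and [m] is additive. *)
Lemma linear_below_sublinear q : sublinear q -> exists u : V -> R,
  [/\ forall x y, u (x + y) = u x + u y, forall t x, u (t *: x) = t * u x &
      forall x, u x <= q x].
Proof.
move=> sq.
pose T := {q' : V -> R | sublinear q' /\ forall x, q' x <= q x}.
pose Q : rel T := fun q1 q2 => `[< forall x, sval q2 x <= sval q1 x >].
have sqT : sublinear q /\ forall x, q x <= q x by [].
pose t0 : T := exist _ q sqT.
have Qtot (A : set T) : total_on A Q -> exists t, forall s, A s -> Q s t.
  move=> totA; have [[s0 As0]|A0] := pselect (exists s, A s); last first.
    by exists t0 => s As; exfalso; apply: A0; exists s.
  pose B x := [set sval s x | s in A].
  have lbB x : lbound (B x) (- q (- x)).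
    move=> _ [s As <-]; have [ss sle] := svalP s.
    by rewrite (le_trans _ (sublinear_lb x ss))// lerN2.
  have B0 x : B x !=set0 by exists (sval s0 x), s0.
  (* The pointwise infimum of a chain of sublinear functionals is sublinear. *)
  pose r x := inf (B x).
  have rle s x : A s -> r x <= sval s x.
    by move=> As; apply: (inf_le_in (lbB x)); exists s.
  have sr : sublinear r /\ forall x, r x <= q x.
    split; last by move=> x; rewrite (le_trans (rle _ _ As0))// (svalP s0).2.
    split=> [x y|t x t_ge0].
      rewrite -lerBlDr; apply: lb_le_inf => // _ [s1 As1 <-].
      rewrite lerBlDr -lerBlDl; apply: lb_le_inf => // _ [s2 As2 <-].
      rewrite lerBlDl.
      have [/asboolP le12|/asboolP le21] := totA _ _ As1 As2.
        rewrite (le_trans (rle _ _ As2))// (le_trans ((svalP s2).1.1 x y))//.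
        by rewrite lerD2r.
      rewrite (le_trans (rle _ _ As1))// (le_trans ((svalP s1).1.1 x y))//.
      by rewrite lerD2l.
    move: t_ge0; rewrite le_eqVlt => /predU1P[<-|t_gt0].
      rewrite mul0r (le_trans (rle _ _ As0))//.
      by rewrite (le_trans ((svalP s0).1.2 0 x _))// mul0r.
    rewrite -ler_pdivrMl//; apply: lb_le_inf => // _ [s As <-].
    rewrite ler_pdivrMl// (le_trans (rle _ _ As))//.
    by apply: (svalP s).1.2; exact: ltW.
  by exists (exist _ r sr) => s As; apply/asboolP => x; exact: rle.
have [||[m [sm mq]] mmin] := @ZL_preorder T t0 Q _ _ Qtot.
- by move=> t; apply/asboolP.
- move=> a b c /asboolP ab /asboolP bc; apply/asboolP => x.
  exact: le_trans (bc x) (ab x).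
have [mD mZ] := sm.
have m0 : m 0 <= 0 by have := mZ 0 0 (lexx _); rewrite scale0r mul0r.
have addm x y : m (x + y) = m x + m y.
  apply/le_anti; rewrite mD/=.
  pose B z := [set m (z + t *: y) - t * m y | t in [set t : R | 0 <= t]].
  have lbB z : lbound (B z) (- m (- z)).
    move=> _ [t /= t0' <-]; rewrite lerBrDr -lerBrDl opprK.
    have [->|tn0] := eqVneq t 0.
      by rewrite scale0r addr0 mul0r (le_trans _ (mD _ _))// subrr;
         have := mD 0 0; rewrite addr0 -[leLHS]addr0 lerD2l.
    have tp : 0 < t by rewrite lt_def tn0.
    have := mZ t^-1 (t *: y); rewrite invr_ge0 => /(_ t0').
    rewrite scalerA mulVf// scale1r -ler_pdivrMl ?invr_gt0// invrK => /le_trans.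
    apply; have := mD (z + t *: y) (- z).
    by rewrite addrAC subrr add0r.
  have B0 z : B z !=set0.
    by exists (m (z + 0 *: y) - 0 * m y), 0 => //=; rewrite lexx.
  pose r z := inf (B z).
  have rle z t : 0 <= t -> r z <= m (z + t *: y) - t * m y.
    by move=> tp; apply: (inf_le_in (lbB z)); exists t.
  have rm z : r z <= m z.
    by have := rle z 0 (lexx _); rewrite scale0r addr0 mul0r subr0.
  have sr : sublinear r /\ forall z, r z <= q z.
    split; last by move=> z; exact: le_trans (rm z) (mq z).
    split=> [z w|t z t_ge0].
      rewrite -lerBlDr; apply: lb_le_inf => // _ [s /= s1 <-].
      rewrite lerBlDr -lerBlDl; apply: lb_le_inf => // _ [s' /= s2 <-].
      rewrite lerBlDl (le_trans (rle _ (s + s') (addr_ge0 s1 s2)))//.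
      rewrite scalerDl addrACA mulrDl opprD [leRHS]addrACA lerD2r.
      exact: mD.
    move: t_ge0; rewrite le_eqVlt => /predU1P[<-|t_gt0].
      by rewrite mul0r scale0r (le_trans (rm _)).
    rewrite -ler_pdivrMl//; apply: lb_le_inf => // _ [s /= s1 <-].
    rewrite ler_pdivrMl// (le_trans (rle _ (t * s) _))//.
      by rewrite mulr_ge0// ltW.
    rewrite -scalerA -scalerDr mulrBr mulrA lerD2r.
    by apply: mZ; exact: ltW.
  have /mmin/asboolP/(_ x)/= : Q (exist _ m (conj sm mq)) (exist _ r sr).
    by apply/asboolP => z; exact: rm.
  move=> /le_trans/(_ (rle x 1 ler01)); rewrite scale1r mul1r.
  by rewrite lerBrDr.
have m00 : m 0 = 0.
  by have /eqP := addm 0 0; rewrite addr0 -[X in X == _]addr0 (inj_eq (addrI _)) => /eqP.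
have mN x : m (- x) = - m x.
  by apply/eqP; rewrite -addr_eq0 -addm addNr m00.
have mZp t x : 0 <= t -> m (t *: x) = t * m x.
  move=> tp; apply/le_anti; rewrite mZ//= -lerN2 -mN -scalerN -mulrN -mN.
  exact: mZ.
exists m; split => // t x; have [tp|tn] := leP 0 t; first exact: mZp.
by rewrite -[t]opprK scaleNr mN mZp ?mulNr// oppr_ge0 ltW.
Qed.

End LinearBelowSublinear.

(** * Finitely supported functions and their sums *)

Section FinitelySupported.
Context (R : realType) (I : choiceType).

Definition finsup_pred : {pred I -> R} :=
  [pred f | `[< finite_set [set i | f i != 0] >]].

Record finsup := Finsup { finsup_fun :> I -> R; _ : finsup_fun \in finsup_pred }.

HB.instance Definition _ := [isSub for finsup_fun].
HB.instance Definition _ := [Choice of finsup by <:].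

Lemma finsup_submod_closed : submod_closed finsup_pred.
Proof.
split.
  apply/asboolP; rewrite (_ : [set _ | _] = set0)//.
  by apply/seteqP; split => // x /=; rewrite eqxx.
move=> c f g /asboolP ff /asboolP fg; apply/asboolP.
apply: sub_finite_set (_ : finite_set ([set i | f i != 0] `|` [set i | g i != 0])).
  move=> i /= ci; have [fi|fi] := eqVneq (f i) 0; last by left.
  right; apply: contra_neq ci => gi.
  by rewrite !fctE fi gi scaler0 addr0.
by rewrite finite_setU.
Qed.

HB.instance Definition _ :=
  GRing.isSubmodClosed.Build _ _ finsup_pred finsup_submod_closed.
HB.instance Definition _ := [SubChoice_isSubLmodule of finsup by <:].

Definition fsupp (f : finsup) : {fset I} := fset_set [set i | f i != 0].

Lemma notin_fsupp (f : finsup) i : i \notin fsupp f -> f i = 0.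
Proof.
have /asboolP ff := valP f; rewrite in_fset_set// notin_setE/=.
by move=> /negP; rewrite negbK => /eqP.
Qed.

Lemma mk_finsup_subproof (f : I -> R) (K : {fset I}) :
  (forall i, i \notin K -> f i = 0) -> f \in finsup_pred.
Proof.
move=> f0; apply/asboolP; apply: (sub_finite_set _ (finite_fset K)) => i /=.
by apply: contraNP => /negP/f0 ->.
Qed.

Definition l1norm (f : finsup) : R := \sum_(i <- fsupp f) `|f i|.

Lemma l1normE (f : finsup) (K : {fset I}) : (forall i, i \notin K -> f i = 0) ->
  l1norm f = \sum_(i <- K) `|f i|.
Proof.
move=> f0; rewrite /l1norm [RHS](big_fsetID _ (mem (fsupp f)))/=.
rewrite [X in _ + X]big1_fset ?addr0; last first.
  by move=> i; rewrite !inE/= => /andP[_ /notin_fsupp ->]; rewrite normr0.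
suff -> : [fset x in K | x \in fsupp f]%fset = fsupp f by [].
apply/fsetP => i; rewrite !inE/=.
case: (boolP (i \in K)) => //= iK; apply/esym.
have /asboolP ff := valP f; rewrite in_fset_set//; apply/negbTE.
by rewrite notin_setE/= f0// eqxx.
Qed.

Lemma l1norm_ge0 (f : finsup) : 0 <= l1norm f. Proof. exact: sumr_ge0. Qed.

Lemma l1norm_fset (f : finsup) (K : {fset I}) : \sum_(i <- K) `|f i| <= l1norm f.
Proof.
rewrite (@l1normE f (K `|` fsupp f)%fset); last first.
  by move=> i; rewrite inE negb_or => /andP[_ /notin_fsupp].
rewrite [leRHS](big_fsetID _ (mem K))/=.
rewrite (_ : [fset x in (K `|` fsupp f) | x \in K] = K)%fset.
  by rewrite lerDl sumr_ge0.
by apply/fsetP => i; rewrite !inE/= andb_idl// => ->.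
Qed.

Lemma l1normD (f g : finsup) : l1norm (f + g) <= l1norm f + l1norm g.
Proof.
pose K := (fsupp f `|` fsupp g)%fset.
have f0 i : i \notin K -> f i = 0.
  by rewrite inE negb_or => /andP[/notin_fsupp].
have g0 i : i \notin K -> g i = 0.
  by rewrite inE negb_or => /andP[_ /notin_fsupp].
rewrite (l1normE f0) (l1normE g0) (@l1normE _ K) => [|i iK].
  by rewrite -big_split/= ler_sum// => i _; exact: ler_normD.
by rewrite [LHS](_ : _ = f i + g i)// f0// g0// addr0.
Qed.

Lemma l1norm_additive (f g : finsup) : (forall i, 0 <= f i) -> (forall i, 0 <= g i) ->
  l1norm (f + g) = l1norm f + l1norm g.
Proof.
move=> fp gp; pose K := (fsupp f `|` fsupp g)%fset.
have f0 i : i \notin K -> f i = 0.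
  by rewrite inE negb_or => /andP[/notin_fsupp].
have g0 i : i \notin K -> g i = 0.
  by rewrite inE negb_or => /andP[_ /notin_fsupp].
rewrite (l1normE f0) (l1normE g0) (@l1normE _ K) => [|i iK].
  rewrite -big_split/=; apply: eq_bigr => i _.
  by rewrite !ger0_norm//; exact: addr_ge0.
by rewrite [LHS](_ : _ = f i + g i)// f0// g0// addr0.
Qed.

Lemma l1normZ c (f : finsup) : l1norm (c *: f) = `|c| * l1norm f.
Proof.
rewrite (@l1normE _ (fsupp f)) => [|i /notin_fsupp fi0].
  by rewrite /l1norm mulr_sumr; apply: eq_bigr => i _; rewrite -normrM.
by rewrite [LHS](_ : _ = c * f i)// fi0 mulr0.
Qed.

Lemma l1norm0 : l1norm (0 : finsup) = 0.
Proof. by rewrite -(scale0r 0) l1normZ normr0 mul0r. Qed.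

Lemma l1normN (f : finsup) : l1norm (- f) = l1norm f.
Proof. by rewrite -scaleN1r l1normZ normrN1 mul1r. Qed.

Lemma finsup_delta_subproof (i : I) :
  (fun j => (j == i)%:R : R) \in finsup_pred.
Proof.
apply: (@mk_finsup_subproof _ [fset i]%fset) => j.
by rewrite inE => /negbTE ->.
Qed.

Definition finsup_delta i : finsup := Finsup (finsup_delta_subproof i).

Lemma l1norm_delta i : l1norm (finsup_delta i) = 1.
Proof.
rewrite (@l1normE _ [fset i]%fset) => [|j].
  by rewrite big_seq_fset1/= eqxx normr1.
by rewrite inE/= => /negbTE ->.
Qed.

Lemma finsup_ext (f g : finsup) : (forall i, f i = g i) -> f = g.
Proof. by move=> fg; apply: val_inj; apply/funext. Qed.

Lemma finsup_linE c (f g : finsup) i : (c *: f + g) i = c * f i + g i.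
Proof. by []. Qed.

End FinitelySupported.

(** * Invariant means and Reiter functions *)

Section Reiter.
Context (R : realType) (G : groupType).

Section Boundary.
Context (F : {fset G}).

Lemma transl_diff_subproof (phi : finsup R G) :
  (fun gh : G * G => if gh.1 \in F then phi (gh.2 * gh.1)%g - phi gh.2 else 0)
  \in @finsup_pred R (G * G)%type.
Proof.
pose S := [set i | phi i != 0].
have fS : finite_set S by have /asboolP := valP phi.
apply/asboolP; apply: (@sub_finite_set _ _ (([set` F] `*` S) `|`
    [set (g, k * g^-1)%g | g in [set` F] & k in S])).
  move=> [g h] /=; case: ifP => [gF|]; last by rewrite eqxx.
  move=> H; have [h0|h0] := eqVneq (phi h) 0; last by left.
  right; exists g => //; exists (h * g)%g; last by rewrite mulgK.
  by move: H; rewrite h0 subr0.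
rewrite finite_setU; split; first exact: finite_setX.
exact: finite_image2.
Qed.

(** The differences phi(. g) - phi for all [g] in [F], collected in one function on
G x G so that a single [l1norm] adds up their norms. *)
Definition transl_diff phi : finsup R (G * G)%type :=
  Finsup (transl_diff_subproof phi).

Lemma transl_diffE phi g h : transl_diff phi (g, h) =
  if g \in F then phi (h * g)%g - phi h else 0.
Proof. by []. Qed.

Lemma transl_diff_lin c phi psi :
  transl_diff (c *: phi + psi) = c *: transl_diff phi + transl_diff psi.
Proof.
apply: finsup_ext => -[g h].
rewrite finsup_linE !transl_diffE !finsup_linE.
by case: ifP => _; [ring|rewrite mulr0 addr0].
Qed.

Lemma transl_diff0 : transl_diff 0 = 0.
Proof.
by have := transl_diff_lin (-1) 0 0; rewrite scaler0 addr0 scaleN1r addNr.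
Qed.

End Boundary.

Lemma mean0 (m : (G -> R[i]) -> R[i]) : left_invariant_mean m ->
  m (fun=> 0) = 0.
Proof.
move=> [mlin _ _ _].
have b0 : bounded_family (fun _ : G => 0 : R[i]).
  by exists 0 => g; rewrite cabs0.
have := mlin 1 _ _ b0 b0; under eq_fun do rewrite mul1r addr0.
by rewrite mul1r => /eqP; rewrite -[X in X == _]addr0 (inj_eq (addrI _)) => /eqP.
Qed.

Lemma bounded_familyR (f : G -> R) (c : R) : (forall g, `|f g| <= c) ->
  bounded_family (fun g => (f g)%:C).
Proof. by move=> fc; exists c => g; rewrite cabs_real. Qed.

(** A left invariant mean annihilates the left side: the substitution of x^-1 for
[x] turns the right translates occurring here into left translates. *)
Lemma no_positive_coboundary (m : (G -> R[i]) -> R[i]) (F : seq G)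
    (u : G -> G -> R) (c : R) :
  left_invariant_mean m -> 0 < c -> (forall g x, `|u g x| <= 1) ->
  (forall x, c <= \sum_(g <- F) (u g (x * g^-1)%g - u g x)) -> False.
Proof.
move=> mm c0 u1 uc; have [mlin m1 mpos minv] := mm.
pose f (s : seq G) x := \sum_(g <- s) (u g (x^-1 * g^-1)%g - u g (x^-1)%g).
have ubd g : bounded_family (fun x => (u g (x^-1)%g)%:C).
  by apply: bounded_familyR => x; exact: u1.
have ubd' g : bounded_family (fun x => (u g (x^-1 * g^-1)%g)%:C).
  by apply: bounded_familyR => x; exact: u1.
have [fb f0] : bounded_family (fun x => (f F x)%:C) /\
    m (fun x => (f F x)%:C) = 0.
  rewrite {uc}/f; elim: F => [|g s [sb s0]].
    under eq_fun do rewrite big_nil.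
    by split; [exists 0 => x; rewrite cabs0|exact: mean0].
  have -> : (fun x => (\sum_(g0 <- g :: s)
      (u g0 (x^-1 * g0^-1)%g - u g0 x^-1%g))%:C) = (fun x => 1 *
      (u g (x^-1 * g^-1)%g)%:C + (-1 * (u g (x^-1)%g)%:C + (\sum_(g0 <- s)
      (u g0 (x^-1 * g0^-1)%g - u g0 x^-1%g))%:C)).
    apply/funext => x; rewrite big_cons !rmorphD/= rmorphN/=.
    by rewrite mul1r mulN1r addrA.
  have b2 : bounded_family (fun x => -1 * (u g (x^-1)%g)%:C + (\sum_(g0 <- s)
      (u g0 (x^-1 * g0^-1)%g - u g0 x^-1%g))%:C).
    have [M sM] := sb; exists (1 + M) => x.
    rewrite -lecR cabsC (le_trans (ler_normD _ _))// rmorphD/= lerD//.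
      by rewrite mulN1r normrN -cabsC lecR cabs_real.
    by rewrite -cabsC lecR.
  split.
    have [M sM] := b2; exists (1 + M) => x.
    rewrite -lecR cabsC (le_trans (ler_normD _ _))// rmorphD/= lerD//.
      by rewrite mul1r -cabsC lecR cabs_real.
    by rewrite -cabsC lecR.
  rewrite mlin// mlin// s0 addr0 mul1r mulN1r.
  suff -> : m (fun x => (u g (x^-1 * g^-1)%g)%:C) =
            m (fun x => (u g (x^-1)%g)%:C) by rewrite subrr.
  rewrite -(minv g _ (ubd g)); congr m; apply/funext => x.
  by rewrite invgM.
have cb : bounded_family (fun _ : G => 1 : R[i]).
  by exists (cabs (1 : R[i])).
have : 0 <= m (fun x => (- c)%:C * 1 + (f F x)%:C).
  apply: mpos => [|x].
    have [M sM] := fb; exists (c + M) => x.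
    rewrite -lecR cabsC (le_trans (ler_normD _ _))// rmorphD/= lerD//.
      by rewrite mulr1 -cabsC lecR cabs_real normrN gtr0_norm.
    by rewrite -cabsC lecR.
  rewrite mulr1 -rmorphD/= ler0c addrC subr_ge0.
  exact: uc.
by rewrite mlin// f0 m1 mulr1 addr0 ler0c oppr_ge0 leNgt c0.
Qed.

(** If [transl_diff] were bounded below on the positive cone by c |phi|, then
q(v) = inf over phi >= 0 of |v + transl_diff phi| - c |phi| would be sublinear
with - |v| <= q(v) <= |v| and q(- transl_diff phi) <= - c |phi|.  A linear
functional below [q] is integration against bounded functions u_g, and testing
it on point masses contradicts [no_positive_coboundary]. *)
Lemma no_uniform_boundary (F : {fset G}) (c : R) : amenable R G -> 0 < c ->
  ~ (forall phi : finsup R G, (forall i, 0 <= phi i) ->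
      c * l1norm phi <= l1norm (transl_diff F phi)).
Proof.
move=> [m mm] c0 Fc.
pose P := [set phi : finsup R G | forall i, 0 <= phi i].
pose B (v : finsup R (G * G)%type) :=
  [set l1norm (v + transl_diff F phi) - c * l1norm phi | phi in P].
have P0 : P 0 by move=> i; rewrite [X in 0 <= X](_ : _ = 0).
have lbB v : lbound (B v) (- l1norm v).
  move=> _ [phi Pphi <-]; rewrite lerBrDr addrC.
  rewrite (le_trans (lerB (Fc _ Pphi) (lexx _)))//.
  rewrite lerBlDr -[X in l1norm X <= _](addKr v) addrC.
  by rewrite (le_trans (l1normD _ _))// l1normN addrC.
have B0 v : B v !=set0.
  by exists (l1norm (v + transl_diff F 0) - c * l1norm (0 : finsup R G)), 0.
pose q v := inf (B v).
have qle v phi : P phi -> q v <= l1norm (v + transl_diff F phi) - c * l1norm phi.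
  by move=> Pphi; apply: (inf_le_in (lbB v)); exists phi.
have q1 v : q v <= l1norm v.
  by have := qle v 0 P0; rewrite transl_diff0 l1norm0 mulr0 subr0 addr0.
have PD phi psi t : 0 <= t -> P phi -> P psi -> P (t *: phi + psi).
  move=> t0 Pphi Ppsi i; rewrite [X in 0 <= X](_ : _ = t * phi i + psi i)//.
  by rewrite addr_ge0// mulr_ge0.
have sq : sublinear q.
  split=> [v w|t v t_ge0].
    rewrite -lerBlDr; apply: lb_le_inf => // _ [phi Pphi <-].
    rewrite lerBlDr -lerBlDl; apply: lb_le_inf => // _ [psi Ppsi <-].
    rewrite lerBlDl (le_trans (qle _ _ (PD _ _ 1 ler01 Pphi Ppsi)))//.
    rewrite transl_diff_lin !scale1r addrACA (l1norm_additive Pphi Ppsi).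
    rewrite mulrDr opprD [leRHS]addrACA lerD2r.
    exact: l1normD.
  move: t_ge0; rewrite le_eqVlt => /predU1P[<-|t_gt0].
    by rewrite mul0r scale0r (le_trans (q1 _))// l1norm0.
  rewrite -ler_pdivrMl//; apply: lb_le_inf => // _ [phi Pphi <-].
  rewrite ler_pdivrMl// (le_trans (qle _ _ (PD _ _ t (ltW t_gt0) Pphi P0)))//.
  rewrite transl_diff_lin transl_diff0 !addr0 -scalerDr !l1normZ.
  by rewrite gtr0_norm// mulrBr mulrCA.
have [u [uD uZ uq]] := linear_below_sublinear sq.
have uN v : u (- v) = - u v by rewrite -scaleN1r uZ mulN1r.
have u1 v : `|u v| <= l1norm v.
  rewrite ler_norml (le_trans (uq v) (q1 v)) andbT lerNl -uN.
  by rewrite (le_trans (uq _))// (le_trans (q1 _))// l1normN.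
pose w g x := u (finsup_delta R (g, x)).
apply: (@no_positive_coboundary m F w c mm c0).
  by move=> g x; rewrite (le_trans (u1 _))// l1norm_delta.
move=> x; have <- : u (transl_diff F (finsup_delta R x)) =
    \sum_(g <- F) (w g (x * g^-1)%g - w g x).
  have u0 : u 0 = 0 by rewrite -(scale0r 0) uZ mul0r.
  transitivity (u (\sum_(g <- F)
      (finsup_delta R (g, (x * g^-1)%g) - finsup_delta R (g, x)))).
    congr u; apply: finsup_ext => -[g h] /=.
    rewrite (big_morph (fun f : finsup R (G * G)%type => f (g, h))
      (id1 := 0) (op1 := +%R))//=.
    case: ifPn => [gF|gF].
      rewrite (big_fsetD1 g)//= big1_seq ?addr0 => [|k].
        rewrite [RHS](_ : _ =
          ((g, h) == (g, x * g^-1)%g)%:R - ((g, h) == (g, x))%:R)//.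
        rewrite !xpair_eqE !eqxx/=; congr (_%:R - _).
        by rewrite -[in RHS](inj_eq (mulIg g)) mulgVK.
      rewrite !inE => /andP[_ /andP[/negbTE kg _]].
      rewrite [LHS](_ : _ =
        ((g, h) == (k, x * k^-1)%g)%:R - ((g, h) == (k, x))%:R)//.
      by rewrite !xpair_eqE eq_sym kg subrr.
    rewrite big1_seq// => k /andP[_ kF].
    rewrite [LHS](_ : _ = ((g, h) == (k, x * k^-1)%g)%:R - ((g, h) == (k, x))%:R)//.
    have /negbTE gk : g != k by apply: contraNneq gF => ->.
    by rewrite !xpair_eqE gk subrr.
  rewrite (big_morph u uD u0); apply: eq_bigr => g _.
  by rewrite uD uN.
have Pd : P (finsup_delta R x) by move=> i /=; rewrite ler0n.
have := le_trans (uq (- transl_diff F (finsup_delta R x))) (qle _ _ Pd).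
by rewrite uN addNr l1norm0 l1norm_delta mulr1 sub0r lerN2.
Qed.

(** The summation over arbitrary [K'] expresses the l^1 norm of the difference,
whose support is not [K]. *)
Lemma reiter (F : {fset G}) (e : R) : amenable R G -> 0 < e ->
  exists (phi : G -> R) (K : {fset G}),
    [/\ forall h, 0 <= phi h, forall h, h \notin K -> phi h = 0,
        \sum_(h <- K) phi h = 1 &
        forall g, g \in F -> forall K' : {fset G},
          \sum_(h <- K') `|phi (h * g)%g - phi h| <= e].
Proof.
move=> amG e0; have := @no_uniform_boundary F e amG e0.
move=> /existsNP[phi /not_implyP[phi0 /negP]]; rewrite -ltNge => lt_phi.
have phi1 : 0 < l1norm phi.
  rewrite lt_def l1norm_ge0 andbT; apply: contraTneq lt_phi => phi1.
  by rewrite phi1 mulr0 -leNgt l1norm_ge0.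
pose psi := (l1norm phi)^-1 *: phi.
have psi0 h : 0 <= psi h.
  by rewrite [X in 0 <= X](_ : _ = (l1norm phi)^-1 * phi h)// mulr_ge0// invr_ge0 ltW.
exists psi, (fsupp psi); split => //.
- by move=> h; exact: notin_fsupp.
- have : l1norm psi = 1.
    by rewrite l1normZ gtr0_norm ?invr_gt0// mulVf// gt_eqF.
  by rewrite /l1norm; under eq_bigr do rewrite ger0_norm//.
move=> g gF K'.
have : l1norm (transl_diff F psi) <= e.
  rewrite -[psi]addr0 transl_diff_lin transl_diff0 addr0 l1normZ.
  by rewrite gtr0_norm ?invr_gt0// ler_pdivrMl// mulrC ltW.
apply: le_trans; apply: le_trans (l1norm_fset _ [fset (g, h) | h in K']%fset).
rewrite big_imfset/=; last by move=> a b _ _ [].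
by rewrite gF.
Qed.

End Reiter.

(** * From l^1 to l^p: roots of Reiter functions *)

Section PowerInequalities.
Context (R : realType) (p : R) (p1 : 1 < p).

Let p_gt0 : 0 < p. Proof. exact: lt_trans p1. Qed.

(** Each of s / (s + t) and t / (s + t) is at most 1, so its p-th power is at most
itself, and the two add up to 1. *)
Lemma powR_superadditive (s t : R) : 0 <= s -> 0 <= t ->
  s `^ p + t `^ p <= (s + t) `^ p.
Proof.
move=> s0 t0; have [st0|stn0] := eqVneq (s + t) 0.
  have /eqP := st0; rewrite paddr_eq0// => /andP[/eqP-> /eqP->].
  by rewrite addr0 powR0 ?gt_eqF// addr0.
have st : 0 < s + t by rewrite lt_def stn0 addr_ge0.
have le_frac (x : R) : 0 <= x -> x <= s + t ->
    x `^ p <= (x / (s + t)) * (s + t) `^ p.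
  move=> x0 xst; rewrite -{1}(divfK stn0 x) powRM ?divr_ge0 ?(ltW st)//.
  rewrite ler_wpM2r ?powR_ge0//.
  have [->|xn0] := eqVneq x 0; first by rewrite mul0r powR0 ?gt_eqF.
  have x'0 : 0 < x / (s + t) by rewrite divr_gt0// lt_def xn0.
  rewrite -[leRHS]powRr1 ?(ltW x'0)//; apply: ger_powR; last exact: ltW.
  by rewrite x'0 ler_pdivrMr// mul1r.
rewrite (le_trans (lerD (le_frac s s0 _) (le_frac t t0 _))) ?lerDl ?lerDr//.
by rewrite -mulrDl -mulrDl mulfV// mul1r.
Qed.

(** This is what makes the p-th root of an l^1-almost invariant function almost
invariant in l^p. *)
Lemma powR_root_dist (x y : R) : 0 <= x -> 0 <= y ->
  `|x `^ p^-1 - y `^ p^-1| `^ p <= `|x - y|.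
Proof.
wlog yx : x y / y <= x.
  move=> H x0 y0; have [|/ltW] := leP y x; first by move=> ?; exact: H.
  by move=> ?; rewrite distrC [leRHS]distrC; exact: H.
move=> x0 y0; have vu : y `^ p^-1 <= x `^ p^-1.
  by rewrite ge0_ler_powR ?nnegrE ?invr_ge0// ltW.
rewrite !ger0_norm ?subr_ge0// lerBrDr.
have := powR_superadditive (_ : 0 <= x `^ p^-1 - y `^ p^-1) (powR_ge0 y p^-1).
rewrite subr_ge0 => /(_ vu); rewrite subrK.
by rewrite !(powR_invK p1).
Qed.

End PowerInequalities.

(** * The regular representation of a covariant system *)

(** Only the algebraic relations between multiplications and translations matter
for the regular representation, so they are kept abstract: [alpha g] is the
automorphism of the coefficients induced by [T g]. *)
Section CovariantSystem.
Context (R : realType) (G : groupType) (A D : normedModType R[i]).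
Context (p : R) (p1 : 1 < p).
Local Notation H := (ellp G D p1).
Context (M : A -> bop D) (T : G -> bop D).
Context (alpha : G -> A -> A) (amul : A -> A -> A).
Context (Mbar : A -> bop H) (V : G -> bop H).
Hypothesis M_lin : forall c a b, M (c *: a + b) = c *: M a + M b.
Hypothesis M_mul : forall a b, M (amul a b) = M a * M b.
Hypothesis M_le : forall a, rnorm (M a) <= rnorm a.
Hypothesis TD : forall g h, T (g * h)%g = T g * T h.
Hypothesis T1 : T 1%g = 1.
Hypothesis T_iso : forall g f, rnorm (T g f) = rnorm f.
Hypothesis TM : forall g a, T g * M a = M (alpha g a) * T g.
Hypothesis MbarE : forall a xi h, Mbar a xi h = M (alpha h a) (xi h).
Hypothesis VE : forall g xi h, V g xi h = xi (h * g)%g.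

Let p_gt0 : 0 < p. Proof. exact: lt_trans p1. Qed.

Local Notation fs := (fin_sum M T).
Local Notation fsbar := (fin_sum Mbar V).

Lemma TK g f : T g (T g^-1%g f) = f.
Proof. by rewrite -bopM -TD mulgV T1. Qed.

Lemma TVK g f : T g^-1%g (T g f) = f.
Proof. by rewrite -bopM -TD mulVg T1. Qed.

Lemma M_alpha h a f : M (alpha h a) f = T h (M a (T h^-1%g f)).
Proof. by rewrite -[RHS]/((T h * M a) (T h^-1%g f)) TM bopM TK. Qed.

Lemma M0 : M 0 = 0.
Proof. by have := M_lin (-1) 0 0; rewrite scaler0 addr0 scaleN1r addNr. Qed.

Lemma Mbar_lin c a b : Mbar (c *: a + b) = c *: Mbar a + Mbar b.
Proof.
apply: bop_inj => xi; apply: ellp_ext => h.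
rewrite bopD bopZ ellpDE ellpZE !MbarE !M_alpha M_lin bopD bopZ.
by rewrite bop_mapD bop_mapZ.
Qed.

Lemma Mbar_mul a b : Mbar (amul a b) = Mbar a * Mbar b.
Proof.
apply: bop_inj => xi; apply: ellp_ext => h.
by rewrite bopM !MbarE !M_alpha M_mul bopM TVK.
Qed.

Lemma VD g h : V (g * h)%g = V g * V h.
Proof.
apply: bop_inj => xi; apply: ellp_ext => k.
by rewrite bopM !VE mulgA.
Qed.

Lemma VMbar g a : V g * Mbar a = Mbar (alpha g a) * V g.
Proof.
apply: bop_inj => xi; apply: ellp_ext => k.
rewrite !bopM VE !MbarE VE !M_alpha TD bopM.
congr (T k (T g (M a _))); rewrite -[in RHS]bopM -TD; congr (T _ _).
by rewrite invgM.
Qed.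

Lemma fin_sumE F a f : fs F a f = \sum_(g <- F) M (a g) (T g f).
Proof. by rewrite /fin_sum bop_sumE. Qed.

Lemma fin_sum_barE F a xi h :
  fsbar F a xi h = \sum_(g <- F) M (alpha h (a g)) (xi (h * g)%g).
Proof.
rewrite /fin_sum bop_sumE ellp_sumfE; apply: eq_bigr => g _.
by rewrite bopM MbarE VE.
Qed.

Lemma fin_sum_coef (W : normedModType R[i]) (N : A -> bop W) (S : G -> bop W)
    (F F' : {fset G}) a : N 0 = 0 -> (F `<=` F')%fset ->
  fin_sum N S F a = fin_sum N S F' (fin_coef F a).
Proof.
move=> N0 FF'; rewrite /fin_sum -(big_fset_incl _ FF')/=.
  by apply: eq_big_seq => g gF; rewrite /fin_coef gF.
by move=> g gF' gF; rewrite /fin_coef (negbTE gF) N0 mul0r.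
Qed.

Lemma fin_sum_lin (W : normedModType R[i]) (N : A -> bop W) (S : G -> bop W)
    (F F' : {fset G}) c a a' :
  (forall c a b, N (c *: a + b) = c *: N a + N b) ->
  c *: fin_sum N S F a + fin_sum N S F' a' =
  fin_sum N S (F `|` F')%fset (fun g => c *: fin_coef F a g + fin_coef F' a' g).
Proof.
move=> Nlin.
have N0 : N 0 = 0.
  by have := Nlin (-1) 0 0; rewrite scaler0 addr0 scaleN1r addNr.
rewrite (fin_sum_coef S a N0 (fsubsetUl F F')).
rewrite (fin_sum_coef S a' N0 (fsubsetUr F F')).
rewrite /fin_sum scaler_sumr -big_split/=; apply: eq_bigr => g _.
rewrite Nlin mulrDl; congr (_ + _).
by apply: bop_inj => w; rewrite bopM !bopZ bopM.
Qed.

(** A relation, since different coefficient families could a priori give the same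
operator on [D] and different ones on [H]. *)
Definition bar_graph (u : bop D) (u' : bop H) : Prop :=
  exists F a, u = fs F a /\ u' = fsbar F a.

Lemma bar_graph_lin c u v u' v' : bar_graph u u' -> bar_graph v v' ->
  bar_graph (c *: u + v) (c *: u' + v').
Proof.
move=> [F [a [-> ->]]] [F' [a' [-> ->]]].
exists (F `|` F')%fset, (fun g => c *: fin_coef F a g + fin_coef F' a' g).
by split; apply: fin_sum_lin; [exact: M_lin|exact: Mbar_lin].
Qed.

Lemma bar_graph0 : bar_graph 0 0.
Proof.
by exists fset0, (fun=> 0); rewrite /fin_sum !big_seq_fset0.
Qed.

Lemma bar_graph_monomial a g : bar_graph (M a * T g) (Mbar a * V g).
Proof.
by exists [fset g]%fset, (fun=> a); rewrite /fin_sum !big_seq_fset1.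
Qed.

Lemma bar_graph_sum (I : Type) (s : seq I) (u : I -> bop D) (u' : I -> bop H) :
  (forall i, bar_graph (u i) (u' i)) ->
  bar_graph (\sum_(i <- s) u i) (\sum_(i <- s) u' i).
Proof.
move=> uu; elim/big_rec2: _ => [|i y x _ xy]; first exact: bar_graph0.
by have := bar_graph_lin 1 (uu i) xy; rewrite !scale1r.
Qed.

(** Both generating families obey the same rule
(a T_g) (a' T_h) = a alpha_g(a') T_(gh). *)
Lemma bar_graphM u v u' v' : bar_graph u u' -> bar_graph v v' ->
  bar_graph (u * v) (u' * v').
Proof.
move=> [F [a [-> ->]]] [F' [a' [-> ->]]].
rewrite /fin_sum !mulr_suml; apply: bar_graph_sum => g.
rewrite !mulr_sumr; apply: bar_graph_sum => h.
have -> : M (a g) * T g * (M (a' h) * T h) =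
    M (amul (a g) (alpha g (a' h))) * T (g * h)%g.
  by rewrite M_mul TD !mulrA -(mulrA (M (a g))) TM !mulrA.
have -> : Mbar (a g) * V g * (Mbar (a' h) * V h) =
    Mbar (amul (a g) (alpha g (a' h))) * V (g * h)%g.
  by rewrite Mbar_mul VD !mulrA -(mulrA (Mbar (a g))) VMbar !mulrA.
exact: bar_graph_monomial.
Qed.

(** These vectors spread [f] over its orbit; on them the regular representation
imitates the action on [D], up to the variation of [c]. *)
Definition orbit_vec (c : G -> R) (f : D) (h : G) : D := (c h)%:C *: T h f.

Lemma orbit_vecP (c : G -> R) f (K : {fset G}) :
  (forall h, h \notin K -> c h = 0) ->
  ellp_fun p (orbit_vec c f) /\ rnorm (to_ellp p1 (orbit_vec c f)) =
    (\sum_(h <- K) `|c h| `^ p) `^ p^-1 * rnorm f.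
Proof.
move=> c0.
have v0 h : h \notin K -> orbit_vec c f h = 0.
  by move=> /c0 ch; rewrite /orbit_vec ch scale0r.
have [vf vE] := ellp_of_finite_support p1 v0; split => //.
rewrite -(powRK_inv p1 (rnorm_ge0 _)) vE.
under eq_bigr => h _.
  rewrite /orbit_vec rnormZ T_iso cabs_real powRM ?normr_ge0 ?rnorm_ge0//.
  over.
have S0 : 0 <= \sum_(h <- K) `|c h| `^ p.
  by apply: sumr_ge0 => h _; rewrite powR_ge0.
rewrite -mulr_suml (powRM _ S0 (powR_ge0 _ _)).
by rewrite (powRK_inv p1 (rnorm_ge0 f)).
Qed.

(** Apply the regular representation to the orbit vector of [f] weighted by the
p-th root of a Reiter function: the result is the orbit vector of b f, up to one
error term for each [g] in [F]. *)
Lemma opnorm_le_bar F a : amenable R G -> rnorm (fs F a) <= rnorm (fsbar F a).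
Proof.
move=> amG; apply: opnorm_le => [|f]; first exact: rnorm_ge0.
apply/ler_addgt0Pr => e e0.
(* C weighs the error terms; the summand 1 keeps it positive. *)
pose C := \sum_(g <- F) rnorm (M (a g) (T g f)) + 1.
have C0 : 0 < C by rewrite ltr_wpDl// sumr_ge0// => g _; exact: rnorm_ge0.
have d0 : 0 < e / C by rewrite divr_gt0.
have [phi [K [phi0 phiK phi1 phiF]]] :=
  @reiter R G F ((e / C) `^ p) amG (powR_gt0 _ d0).
pose c h := phi h `^ p^-1.
have cK h : h \notin K -> c h = 0.
  by move=> /phiK hK; rewrite /c hK powR0// invr_eq0 gt_eqF.
have c_norm : (\sum_(h <- K) `|c h| `^ p) `^ p^-1 = 1.
  rewrite (_ : \sum_(h <- K) _ = 1) ?powR1// -phi1; apply: eq_bigr => h _.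
  by rewrite ger0_norm ?powR_ge0// (powR_invK p1).
have [xif xiE] := orbit_vecP f cK.
have [etaf etaE] := orbit_vecP (fs F a f) cK.
rewrite c_norm mul1r in xiE; rewrite c_norm mul1r in etaE.
set xi := to_ellp p1 (orbit_vec c f) in xiE.
set eta := to_ellp p1 (orbit_vec c (fs F a f)) in etaE.
pose w g := to_ellp p1 (orbit_vec (fun h => c h - c (h * g)%g) (M (a g) (T g f))).
have wK g h : h \notin (K `|` [fset (k * g^-1)%g | k in K])%fset ->
    c h - c (h * g)%g = 0.
  rewrite inE negb_or => /andP[hK hgK]; rewrite !cK ?subrr//.
  apply: contra hgK => hgK; apply/imfsetP; exists (h * g)%g => //.
  by rewrite mulgK.
have wf g : g \in F -> rnorm (w g) <= e / C * rnorm (M (a g) (T g f)).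
  move=> gF; have [_ ->] := orbit_vecP (M (a g) (T g f)) (@wK g).
  rewrite ler_wpM2r ?rnorm_ge0//.
  rewrite -[leRHS](powRK_inv p1 (ltW d0)); apply: ge0_ler_powR.
  - by rewrite invr_ge0 ltW.
  - by rewrite nnegrE sumr_ge0// => h _; rewrite powR_ge0.
  - by rewrite nnegrE powR_ge0.
  apply: le_trans (phiF g gF (K `|` [fset (k * g^-1)%g | k in K])%fset).
  apply: ler_sum => h _; rewrite [leRHS]distrC.
  exact: powR_root_dist.
have etaD : eta = fsbar F a xi + \sum_(g <- F) w g.
  apply: ellp_ext => h; rewrite ellpDE ellp_sumfE fin_sum_barE -big_split/=.
  rewrite /eta /xi !to_ellpE// /orbit_vec fin_sumE bop_map_sum scaler_sumr.
  apply: eq_bigr => g _; have [wff _] := orbit_vecP (M (a g) (T g f)) (@wK g).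
  rewrite /w to_ellpE// /orbit_vec M_alpha TD bopM.
  rewrite !bop_mapZ -[T h (T g f)]/((T h * T g) f) TVK.
  by rewrite -scalerDl -rmorphD/= addrC subrK.
rewrite -etaE etaD (le_trans (ler_rnormD _ _))// lerD//.
  by rewrite -xiE; exact: le_opnorm.
rewrite (le_trans (ler_rnorm_sum _ _ _))//.
apply: (@le_trans _ _ (\sum_(g <- F) e / C * rnorm (M (a g) (T g f)))).
  by rewrite big_seq [leRHS]big_seq; apply: ler_sum => g gF; exact: wf.
rewrite -mulr_sumr mulrAC ler_pdivrMr// ler_wpM2l ?(ltW e0)//.
by rewrite /C lerDl.
Qed.

(** The diagonal isometry with entries [chi h] conjugates one operator to the
other: in row [h] and column h g the entry is multiplied by
chi(h)^-1 chi(h g) = chi(g). *)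
Lemma bar_character_le F a (chi : G -> R[i]) : group_character chi ->
  rnorm (fsbar F (fun g => chi g *: a g)) <= rnorm (fsbar F a).
Proof.
move=> [chiM chi1]; apply: opnorm_le => [|xi]; first exact: rnorm_ge0.
have cabs_chi g : cabs (chi g) = 1 by rewrite /cabs chi1.
pose f h := chi h *: xi h.
have f_le (K : {fset G}) : \sum_(h <- K) rnorm (f h) `^ p <= rnorm xi `^ p.
  rewrite (le_trans _ (ellp_fset_le xi K))// le_eqVlt; apply/orP; left.
  by apply/eqP/eq_bigr => h _; rewrite rnormZ cabs_chi mul1r.
have [ff f_norm] := ellp_bound p1 (rnorm_ge0 xi) f_le.
apply: ellp_norm_bound => [|K].
  by rewrite mulr_ge0 ?rnorm_ge0 ?opnorm_ge0.
apply: (@le_trans _ _ (\sum_(h <- K) rnorm (fsbar F a (to_ellp p1 f) h) `^ p)).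
  rewrite le_eqVlt; apply/orP; left; apply/eqP/eq_bigr => h _; congr (_ `^ _).
  rewrite !fin_sum_barE to_ellpE// -[LHS]mul1r -(cabs_chi h) -rnormZ.
  congr rnorm; rewrite scaler_sumr; apply: eq_bigr => g _.
  rewrite /f bop_mapZ chiM -scalerA; congr (_ *: _).
  rewrite !M_alpha (_ : M (chi g *: a g) = chi g *: M (a g)); last first.
    by rewrite -[X in M X]addr0 M_lin M0 addr0.
  by rewrite bopZ bop_mapZ.
rewrite (le_trans (ellp_fset_le _ K))// (powR_mono p1) ?rnorm_ge0//.
apply: le_trans (le_opnorm (fsbar F a) (to_ellp p1 f)) _.
apply: ler_wpM2l; first exact: opnorm_ge0.
by rewrite rnorm_ellp (to_ellpE p1 ff).
Qed.

Hypothesis amG : amenable R G.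
Hypothesis Dc : seq_complete D.
Hypothesis Ac : seq_complete A.
Hypothesis bar_le : forall F a, rnorm (fsbar F a) <= rnorm (fs F a).
Hypothesis coef_le : forall F a g, rnorm (fin_coef F a g) <= rnorm (fs F a).

Lemma rnorm_bar F a : rnorm (fsbar F a) = rnorm (fs F a).
Proof. by apply/le_anti; rewrite bar_le opnorm_le_bar. Qed.

Lemma bar_graph_norm u u' : bar_graph u u' -> rnorm u' = rnorm u.
Proof. by move=> [F [a [-> ->]]]; exact: rnorm_bar. Qed.

Lemma bar_graph_le u u' : bar_graph u u' -> rnorm u' <= rnorm u.
Proof. by move=> /bar_graph_norm ->. Qed.

(** The inverse relation is contractive as well, and extending it gives the
surjectivity of [bar_iso]. *)
Definition unbar_graph (u' : bop H) (u : bop D) : Prop := bar_graph u u'.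

Lemma unbar_graph_le u' u : unbar_graph u' u -> rnorm u <= rnorm u'.
Proof. by move=> /bar_graph_norm ->. Qed.

Lemma unbar_graph_lin c u' v' u v : unbar_graph u' u -> unbar_graph v' v ->
  unbar_graph (c *: u' + v') (c *: u + v).
Proof. exact: bar_graph_lin. Qed.

Lemma graph_closure_flip u u' :
  graph_closure bar_graph u u' <-> graph_closure unbar_graph u' u.
Proof.
by split=> uu e /uu[v [v' [vv uv uv']]]; exists v', v; split.
Qed.

Lemma bar_closure_norm u u' : graph_closure bar_graph u u' -> rnorm u' = rnorm u.
Proof.
move=> uu; apply/le_anti; rewrite (graph_closure_le bar_graph_le uu)/=.
by apply: (graph_closure_le unbar_graph_le); exact/graph_closure_flip.
Qed.

Lemma gen_algebraE : gen_algebra M T = closure [set u | exists u', bar_graph u u'].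
Proof.
congr closure; apply/seteqP; split=> u.
  by move=> [F [a ->]]; exists (fsbar F a), F, a.
by move=> [_ [F [a [-> _]]]]; exists F, a.
Qed.

Lemma gen_algebra_barE :
  gen_algebra Mbar V = closure [set u' | exists u, unbar_graph u' u].
Proof.
congr closure; apply/seteqP; split=> u.
  by move=> [F [a ->]]; exists (fs F a), F, a.
by move=> [_ [F [a [_ ->]]]]; exists F, a.
Qed.

Let Hc : seq_complete (bop H).
Proof. by apply: bop_seq_complete; exact: ellp_seq_complete. Qed.

Let BDc : seq_complete (bop D). Proof. exact: bop_seq_complete. Qed.

Definition bar_iso : bop D -> bop H := graph_ext bar_graph.

Lemma bar_isoP u : gen_algebra M T u -> graph_closure bar_graph u (bar_iso u).
Proof.
rewrite gen_algebraE => clu.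
exact: (graph_extP bar_graph_lin bar_graph_le Hc clu).
Qed.

Lemma bar_isoE u u' : graph_closure bar_graph u u' -> bar_iso u = u'.
Proof. exact: (graph_extE bar_graph_lin bar_graph_le). Qed.

Lemma bar_iso_fin_sum F a : bar_iso (fs F a) = fsbar F a.
Proof.
by apply: bar_isoE; apply: graph_closure_sub; exists F, a.
Qed.

(** Joint continuity of the product, with an explicit modulus [d]. *)
Lemma rnorm_mul_near (W : normedModType R[i]) (u v a b : bop W) (r s d e : R) :
  0 < e -> rnorm u <= r -> rnorm v <= s -> 0 <= d -> d <= 1 ->
  d * (r + s + 1) <= e ->
  rnorm (u - a) <= d -> rnorm (v - b) <= d -> rnorm (u * v - a * b) <= e.
Proof.
move=> e0 ur vs d0 d1 de ua vb.
have -> : u * v - a * b = (u - a) * v + a * (v - b).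
  by rewrite mulrBl mulrBr addrA subrK.
apply: le_trans (ler_rnormD _ _) _; apply: le_trans de.
have -> : d * (r + s + 1) = d * s + (r + 1) * d by ring.
have r0 : 0 <= r by apply: le_trans ur; exact: rnorm_ge0.
have ar : rnorm a <= r + 1.
  rewrite -[a](subrK u) addrC (le_trans (ler_rnormD _ _))// lerD//.
  by rewrite rnormB (le_trans ua).
apply: lerD; apply: le_trans (opnormM _ _) _.
  by apply: ler_pM; rewrite ?opnorm_ge0.
by apply: ler_pM; rewrite ?opnorm_ge0.
Qed.

Lemma bar_closureM u v u' v' : graph_closure bar_graph u u' ->
  graph_closure bar_graph v v' -> graph_closure bar_graph (u * v) (u' * v').
Proof.
move=> uu vv e e0.
pose C := rnorm u + rnorm v + 1 : R.
have C0 : 0 < C by rewrite ltr_wpDl// addr_ge0 ?rnorm_ge0.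
pose d := Num.min 1 (e / C).
have d0 : 0 < d by rewrite lt_min ltr01 divr_gt0.
have d1 : d <= 1 by rewrite ge_min lexx.
have dC : d * C <= e by rewrite -ler_pdivlMr// ge_min lexx orbT.
have [a [a' [aa ua ua']]] := uu _ d0.
have [b [b' [bb vb vb']]] := vv _ d0.
exists (a * b), (a' * b'); split; first exact: bar_graphM.
  exact: (rnorm_mul_near e0 (lexx _) (lexx _) (ltW d0) d1 dC).
apply: (rnorm_mul_near e0 _ _ (ltW d0) d1 dC ua' vb').
  by rewrite (bar_closure_norm uu).
by rewrite (bar_closure_norm vv).
Qed.

Lemma bar_iso_isometric :
  isometric_isomorphism (gen_algebra M T) (gen_algebra Mbar V) bar_iso.
Proof.
have norm_iso u : gen_algebra M T u -> rnorm (bar_iso u) = rnorm u.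
  by move=> Bu; exact: bar_closure_norm (bar_isoP Bu).
have lin_iso c u v : gen_algebra M T u -> gen_algebra M T v ->
    bar_iso (c *: u + v) = c *: bar_iso u + bar_iso v.
  move=> Bu Bv; apply: bar_isoE.
  exact: (graph_closure_lin bar_graph_lin _ (bar_isoP Bu) (bar_isoP Bv)).
split; [|exact: lin_iso| |]; last 2 first.
- move=> u v Bu Bv; apply: bar_isoE.
  by apply: bar_closureM; exact: bar_isoP.
- by move=> u Bu; rewrite -!rnormC norm_iso.
- split.
  + move=> u Bu; rewrite gen_algebra_barE.
    apply: (graph_closure_dom (u' := u)).
    by apply/graph_closure_flip; exact: bar_isoP.
  + move=> u v; rewrite !inE => Bu Bv uv.
    have Buv : gen_algebra M T (-1 *: u + v).
      rewrite gen_algebraE; apply: (graph_closure_dom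
        (u' := -1 *: bar_iso u + bar_iso v)).
      exact: (graph_closure_lin bar_graph_lin _ (bar_isoP Bu) (bar_isoP Bv)).
    have : rnorm (-1 *: u + v) = 0.
      by rewrite -(norm_iso _ Buv) (lin_iso _ _ _ Bu Bv) uv scaleN1r addNr rnorm0.
    by move=> /rnorm0_eq0; rewrite scaleN1r addrC => /subr0_eq ->.
  + move=> u'; rewrite gen_algebra_barE => clu.
    have [u uu] := graph_closure_ex unbar_graph_lin unbar_graph_le BDc clu.
    move/graph_closure_flip in uu; exists u; last exact: bar_isoE.
    rewrite gen_algebraE; exact: graph_closure_dom uu.
Qed.

Definition coef_graph (g : G) (u : bop D) (c : A) : Prop :=
  exists F a, u = fs F a /\ c = fin_coef F a g.

Lemma coef_graph_lin g c u v u' v' : coef_graph g u u' -> coef_graph g v v' ->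
  coef_graph g (c *: u + v) (c *: u' + v').
Proof.
move=> [F [a [-> ->]]] [F' [a' [-> ->]]].
exists (F `|` F')%fset, (fun g => c *: fin_coef F a g + fin_coef F' a' g).
split; first by apply: fin_sum_lin; exact: M_lin.
rewrite {3}/fin_coef inE; case: ifP => // /negbT; rewrite negb_or.
by move=> /andP[gF gF']; rewrite /fin_coef (negbTE gF) (negbTE gF') scaler0 addr0.
Qed.

Lemma coef_graph_le g u c : coef_graph g u c -> rnorm c <= rnorm u.
Proof. by move=> [F [a [-> ->]]]; exact: coef_le. Qed.

Lemma gen_algebra_coefE g :
  gen_algebra M T = closure [set u | exists c, coef_graph g u c].
Proof.
congr closure; apply/seteqP; split=> u.
  by move=> [F [a ->]]; exists (fin_coef F a g), F, a.
by move=> [_ [F [a [-> _]]]]; exists F, a.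
Qed.

Definition coef (g : G) : bop D -> A := graph_ext (coef_graph g).

Lemma coefP g u : gen_algebra M T u -> graph_closure (coef_graph g) u (coef g u).
Proof.
rewrite (gen_algebra_coefE g) => clu.
exact: (graph_extP (@coef_graph_lin g) (@coef_graph_le g) Ac clu).
Qed.

Lemma coefE g u c : graph_closure (coef_graph g) u c -> coef g u = c.
Proof. exact: (graph_extE (@coef_graph_lin g) (@coef_graph_le g)). Qed.

Lemma coef_fin_sum g F a : coef g (fs F a) = fin_coef F a g.
Proof. by apply: coefE; apply: graph_closure_sub; exists F, a. Qed.

Lemma coef_dist g u v : gen_algebra M T u -> gen_algebra M T v ->
  rnorm (coef g u - coef g v) <= rnorm (u - v).
Proof.
move=> Bu Bv; rewrite rnormB [leRHS]rnormB.
have := graph_closure_le (@coef_graph_le g)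
  (graph_closure_lin (@coef_graph_lin g) (-1) (coefP g Bu) (coefP g Bv)).
by rewrite !scaleN1r ![- _ + _]addrC.
Qed.

Definition delta_vec (k : G) (f : D) : H :=
  to_ellp p1 (fun h => if h == k then f else 0).

Lemma delta_vecE k f h : delta_vec k f h = if h == k then f else 0.
Proof.
have f0 i : i \notin [fset k]%fset -> (fun h => if h == k then f else 0) i = 0.
  by rewrite inE => /negbTE ->.
by rewrite /delta_vec (to_ellpE p1 (ellp_of_finite_support p1 f0).1).
Qed.

Lemma bar_delta F a k f h : fsbar F a (delta_vec k f) h =
  M (alpha h (fin_coef F a (h^-1 * k)%g)) f.
Proof.
rewrite fin_sum_barE /fin_coef; case: ifPn => hk.
  rewrite (big_fsetD1 (h^-1 * k)%g)//= delta_vecE mulVKg eqxx.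
  rewrite big1_seq ?addr0// => g; rewrite !inE => /andP[_ /andP[gk _]].
  rewrite delta_vecE ifF ?bop_map0//; apply: contraNF gk => /eqP <-.
  by rewrite mulKg.
rewrite M_alpha M0 bop0 bop_map0 big1_seq// => g /andP[_ gF].
rewrite delta_vecE ifF ?bop_map0//; apply: contraNF hk => /eqP <-.
by rewrite mulKg.
Qed.

Lemma M_alpha_le h a f : rnorm (M (alpha h a) f) <= rnorm a * rnorm f.
Proof.
rewrite M_alpha T_iso (le_trans (le_opnorm _ _))// T_iso.
by apply: ler_wpM2r; [exact: rnorm_ge0|exact: M_le].
Qed.

(** The block of [bar_iso b] in row [h] and column [k] is [alpha h] of the
coefficient of [b] at h^-1 k, first for finite sums and then by continuity.  If
the coefficients vanish, then [bar_iso b] kills the finitely supported vectors,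
which are dense in [H]. *)
Lemma coef_eq0 b : gen_algebra M T b -> (forall g, coef g b = 0) -> b = 0.
Proof.
move=> Bb b0; apply: rnorm0_eq0; rewrite -(bar_closure_norm (bar_isoP Bb)).
suff -> : bar_iso b = 0 by rewrite rnorm0.
have bdelta k f : bar_iso b (delta_vec k f) = 0.
  apply: ellp_ext => h; apply: rnorm0_eq0; apply/le_anti; rewrite rnorm_ge0 andbT.
  apply/ler_addgt0Pr => e e0; rewrite add0r.
  pose C := rnorm (delta_vec k f) + rnorm f + 1 : R.
  have C0 : 0 < C by rewrite ltr_wpDl// addr_ge0 ?rnorm_ge0.
  have [v [v' [[F [a [vE v'E]]] bv bv']]] := bar_isoP Bb (divr_gt0 e0 C0).
  rewrite -[bar_iso b](subrK v') bopD ellpDE.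
  apply: le_trans (ler_rnormD _ _) _.
  apply: (@le_trans _ _ (e / C * (rnorm (delta_vec k f) + rnorm f))).
    rewrite mulrDr; apply: lerD.
      apply: le_trans (ellp_coord_le _ _) _; apply: le_trans (le_opnorm _ _) _.
      by apply: ler_wpM2r; [exact: rnorm_ge0|exact: bv'].
    rewrite v'E bar_delta; apply: le_trans (M_alpha_le _ _ _) _.
    apply: ler_wpM2r; first exact: rnorm_ge0.
    rewrite -coef_fin_sum -vE -[X in rnorm X]subr0 -(b0 (h^-1 * k)%g).
    rewrite rnormB; apply: le_trans bv; apply: coef_dist => //.
    rewrite vE gen_algebraE; apply: subset_closure.
    by exists (fsbar F a), F, a.
  rewrite mulrAC ler_pdivrMr// ler_wpM2l ?(ltW e0)//.
  by rewrite /C lerDl.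
apply: bop_inj => xi; apply: rnorm0_eq0; apply/le_anti; rewrite rnorm_ge0 andbT.
apply/ler_addgt0Pr => e e0; rewrite add0r.
have C0 : 0 < rnorm (bar_iso b) + 1 by rewrite ltr_wpDl ?rnorm_ge0.
have [K Kxi] := ellp_finite_approx xi (divr_gt0 e0 C0).
set eta := to_ellp p1 _ in Kxi.
have etaE : eta = \sum_(k <- K) delta_vec k (xi k).
  apply: ellp_ext => h; rewrite ellp_sumfE.
  have f0 i : i \notin K -> (fun i => if i \in K then xi i else 0) i = 0.
    by move=> /negbTE ->.
  rewrite /eta (to_ellpE p1 (ellp_of_finite_support p1 f0).1); case: ifPn => hK.
    rewrite (big_fsetD1 h)//= delta_vecE eqxx big1_seq ?addr0// => k.
    rewrite !inE => /andP[_ /andP[kh _]]; rewrite delta_vecE ifF//.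
    by rewrite eq_sym; exact: negbTE.
  rewrite big1_seq// => k /andP[_ kK]; rewrite delta_vecE ifF//.
  by apply: contraNF hK => /eqP ->.
have eta0 : bar_iso b eta = 0.
  by rewrite etaE bop_map_sum big1// => k _; exact: bdelta.
rewrite -[xi](subrK eta) bop_mapD eta0 addr0.
apply: le_trans (le_opnorm _ _) _.
apply: le_trans (ler_wpM2l (opnorm_ge0 _) Kxi) _.
rewrite mulrCA ler_piMr ?(ltW e0)// ler_pdivrMr// mul1r.
by rewrite lerDl.
Qed.

Lemma covariant_prop_star : prop_star M T.
Proof. by move=> F a; rewrite -!rnormC lecR; exact: coef_le. Qed.

Lemma covariant_prop_star_star : prop_star_star M T.
Proof.
split; first exact: covariant_prop_star.
exists coef; split.
- move=> g; apply/subspace_continuousP => u Bu.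
  apply/cvgrPdist_le => e /pos_complex[-> e0].
  have near_u : \forall v \near u, `|u - v| <= (complex.Re e)%:C.
    have /cvgrPdist_le := @cvg_id _ (nbhs u); apply.
    by rewrite ltcR.
  near=> v; rewrite rnorm_le; apply: le_trans (coef_dist _ Bu _) _.
    by near: v; exact: withinT.
  by rewrite -rnorm_le; near: v; exact: cvg_within.
- by move=> g F a; exact: coef_fin_sum.
- move=> b Bb; split=> [-> g|]; last exact: coef_eq0.
  apply: coefE; apply: graph_closure_sub; exists fset0, (fun=> 0).
  by rewrite /fin_sum big_seq_fset0.
Unshelve. all: by end_near. Qed.

(** One inequality for [chi] and the other for its inverse. *)
Lemma covariant_character F a chi : group_character chi ->
  `|fs F a| = `|fs F (fun g => chi g *: a g)|.
Proof.
move=> chiP; rewrite -(rnormC (fs F a)) -(rnormC (fs F _)); congr (_%:C).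
rewrite -(rnorm_bar F a) -(rnorm_bar F (fun g => chi g *: a g)).
apply/le_anti/andP; split; last exact: bar_character_le.
have chi_neq0 g : chi g != 0 by rewrite -normr_eq0 chiP.2 oner_eq0.
have chiV : group_character (fun g => (chi g)^-1).
  by split=> [g h|g]; [rewrite chiP.1 invfM|rewrite normfV chiP.2 invr1].
have := bar_character_le F (fun g => chi g *: a g) chiV.
rewrite (_ : (fun g => _) = a)//; apply/funext => g.
by rewrite scalerA mulVf// scale1r.
Qed.

End CovariantSystem.

(** * Strong measurability *)

Section StrongMeasurability.
Context d (T : measurableType d) (R : realType).

(** The idea of Pettis' theorem: enumerate [Y] and let the n-th approximation take,
at each point, the value among the first ones that is nearest to [f]. *)
Lemma strongly_measurable_separable (V : normedModType R[i]) (f : T -> V)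
    (Y : set V) : countable Y ->
  (forall x (e : R), 0 < e -> exists2 v, Y v & rnorm (f x - v) <= e) ->
  (forall v, measurable_fun [set: T] (fun x => rnorm (f x - v))) ->
  strongly_measurable f.
Proof.
move=> cY Yf mf.
have [c cinj] := countable_injP _ cY.
pose y n : V := xget 0 [set v | Y v /\ c v = n].
have yP v : Y v -> y (c v) = v.
  move=> Yv; have [Yy cy] : [set w | Y w /\ c w = c v] (y (c v)).
    by have := @xgetI V 0 [set w | Y w /\ c w = c v] v (conj Yv erefl).
  by apply: cinj; rewrite ?inE.
pose s := fix s n : T -> V := if n is m.+1 then
  fun x => if rnorm (f x - y n) < rnorm (f x - s m x) then y n else s m x
  else fun=> y 0%N.
have s_le n k x : (k <= n)%N -> rnorm (f x - s n x) <= rnorm (f x - y k).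
  elim: n => [|n ih] in k *; first by rewrite leqn0 => /eqP ->.
  rewrite leq_eqVlt ltnS => /predU1P[-> /=|/ih kn /=].
    by case: ltP => //.
  case: ltP => // lt_s; exact: le_trans (ltW lt_s) kn.
have s_simple n : simple_fun (s n).
  elim: n => [|n [fs ms]].
    split=> [|v].
      by apply: (sub_finite_set _ (finite_set1 (y 0%N))) => _ [x _ <-].
    have [<-|/eqP y0] := eqVneq (y 0%N) v.
      by rewrite (_ : _ @^-1` _ = setT)//; apply/seteqP; split.
    by rewrite (_ : _ @^-1` _ = set0)//; apply/seteqP; split.
  split=> [|v].
    apply: (@sub_finite_set _ _ (range (s n) `|` [set y n.+1])).
      move=> _ [x _ <-] /=; case: ifP => _; [by right|by left; exists x].
    by rewrite finite_setU; split.
  pose E := [set x | rnorm (f x - y n.+1) < rnorm (f x - s n x)].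
  have mE : measurable E.
    have -> : E = \bigcup_(w in range (s n)) (s n @^-1` [set w] `&`
        [set x | rnorm (f x - y n.+1) < rnorm (f x - w)]).
      apply/seteqP; split=> [x Ex|x [w _ [/= <-]]]//.
      by exists (s n x) => //; exists x.
    apply: fin_bigcup_measurable => // w _; apply: measurableI; first exact: ms.
    rewrite -[X in measurable X]setTI.
    exact: (measurable_fun_ltr (mf _) (mf _) measurableT (Y := [set true])).
  have -> : s n.+1 @^-1` [set v] =
      (E `&` [set _ | y n.+1 = v]) `|` (~` E `&` s n @^-1` [set v]).
    apply/seteqP; split=> [x /=|x].
      case: ifPn => [Ex yv|/negP Ex sv]; [by left; split|by right; split].
    case=> [[Ex yv]|[Ex sv]] /=; first by rewrite ifT.
    by rewrite ifF//; apply/negbTE/negP.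
  apply: measurableU; last by apply: measurableI; [exact: measurableC|exact: ms].
  apply: measurableI => //; have [yv|yv] := pselect (y n.+1 = v).
    by rewrite (_ : [set _ | _] = setT)//; apply/seteqP; split.
  by rewrite (_ : [set _ | _] = set0)//; apply/seteqP; split.
exists s; split => // x; apply/rlimP => e e0.
have [v Yv fv] := Yf x e e0; exists (c v) => n vn.
by rewrite rnormB (le_trans (s_le _ _ _ vn))// yP.
Qed.

Lemma strongly_measurable_cst (V : normedModType R[i]) (v : V) :
  strongly_measurable (fun _ : T => v).
Proof.
apply: (@strongly_measurable_separable _ _ [set v]) => // x e e0.
by exists v => //; rewrite subrr rnorm0 ltW.
Qed.

Lemma strongly_measurableB (V : normedModType R[i]) (f g : T -> V) :
  strongly_measurable f -> strongly_measurable g ->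
  strongly_measurable (fun x => f x - g x).
Proof.
move=> mf mg; have := strongly_measurable_lin (-1) mg mf.
by congr strongly_measurable; apply/funext => x; rewrite !fctE scaleN1r addrC.
Qed.

Lemma strongly_measurable_cvg (V : normedModType R[i]) (u : nat -> T -> V) f :
  (forall n, strongly_measurable (u n)) ->
  (forall x, rlim (u ^~ x) (f x)) -> strongly_measurable f.
Proof.
move=> /choice[s sP] uf.
pose Y := \bigcup_n \bigcup_k range (s n k).
apply: (@strongly_measurable_separable _ _ Y).
- apply: bigcup_countable => // n _; apply: bigcup_countable => // k _.
  exact: finite_set_countable ((sP n).1 k).1.
- move=> x e e0; have e2 := divr_gt0 e0 (@ltr0n R 2).
  have [n /(_ n (leqnn _)) fn] := uf x _ e2.
  have [k /(_ k (leqnn _)) sk] := (@rlimP _ _ (s n ^~ x) _).2 ((sP n).2 x) _ e2.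
  exists (s n k x); first by exists n => //; exists k => //; exists x.
  rewrite (le_trans (rnorm_dist3 (u n x) _ _))// [leRHS]splitr lerD// rnormB//.
- move=> v; apply: (@measurable_realfun.measurable_fun_cvg _ _ _ _
    (fun n x => rnorm (u n x - v))) => [n|x _].
    apply: measurable_rnorm; apply: strongly_measurableB.
      by exists (s n); exact: sP.
    exact: strongly_measurable_cst.
  apply/cvgrPdist_le => e e0; have [N uN] := uf x e e0.
  exists N => // n /= Nn; apply: le_trans (ler_rnorm_dist _ _) _.
  by rewrite opprB addrA subrK rnormB uN.
Qed.

Lemma strongly_measurable_app (V : normedModType R[i]) (a : T -> bop V)
    (f : T -> V) : strongly_measurable a -> strongly_measurable f ->
  strongly_measurable (fun x => a x (f x)).
Proof.
move=> [s [ss sa]] [t [st tf]]; exists (fun n x => s n x (t n x)); split=> [n|x].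
  split.
    apply: (@sub_finite_set _ _
        [set (u : bop V) v | u in range (s n) & v in range (t n)]).
      by move=> _ [x _ <-]; exists (s n x); [exists x|exists (t n x); [exists x|]].
    by apply: finite_image2; [exact: (ss n).1|exact: (st n).1].
  move=> y; have -> : (fun x => s n x (t n x)) @^-1` [set y] =
      \bigcup_(v in range (t n)) (t n @^-1` [set v] `&`
        (s n @^-1` [set u | u v = y])).
    apply/seteqP; split=> [x /= <-|x [v _ [/= <- <-]]]//.
    by exists (t n x) => //; exists x.
  apply: fin_bigcup_measurable => [|v _]; first exact: (st n).1.
  by apply: measurableI; [exact: (st n).2|exact: simple_fun_preimage].
apply/rlimP => e e0.
have sx := (@rlimP _ _ (s ^~ x) _).2 (sa x).
have tx := (@rlimP _ _ (t ^~ x) _).2 (tf x).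
pose C := rnorm (f x) + 1 + rnorm (a x).
have C0 : 0 < C by rewrite ltr_wpDr ?rnorm_ge0// ltr_wpDl ?rnorm_ge0.
have [N1 N1t] := tx _ ltr01.
have [N2 N2t] := tx _ (divr_gt0 e0 C0); have [N3 N3s] := sx _ (divr_gt0 e0 C0).
exists (maxn N1 (maxn N2 N3)) => n; rewrite !geq_max => /and3P[n1 n2 n3].
have -> : s n x (t n x) - a x (f x) = (s n x - a x) (t n x) + a x (t n x - f x).
  by rewrite bop_mapB bopD bopN addrA subrK.
apply: le_trans (ler_rnormD _ _) _.
have -> : e = e / C * (rnorm (f x) + 1) + rnorm (a x) * (e / C).
  by rewrite [_ * (e / C)]mulrC -mulrDr divfK// gt_eqF.
apply: lerD.
  apply: le_trans (le_opnorm _ _) _; apply: ler_pM; rewrite ?rnorm_ge0 ?opnorm_ge0//.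
    exact: N3s.
  rewrite -[t n x](subrK (f x)) addrC (le_trans (ler_rnormD _ _))// lerD//.
  exact: N1t.
apply: le_trans (le_opnorm _ _) _; apply: ler_wpM2l; first exact: opnorm_ge0.
exact: N2t.
Qed.

Lemma strongly_measurable_comp (V : normedModType R[i]) (f : T -> V) (s : T -> T) :
  measurable_fun [set: T] s -> strongly_measurable f -> strongly_measurable (f \o s).
Proof.
move=> ms [u [su uf]]; exists (fun n => u n \o s); split=> [n|x]; last exact: uf.
split=> [|y].
  apply: (sub_finite_set _ (su n).1) => _ [x _ <-].
  by exists (s x).
rewrite -[X in measurable X]setTI comp_preimage.
by apply: ms => //; exact: (su n).2.
Qed.

(** Real functions are used as operator-valued multipliers, so that weights,
indicators and elements of [C(X, L(E))] are treated alike. *)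
Definition scal_bop (V : normedModType R[i]) (c : R) : bop V := c%:C *: bop_id V.

Lemma scal_bopE (V : normedModType R[i]) c (v : V) : scal_bop V c v = c%:C *: v.
Proof. by []. Qed.

Lemma rnorm_scal_bop (V : normedModType R[i]) c : rnorm (scal_bop V c) <= `|c|.
Proof.
apply: opnorm_le => // v; rewrite scal_bopE rnormZ cabs_real.
exact: lexx.
Qed.

Lemma scal_bopB (V : normedModType R[i]) c c' :
  scal_bop V c - scal_bop V c' = scal_bop V (c - c').
Proof. by rewrite /scal_bop -scalerBl rmorphB. Qed.

(** Rational multiples of the identity approximate all the values. *)
Lemma strongly_measurable_scal (V : normedModType R[i]) (w : T -> R) :
  measurable_fun [set: T] w -> strongly_measurable (fun x => scal_bop V (w x)).
Proof.
move=> mw.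
pose Y := [set scal_bop V (ratr q) | q in [set: rat]].
apply: (@strongly_measurable_separable _ _ Y).
- exact: sub_countable (card_image_le _ _) (countableP _).
- move=> x e e0.
  have we : w x - e < w x + e by rewrite ltrBlDr -addrA ltrDl addr_gt0.
  have [q] := rat_in_itvoo we; rewrite in_itv/= => /andP[q1 q2].
  exists (scal_bop V (ratr q)); first by exists q.
  rewrite scal_bopB (le_trans (rnorm_scal_bop _ _))// ler_norml.
  by move: q1 q2; lra.
- move=> v.
  have cphi : continuous (fun c : R => rnorm (scal_bop V c - v)).
    move=> c; apply/cvgrPdist_le => e e0.
    have /cvgrPdist_le/(_ e e0) := @cvg_id _ (nbhs c); apply: filterS => c' cc'.
    apply: le_trans (ler_rnorm_dist _ _) _.
    rewrite opprB addrA subrK scal_bopB; exact: le_trans (rnorm_scal_bop _ _) cc'.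
  apply: (@measurableT_comp _ _ _ _ _ _ (fun c : R => rnorm (scal_bop V c - v))).
    exact: continuous_measurable_fun.
  exact: mw.
Qed.

End StrongMeasurability.

(** * Continuous functions are strongly measurable *)

Section CountableChain.
Context d (T : measurableType d) (R : realType).
Context (mu : {measure set T -> \bar R}).

(** On a set of finite measure, only finitely many disjoint sets can each have
measure above 1 / (k + 1). *)
Lemma countable_disjoint_pos (I : choiceType) (D : set I) (B : I -> set T) :
  sigma_finite [set: T] mu -> (forall i, D i -> measurable (B i)) ->
  (forall i, D i -> (0 < mu (B i))%E) -> trivIset D B -> countable D.
Proof.
move=> [F TF mF] mB B0 tB.
pose E n k := [set i | D i /\ ((k.+1%:R^-1)%:E < mu (B i `&` F n))%E].
have -> : D = \bigcup_n \bigcup_k E n k.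
  apply/seteqP; split=> [i Di|i [n _ [k _ []]]]//.
  have mBF n : measurable (B i `&` F n) by apply: measurableI; [exact: mB|exact: (mF n).1].
  have [n Bn] : exists n, (0 < mu (B i `&` F n))%E.
    apply: contrapT => /forallNP nB; have := B0 i Di.
    suff : mu.-negligible (B i).
      by move=> /(negligibleP _ (mB i Di)) ->; rewrite ltxx.
    have -> : B i = \bigcup_n (B i `&` F n) by rewrite -setI_bigcupr -TF setIT.
    apply: negligible_bigcup => n; apply/negligibleP => //.
    by apply/eqP; move/negP: (nB n); rewrite lt_def measure_ge0 andbT negbK.
  have [k kB] : exists k, ((k.+1%:R^-1)%:E < mu (B i `&` F n))%E.
    have [fin|] := boolP (mu (B i `&` F n) \is a fin_num); last first.
      rewrite ge0_fin_numE ?measure_ge0// -leNgt leye_eq => /eqP ->.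
      by exists 0%N; rewrite ltry.
    have : 0 < fine (mu (B i `&` F n)) by rewrite fine_gt0// Bn -ge0_fin_numE.
    move=> /ltr_add_invr[k]; rewrite add0r => kB; exists k.
    by rewrite -(fineK fin) lte_fin.
  by exists n => //; exists k.
apply: bigcup_countable => // n _; apply: bigcup_countable => // k _.
apply: finite_set_countable; apply: contrapT => infE.
have Fn_fin : mu (F n) \is a fin_num.
  by rewrite ge0_fin_numE ?measure_ge0//; exact: (mF n).2.
pose N := Num.truncn (k.+1%:R * fine (mu (F n))).
have [K KE NK] := infinite_set_fset N.+1 infE.
have mBF i : i \in K -> measurable (B i `&` F n).
  move=> iK; apply: measurableI; last exact: (mF n).1.
  by apply: mB; exact: (KE i iK).1.
have : (\sum_(i <- K) mu (B i `&` F n) <= mu (F n))%E.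
  rewrite -measure_fbigsetU//; last first.
    move=> i j iK jK [x [[Bix _] [Bjx _]]].
    by apply: tB; [exact: (KE i iK).1|exact: (KE j jK).1|exists x].
  apply: le_measure; rewrite ?inE; [|exact: (mF n).1|].
    rewrite big_seq; apply: bigsetU_measurable => i iK; exact: mBF.
  rewrite -bigcup_seq => x [i _ []]//.
apply/negP; rewrite -ltNge.
apply: (@lt_le_trans _ _ (\sum_(i <- K) (k.+1%:R^-1)%:E)%E); last first.
  rewrite big_seq [leRHS]big_seq; apply: lee_sum => i iK.
  by apply/ltW; exact: (KE i iK).2.
rewrite sumEFin -(fineK Fn_fin) lte_fin big_const_seq count_predT iter_addr_0.
rewrite -[X in _ < X]mulr_natl -ltr_pdivrMr ?invr_gt0// invrK.
apply: (@lt_le_trans _ _ N.+1%:R); last by rewrite ler_nat.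
by rewrite mulrC real_truncnS_gt// num_real.
Qed.

End CountableChain.

Section ContinuousStronglyMeasurable.
Context (R : realType) (X : ptopologicalType).
Context (mu : {measure set (borelType X) -> \bar R}).
Hypothesis sfmu : sigma_finite [set: borelType X] mu.
Hypothesis suppmu : msupport mu = [set: X].

Lemma open_borel (U : set X) : open U -> measurable (U : set (borelType X)).
Proof. exact: sub_sigma_algebra. Qed.

Lemma open_pos (U : set X) : open U -> U !=set0 ->
  (0 < mu (U : set (borelType X)))%E.
Proof.
move=> oU [x Ux]; have : msupport mu x by rewrite suppmu.
exact.
Qed.

Lemma continuous_rnorm (V : normedModType R[i]) (Y : topologicalType)
    (f : Y -> V) : continuous f -> continuous (fun x => rnorm (f x)).
Proof.
move=> cf x; apply/cvgrPdist_le => e e0.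
have /cvgrPdist_le /(_ e%:C) := cf x; rewrite ltcR => /(_ e0).
apply: filterS => y; rewrite rnorm_le; apply: le_trans.
exact: ler_rnorm_dist.
Qed.

(** For each [n] take a maximal family of points whose neighbourhoods
{y | rnorm (f y - f x) < 1 / (n + 1)} are disjoint.  These are open and nonempty,
so the family is countable, and by maximality the values of [f] on it approximate
all its values up to 2 / (n + 1). *)
Lemma continuous_strongly_measurable (V : normedModType R[i]) (f : X -> V) :
  continuous f -> strongly_measurable (f : borelType X -> V).
Proof.
move=> cf.
have cB (e : R) x : open [set y | rnorm (f y - f x) < e].
  apply: (@open_comp _ _ (fun y => rnorm (f y - f x)) [set r | r < e]).
    move=> y _; apply: (@continuous_rnorm _ _ (fun y => f y - f x)) => z.
    by apply: cvgB; [exact: cf|exact: cvg_cst].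
  exact: open_lt.
pose e n : R := n.+1%:R^-1.
have e0 n : 0 < e n by rewrite invr_gt0.
pose B n x := [set y | rnorm (f y - f x) < e n].
have Bx n x : B n x x by rewrite /B/= subrr rnorm0.
have /choice[D DP] n : exists D, maximal_disjoint_subcollection (B n) D [set: X].
  by have [D ?] := ex_maximal_disjoint_subcollection (B n) [set: X]; exists D.
have cD n : countable (D n).
  have [_ tD _] := DP n.
  apply: (@countable_disjoint_pos _ (borelType X) _ mu X (D n) (B n)) => //.
    by move=> x _; apply: open_borel; exact: cB.
  move=> x _; apply: open_pos; first exact: cB.
  by exists x.
apply: (@strongly_measurable_separable _ _ _ _ _ (\bigcup_n (f @` D n))).
- apply: bigcup_countable => // n _; exact: sub_countable (card_image_le _ _) (cD n).
- move=> x r r0.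
  have [n nr] : exists n, e n < r / 2.
    have /ltr_add_invr[n] : 0 < r / 2 by rewrite divr_gt0.
    by rewrite add0r; exists n.
  have [_ tD maxD] := DP n.
  have [y [Dy [z [Bzx Bzy]]]] : exists y, D n y /\ (B n x `&` B n y) !=set0.
    apply: contrapT => /forallNP H.
    have xD : ~ D n x by move=> Dx; apply: (H x); split => //; exists x.
    apply: (maxD (D n `|` [set x])) => //.
      by split=> [y Dy|/(_ x (or_intror erefl))//]; left.
    move=> y z [Dy|->] [Dz|->] //.
    - exact: tD.
    - move=> [w [Bw1 Bw2]]; exfalso; apply: (H y); split => //.
      by exists w.
    - by move=> ?; exfalso; apply: (H z).
  exists (f y); first by exists n => //; exists y.
  rewrite (le_trans (rnorm_dist3 (f z) _ _))// (splitr r) lerD//.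
    by rewrite rnormB; apply/ltW/(lt_trans Bzx).
  by apply/ltW/(lt_trans Bzy).
- move=> v _ Y mY; rewrite setTI.
  have cr : continuous (fun x => rnorm (f x - v)).
    apply: (@continuous_rnorm _ _ (fun y => f y - v)) => z.
    by apply: cvgB; [exact: cf|exact: cvg_cst].
  have : measurable_fun [set: borelType X]
      ((fun x => rnorm (f x - v)) : borelType X -> R).
    apply: (measurability _ (RGenOpens.measurableE R)).
    move=> _ [_ [a [b ->]] <-]; rewrite setTI; apply: open_borel.
    apply: (@open_comp _ _ (fun x => rnorm (f x - v))).
      by move=> y _; exact: cr.
    exact: interval_open.
  by move=> /(_ measurableT Y mY); rewrite setTI.
Qed.

End ContinuousStronglyMeasurable.

(** * Radon-Nikodym densities of sigma-finite measures *)

Section SigmaFiniteInstance.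
Context d (T : measurableType d) (R : realType).
Context (mu : {measure set T -> \bar R}) (sfmu : sigma_finite [set: T] mu).

(** An alias of [mu] that carries the hypothesis of sigma-finiteness, so that it
can be registered as a sigma-finite measure. *)
Definition with_sigma_finite (_ : sigma_finite [set: T] mu) : set T -> \bar R :=
  mu.

HB.instance Definition _ := Measure.on (with_sigma_finite sfmu).
HB.instance Definition _ :=
  Measure_isSigmaFinite.Build _ _ _ (with_sigma_finite sfmu) sfmu.

End SigmaFiniteInstance.

Section Densities.
Context d (T : measurableType d) (R : realType).
Implicit Types mu nu : {measure set T -> \bar R}.
Local Open Scope ereal_scope.
Import HBNNSimple.

Lemma density_integral_nnsfun mu nu (h : T -> R) (f : {nnsfun T >-> R}) :
  is_density mu nu h ->
  \int[nu]_x (f x)%:E = \int[mu]_x ((f x)%:E * (h x)%:E).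
Proof.
move=> [mh h0 nuh]; rewrite integralT_nnsfun sintegralE.
have mS r : measurable (f @^-1` [set r]) by [].
have -> : \int[mu]_x ((f x)%:E * (h x)%:E) =
    \sum_(r \in range f) \int[mu]_(x in f @^-1` [set r]) ((f x)%:E * (h x)%:E).
  rewrite fsbig_finite//= -ge0_integral_bigsetU//=; last 4 first.
  - exact: fset_uniq.
  - move=> r s _ _ [x [/= <- <-]] //.
  - apply/measurable_funTS/emeasurable_funM; apply/measurable_EFinP => //.
  - by move=> x _; rewrite mule_ge0// lee_fin.
  congr integral; rewrite bigsetU_fset_set//; apply/seteqP; split => // x _.
  by exists (f x) => //; exists x.
apply: eq_fsbigr => r; rewrite inE => -[x _ fx].
have r0 : (0 <= r)%R by rewrite -fx.
have hS : measurable_fun (f @^-1` [set r]) (fun x => (h x)%:E).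
  by apply/measurable_funTS/measurable_EFinP.
have hS0 x0 : (f @^-1` [set r]) x0 -> 0 <= (h x0)%:E by rewrite lee_fin.
rewrite (nuh _ (mS r)) -(ge0_integralZl_EFin mu (mS r) hS0 hS r0).
by apply: eq_integral => y; rewrite inE /= => ->.
Qed.

(** From the simple functions by monotone convergence. *)
Lemma density_integral mu nu (h : T -> R) (f : T -> \bar R) :
  is_density mu nu h -> measurable_fun [set: T] f -> (forall x, 0 <= f x) ->
  \int[nu]_x f x = \int[mu]_x (f x * (h x)%:E).
Proof.
move=> dh mf f0; have [mh h0 nuh] := dh.
pose g := nnsfun_approx measurableT mf.
have gf x : f x = lim ((g n x)%:E @[n --> \oo]).
  by apply/esym/cvg_lim => //; exact: cvg_nnsfun_approx.
have g_nd x m n : (m <= n)%N -> (g m x)%:E <= (g n x)%:E.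
  by move=> mn; rewrite lee_fin; exact/lefP/nd_nnsfun_approx.
have mg n : measurable_fun [set: T] (fun x => (g n x)%:E).
  exact/measurable_EFinP.
under eq_integral => x _ do rewrite gf.
rewrite monotone_convergence//; last 2 first.
- by move=> n x _; rewrite lee_fin.
- by move=> x _ m n; exact: g_nd.
have -> : \int[mu]_x (f x * (h x)%:E) =
    \int[mu]_x (lim ((g n x)%:E * (h x)%:E @[n --> \oo])).
  apply: eq_integral => x _; apply/esym/cvg_lim => //; apply: cvgeZr => //.
  exact: cvg_nnsfun_approx.
rewrite monotone_convergence//; last 3 first.
- by move=> n; apply: emeasurable_funM => //; exact/measurable_EFinP.
- by move=> n x _; rewrite mule_ge0// lee_fin.
- by move=> x _ m n mn; rewrite lee_wpmul2r ?lee_fin//; exact: g_nd.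
suff -> : (fun n => \int[nu]_x (g n x)%:E) =
    (fun n => \int[mu]_x ((g n x)%:E * (h x)%:E)) by [].
by apply/funext => n; exact: density_integral_nnsfun.
Qed.

Lemma density_ae_unique mu nu (h1 h2 : T -> R) :
  sigma_finite [set: T] nu -> is_density mu nu h1 -> is_density mu nu h2 ->
  {ae mu, forall x, h1 x = h2 x}.
Proof.
move=> [F TF mF] [mh1 h10 nuh1] [mh2 h20 nuh2].
have H n : {ae mu, forall x, F n x -> (h1 x)%:E = (h2 x)%:E}.
  have [mFn Fn_fin] := mF n.
  apply: integral_ae_eq => //.
  - apply/integrableP; split.
      by apply/measurable_funTS/measurable_EFinP.
    under eq_integral => x _ do rewrite /= ger0_norm//.
    by rewrite -nuh1.
  - by apply/measurable_funTS/measurable_EFinP.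
  - by move=> E _ mE; rewrite -nuh1// -nuh2.
have := ae_foralln H; apply: filterS => x Hx.
have [n _ Fnx] : (\bigcup_n F n) x by rewrite -TF.
by have [] := Hx n Fnx.
Qed.

(** The restriction of [nu] to [D] is a finite measure, for which the classical
theorem applies. *)
Lemma radon_nikodym_restr mu nu (D : set T) : sigma_finite [set: T] mu ->
  nu `<< mu -> measurable D -> nu D < +oo -> exists f : T -> \bar R,
    [/\ forall x, f x >= 0, forall x, f x \is a fin_num,
    mu.-integrable [set: T] f &
    forall A, measurable A -> nu (A `&` D) = \int[mu]_(x in A) f x].
Proof.
move=> sfmu numu mD nuD.
have numuD : mfrestr mD nuD `<< with_sigma_finite sfmu.
  apply/null_content_dominatesP => A mA muA; rewrite /mfrestr /mrestr.
  apply/eqP; rewrite -measure_le0.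
  have <- : nu A = 0 by move/null_content_dominatesP : numu; apply.
  exact: measureIl.
exact: radon_nikodym_sigma_finite numuD.
Qed.

(** The densities of the restrictions of [nu] to disjoint pieces [D n] of finite
measure are glued together. *)
Lemma density_exists mu nu : sigma_finite [set: T] mu ->
  sigma_finite [set: T] nu -> nu `<< mu -> exists h, is_density mu nu h.
Proof.
move=> sfmu [F TF mF] numu.
pose D := seqDU F.
have mD n : measurable (D n) by apply: seqDU_measurable => k; exact: (mF k).1.
have tD : trivIset [set: nat] D := @trivIset_seqDU _ F.
have TD : \bigcup_n D n = [set: T] by rewrite -seqDU_bigcup_eq.
have nuD n : nu (D n) < +oo.
  apply: le_lt_trans (mF n).2; apply: le_measure; rewrite ?inE//.
    exact: (mF n).1.
  exact: subset_seqDU.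
have /choice[f fP] n : exists f : T -> \bar R,
    [/\ forall x, f x >= 0, forall x, f x \is a fin_num,
    mu.-integrable [set: T] f &
    forall A, measurable A -> nu (A `&` D n) = \int[mu]_(x in A) f x].
  exact: radon_nikodym_restr.
pose N x := xget 0%N [set n | D n x].
have NE n x : D n x -> N x = n.
  move=> Dnx; have DN : D (N x) x.
    by have := @xgetI nat 0%N [set n | D n x] n Dnx.
  by apply: tD => //; exists x.
pose h x := fine (f (N x) x).
have hE n x : D n x -> (h x)%:E = f n x.
  move=> /NE Nx; rewrite /h Nx fineK//; exact: (let: And4 _ H _ _ := fP n in H).
have mh : measurable_fun [set: T] h.
  rewrite -TD; apply/measurable_fun_bigcup => // n.
  apply/measurable_EFinP; apply: (eq_measurable_fun (f n)).
    by move=> x; rewrite inE => /hE.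
  by apply: measurable_funTS; have [_ _ /integrableP[]] := fP n.
have h0 x : (0 <= h x)%R by rewrite fine_ge0//; have [] := fP (N x).
exists h; split => // Q mQ.
have Dh n : \int[mu]_(x in Q `&` D n) (h x)%:E = nu (Q `&` D n).
  have [_ _ _ fI] := fP n.
  rewrite -[in RHS](setIid (D n)) setIA fI; last exact: measurableI.
  by apply: eq_integral => x; rewrite inE => -[_ /hE].
have QD : Q = \bigcup_n (Q `&` D n) by rewrite -setI_bigcupr TD setIT.
have tQD : trivIset [set: nat] (fun n => Q `&` D n).
  by apply: trivIset_setIl.
have mQD n : measurable (Q `&` D n) by exact: measurableI.
rewrite QD ge0_integral_bigcup//; last 2 first.
- rewrite -QD; apply/measurable_funTS/measurable_EFinP.
  exact: mh.
- by move=> x _; rewrite lee_fin h0.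
rewrite measure_bigcup//=.
transitivity (\sum_(n <oo) nu (Q `&` D n)).
  by apply: eq_eseriesl => n; rewrite in_setT.
by apply: eq_eseriesr => n _; rewrite Dh.
Qed.

End Densities.

(** * The Bochner space and its completeness *)

(** Convergence to [0] needs a separate argument, as the power function with real
exponent is differentiable only away from [0]. *)
Lemma powR_cvg_ge0 (R : realType) (I : Type) (F : set_system I)
    (FF : ProperFilter F) (p : R) (u : I -> R) (r : R) : 1 < p ->
  (forall n, 0 <= u n) -> u n @[n --> F] --> r ->
  u n `^ p @[n --> F] --> r `^ p.
Proof.
move=> p1 u0 ur; have p0 : 0 < p by exact: lt_trans p1.
have r0 : 0 <= r.
  rewrite -(cvg_lim (@Rhausdorff R) ur); apply: limr_ge; first by apply/cvg_ex; exists r.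
  by apply: nearW.
move: r0; rewrite le_eqVlt => /predU1P[r0|rp]; last first.
  apply: (@continuous_cvg _ _ _ _ _ u (fun a : R => a `^ p)) => //.
  apply/differentiable_continuous/derivable1_diffP.
  by apply: derivable_powR; rewrite in_itv/= rp.
rewrite -r0 in ur *; rewrite powR0 ?gt_eqF//; apply/cvgrPdist_le => e e0.
have e1 : 0 < e `^ p^-1 by rewrite powR_gt0.
have /cvgrPdist_le/(_ _ e1) := ur; apply: filterS => n.
rewrite !sub0r !normrN !ger0_norm ?powR_ge0// => un.
rewrite -[leRHS](powR_invK p1 (ltW e0)); exact: powR_mono.
Qed.

Section BochnerSpace.
Context d (T : measurableType d) (R : realType).
Context (mu : {measure set T -> \bar R}) (V : normedModType R[i]).
Context (p : R) (p1 : 1 < p).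
Local Notation D := (Lp mu V p1).
Implicit Types f g : T -> V.
Implicit Types F G : D.

Let p_gt0 : 0 < p. Proof. exact: lt_trans p1. Qed.

(** The p-th power of the Bochner norm, which is additive over disjoint supports
and stable under Fatou's lemma. *)
Definition Lpint f : \bar R := (\int[mu]_x (rnorm (f x) `^ p)%:E)%E.

Lemma Lpint_ge0 f : (0 <= Lpint f)%E.
Proof. by apply: integral_ge0 => x _; rewrite lee_fin powR_ge0. Qed.

Lemma measurable_Lpint f : strongly_measurable f ->
  measurable_fun [set: T] (fun x => (rnorm (f x) `^ p)%:E).
Proof.
move=> mf; apply/measurable_EFinP.
apply: (@measurableT_comp _ _ _ _ _ _ (@powR R ^~ p)) => //.
exact: measurable_rnorm.
Qed.

Lemma Lp_funP f : Lp_fun mu p f <-> strongly_measurable f /\ (Lpint f < +oo)%E.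
Proof.
rewrite /Lp_fun Bochner_normE -/(Lpint f); split=> -[mf foo]; split => //.
  rewrite ltey; apply: contraTneq foo => ->.
  by rewrite poweRyr ?invr_eq0 ?gt_eqF// ltxx.
exact: poweR_lty.
Qed.

Lemma ae_Lpint f g : strongly_measurable f -> strongly_measurable g ->
  {ae mu, forall x, f x = g x} -> Lpint f = Lpint g.
Proof.
move=> mf mg fg; apply: ae_eq_integral => //; [exact: measurable_Lpint|
  exact: measurable_Lpint|].
by apply: filterS fg => x -> _.
Qed.

Lemma Lp_measurable F : strongly_measurable (repr F : T -> V).
Proof. exact: (LpFunP _).1. Qed.

Lemma rnorm_Lp F : (rnorm F `^ p)%:E = Lpint (repr F).
Proof.
have [mF /[dup] Foo] := LpFunP (repr F).
have -> : rnorm F = fine (Bochner_norm mu p (repr F)) by [].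
rewrite Bochner_normE -/(Lpint _).
have Ioo : (Lpint (repr F) < +oo)%E by have [] := (Lp_funP _).1 (LpFunP (repr F)).
have : Lpint (repr F) \is a fin_num by rewrite ge0_fin_numE ?Lpint_ge0.
move: (Lpint_ge0 (repr F)); case: (Lpint _) => // r; rewrite lee_fin => r0 _ _.
by rewrite poweR_EFin /= powR_invK.
Qed.

Lemma to_LpE f : Lp_fun mu p f ->
  {ae mu, forall x, repr (to_Lp mu p1 f) x = f x}.
Proof.
move=> lf; have lfp : f \in @Lp_fun_pred _ T R mu V p p1 by apply/asboolP.
rewrite /to_Lp /insubd insubT /=.
exact: (Lp_repr (MkLpFun lfp)).
Qed.

Lemma rnorm_to_Lp f : Lp_fun mu p f -> (rnorm (to_Lp mu p1 f) `^ p)%:E = Lpint f.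
Proof.
move=> lf; rewrite rnorm_Lp; apply: ae_Lpint; first exact: Lp_measurable.
  by case: lf.
exact: to_LpE.
Qed.

Lemma Lp_ext F G : {ae mu, forall x, repr F x = repr G x} -> F = G.
Proof. by move=> /Lp_piP; rewrite !reprK. Qed.

Lemma Lp_lin_repr c F G :
  {ae mu, forall x, repr (c *: F + G) x = c *: repr F x + repr G x}.
Proof.
have := Lp_repr (repr (c *: F) + repr G).
have := Lp_repr (c *: repr F).
apply: filterS2 => x cF cFG.
by rewrite [LHS]cFG LpFunDE [repr (c *: F) x]cF LpFunZE.
Qed.

Lemma Lp0_repr : {ae mu, forall x, repr (0 : D) x = 0}.
Proof. exact: (Lp_repr (0 : LpFun mu V p1)). Qed.

Lemma LpD_repr F G : {ae mu, forall x, repr (F + G) x = repr F x + repr G x}.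
Proof.
by have := Lp_lin_repr 1 F G; apply: filterS => x; rewrite !scale1r.
Qed.

Lemma LpB_repr F G : {ae mu, forall x, repr (F - G) x = repr F x - repr G x}.
Proof.
have := Lp_lin_repr (-1) G F; apply: filterS => x.
by rewrite !scaleN1r addrC => ->; rewrite addrC.
Qed.

Lemma Lp_sum_repr (I : Type) (s : seq I) (H : I -> D) :
  {ae mu, forall x, repr (\sum_(i <- s) H i) x = \sum_(i <- s) repr (H i) x}.
Proof.
elim: s => [|i s ih].
  by have := Lp0_repr; apply: filterS => x; rewrite !big_nil.
have := LpD_repr (H i) (\sum_(i <- s) H i); apply: filterS2 ih => x ih.
by rewrite !big_cons => ->; rewrite ih.
Qed.

Lemma rnorm_LpB F G : (rnorm (F - G) `^ p)%:E = Lpint (fun x => repr F x - repr G x).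
Proof.
rewrite rnorm_Lp; apply: ae_Lpint; first exact: Lp_measurable.
  by apply: strongly_measurableB; exact: Lp_measurable.
exact: LpB_repr.
Qed.

Lemma Lpint_fatou (u : nat -> T -> V) (f : T -> V) (c : \bar R) N :
  (forall n, strongly_measurable (u n)) -> (forall x, rlim (u ^~ x) (f x)) ->
  (forall n, (N <= n)%N -> (Lpint (u n) <= c)%E) -> (Lpint f <= c)%E.
Proof.
move=> mu_ uf uc.
pose v k x := (rnorm (u (N + k)%N x) `^ p)%:E.
have vf x : v k x @[k --> \oo] --> (rnorm (f x) `^ p)%:E.
  apply: cvg_EFin; first by near=> k.
  apply: powR_cvg_ge0 => //; first by move=> k; exact: rnorm_ge0.
  apply/cvgrPdist_le => e e0; have [M Mu] := uf x e e0.
  exists M => // k /= Mk; apply: le_trans (ler_rnorm_dist _ _) _.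
  by rewrite rnormB Mu// (leq_trans Mk)// leq_addl.
have -> : Lpint f = (\int[mu]_x limn_einf (v ^~ x))%E.
  apply: eq_integral => x _; rewrite is_cvg_limn_einfE.
    by apply/esym/cvg_lim => //; exact: vf.
  by apply/cvg_ex; exists (rnorm (f x) `^ p)%:E; exact: vf.
apply: le_trans (fatou _ _ _ _) _ => //.
- by move=> k; exact: measurable_Lpint.
- by move=> k x _; rewrite lee_fin powR_ge0.
rewrite limn_einf_lim; apply: lime_le; first exact: is_cvg_einfs.
near=> k; apply: le_trans (_ : (\int[mu]_x v k x <= _)%E).
  by apply: ereal_inf_lbound; exists k => //=.
by apply: uc; rewrite leq_addr.
Unshelve. all: by end_near. Qed.

End BochnerSpace.

Section GeometricCauchy.
Context (R : realType) (V : normedModType R[i]).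

Lemma geometric_rcauchy (w : nat -> V) (h : R) : 0 <= h ->
  (forall k, rnorm (w k.+1 - w k) <= h / (2 ^ k.+1)%:R) -> rcauchy w.
Proof.
move=> h0 wh.
have wmj m j : rnorm (w (m + j)%N - w m) <= h / (2 ^ m)%:R - h / (2 ^ (m + j))%:R.
  elim: j => [|j ih]; first by rewrite addn0 !subrr rnorm0.
  rewrite addnS (le_trans (rnorm_dist3 (w (m + j)%N) _ _))//.
  apply: le_trans (lerD (wh _) ih) _.
  have -> : h / (2 ^ (m + j).+1)%:R = h / (2 ^ (m + j))%:R / 2 :> R.
    by rewrite expnS natrM invfM mulrCA mulrC.
  by lra.
have wm m n : (m <= n)%N -> rnorm (w n - w m) <= h / (2 ^ m)%:R.
  move=> mn; rewrite -(subnKC mn) (le_trans (wmj _ _))// gerBl.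
  by rewrite divr_ge0.
move=> e e0.
have [N Ne] : exists N, h / (2 ^ N)%:R <= e / 2.
  exists (Num.bound (h / (e / 2))).
  rewrite ler_pdivrMr ?ltr0n ?expn_gt0// -ler_pdivrMl ?divr_gt0// natrX.
  by rewrite mulrC ltW// upper_nthrootP.
exists N => m n Nm Nn; rewrite (le_trans (rnorm_dist3 (w N) _ _))//.
rewrite [leRHS]splitr lerD//; first exact: le_trans (wm _ _ Nm) Ne.
by rewrite rnormB; exact: le_trans (wm _ _ Nn) Ne.
Qed.

End GeometricCauchy.

Section LpComplete.
Context d (T : measurableType d) (R : realType).
Context (mu : {measure set T -> \bar R}) (V : normedModType R[i]).
Context (p : R) (p1 : 1 < p).
Local Notation D := (Lp mu V p1).

Let p_gt0 : 0 < p. Proof. exact: lt_trans p1. Qed.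

(** When the steps are bounded by 4^-(k+1) in norm, the function summing
(2^(k+1) |step k|)^p is integrable, hence finite almost everywhere, and where it
is finite the steps are O(2^-k). *)
Lemma fast_cauchy_ae (w : nat -> T -> V) : (forall k, strongly_measurable (w k)) ->
  (forall k, (Lpint mu p (fun x => (w k.+1 x - w k x)%R) <=
    ((((2 ^ k.+1)%:R ^- 2) : R) `^ p)%:E)%E) ->
  exists S, [/\ measurable S, {ae mu, forall x, S x} &
    forall x, S x -> rcauchy (w ^~ x)].
Proof.
move=> mw ww; pose b k : R := (2 ^ k.+1)%:R.
have b0 k : 0 < b k by rewrite ltr0n expn_gt0.
have b1 k : 1 <= b k by rewrite ler1n expn_gt0.
pose a k x : \bar R := ((b k `^ p)%:E * (rnorm (w k.+1 x - w k x) `^ p)%:E)%E.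
have mdiff k : strongly_measurable (fun x => w k.+1 x - w k x).
  by apply: strongly_measurableB.
have a0 k x : (0 <= a k x)%E by rewrite mule_ge0// lee_fin powR_ge0.
have ma k : measurable_fun [set: T] (a k).
  by apply: measurable_funeM; exact: measurable_Lpint.
have int_a k : (\int[mu]_x a k x <= (1 / (2 ^ k.+1)%:R)%:E)%E.
  rewrite ge0_integralZl_EFin ?powR_ge0//; last 2 first.
  - by move=> x _; rewrite lee_fin powR_ge0.
  - exact: measurable_Lpint.
  apply: le_trans (lee_wpmul2l _ (ww k)) _; first by rewrite lee_fin powR_ge0.
  rewrite -EFinM lee_fin -powRM ?(ltW (b0 k)) ?exprn_ge0 ?invr_ge0//.
  rewrite -/(b k) expr2 invfM mulrA mulfV ?gt_eqF// mul1r.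
  rewrite -[leRHS]powRr1 ?invr_ge0 ?(ltW (b0 k))//.
  by apply: ger_powR; rewrite ?invr_gt0 ?b0 ?invf_le1 ?b1// ltW.
pose H x : \bar R := (\sum_(k <oo) a k x)%E.
have mH : measurable_fun [set: T] H.
  by apply: ge0_emeasurable_sum => // k x _ _; exact: a0.
have H0 x : (0 <= H x)%E by apply: nneseries_ge0.
have int_H : (\int[mu]_x H x < +oo)%E.
  rewrite integral_nneseries//.
  apply: (@le_lt_trans _ _ 1%:E); last by rewrite ltry.
  apply: le_trans (epsilon_trick0 xpredT (@ler01 R)).
  apply: lee_nneseries => [k _ _|k _].
    by apply: integral_ge0 => x _; exact: a0.
  exact: int_a.
pose S := [set x | (H x < +oo)%E].
exists S; split.
- rewrite -[S]setTI; exact: emeasurable_fun_infty_o.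
- have iH : mu.-integrable [set: T] H.
    apply/integrableP; split => //.
    by under eq_integral => x _ do rewrite gee0_abs//.
  have := integrable_ae measurableT iH; apply: filterS => x /(_ I).
  by rewrite ge0_fin_numE.
- move=> x Sx; have Hfin : H x \is a fin_num by rewrite ge0_fin_numE.
  apply: (@geometric_rcauchy _ _ _ (fine (H x) `^ p^-1)); first exact: powR_ge0.
  move=> k; rewrite ler_pdivlMr ?b0// mulrC.
  apply: (powR_inj_ge0 p1); rewrite ?powR_ge0 ?mulr_ge0 ?rnorm_ge0//.
  rewrite (powR_invK p1) ?fine_ge0// powRM ?rnorm_ge0//.
  rewrite -lee_fin fineK// EFinM.
  apply: le_trans (nneseries_lim_ge k.+1 _) => //.
  by rewrite big_nat_recr//= leeDr// sume_ge0.
Qed.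

(** Riesz-Fischer: a subsequence with small steps converges pointwise on a set [S]
of full measure; cutting it off outside [S] gives an everywhere limit [f], and
Fatou's lemma bounds the distances to [f]. *)
Lemma Lp_seq_complete : seq_complete V -> seq_complete D.
Proof.
move=> Vc u cu.
pose r k : R := (2 ^ k.+1)%:R ^- 2.
have r0 k : 0 < r k by rewrite invr_gt0 exprn_gt0// ltr0n expn_gt0.
have /choice[N NP] k : exists N, forall m n, (N <= m)%N -> (N <= n)%N ->
    rnorm (u m - u n) <= r k by exact: cu.
pose n k := (\max_(j < k.+1) N j)%N.
have nN j k : (j <= k)%N -> (N j <= n k)%N.
  move=> jk; have jk' : (j < k.+1)%N by [].
  exact: (leq_bigmax (Ordinal jk')).
pose w k : T -> V := repr (u (n k)).
have mw k : strongly_measurable (w k) by exact: Lp_measurable.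
have [S [mS aeS Scauchy]] : exists S, [/\ measurable S, {ae mu, forall x, S x} &
    forall x, S x -> rcauchy (w ^~ x)].
  apply: fast_cauchy_ae => // k.
  rewrite -rnorm_LpB lee_fin; apply: (powR_mono p1); first exact: rnorm_ge0.
  by apply: NP; apply: nN.
pose v k x := scal_bop V (\1_S x) (w k x).
have vE k x : v k x = if x \in S then w k x else 0.
  rewrite /v scal_bopE indicE; case: ifP => _; first by rewrite scale1r.
  by rewrite scale0r.
have mv k : strongly_measurable (v k).
  apply: strongly_measurable_app => //; apply: strongly_measurable_scal.
  exact: measurable_indic.
have /choice[f vf] x : exists l, rlim (v ^~ x) l.
  have [xS|xS] := boolP (x \in S).
    have [l wl] := Vc _ (Scauchy x (set_mem xS)).
    exists l => e /wl[M Mw]; exists M => k Mk.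
    by rewrite vE xS; exact: Mw.
  exists 0 => e e0; exists 0%N => k _; rewrite vE (negbTE xS).
  by rewrite subrr rnorm0 ltW.
have mf : strongly_measurable f by exact: strongly_measurable_cvg vf.
have dist m k : (N k <= m)%N ->
    (Lpint mu p (fun x => repr (u m) x - f x)%R <= ((r k) `^ p)%:E)%E.
  move=> km.
  apply: (@Lpint_fatou _ _ _ _ _ _ p1 (fun j x => repr (u m) x - v j x) _ _ k).
  - by move=> j; apply: strongly_measurableB => //; exact: Lp_measurable.
  - move=> x e /(vf x)[M Mv]; exists M => j Mj.
    by rewrite opprB addrC addrA subrK rnormB; exact: Mv.
  - move=> j kj; have -> : Lpint mu p (fun x => repr (u m) x - v j x) =
        Lpint mu p (fun x => repr (u m) x - w j x).
      apply: ae_Lpint; first by apply: strongly_measurableB => //; exact: Lp_measurable.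
        by apply: strongly_measurableB => //; exact: Lp_measurable.
      apply: filterS aeS => x Sx; rewrite vE.
      by rewrite ifT// inE.
    rewrite -rnorm_LpB lee_fin; apply: (powR_mono p1); first exact: rnorm_ge0.
    by apply: NP => //; apply: nN.
(* The limit f itself is recovered as the difference of u (N 0) and g. *)
pose g x := repr (u (N 0%N)) x - f x.
have Lg : Lp_fun mu p g.
  apply/(Lp_funP mu p1); split.
    by apply: strongly_measurableB => //; exact: Lp_measurable.
  by apply: le_lt_trans (dist _ 0%N (leqnn _)) _; rewrite ltry.
pose l := u (N 0%N) - to_Lp mu p1 g.
have lE : {ae mu, forall x, repr l x = f x}.
  have := LpB_repr (u (N 0%N)) (to_Lp mu p1 g).
  have := to_LpE p1 Lg; apply: filterS2 => x gE lE.
  by rewrite lE gE /g opprB addrC subrK.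
exists l => e e0.
have [k ke] : exists k, r k <= e.
  exists (Num.bound e^-1); rewrite /r -[leRHS]invrK lef_pV2; last 2 first.
  - by rewrite posrE exprn_gt0// ltr0n expn_gt0.
  - by rewrite posrE invr_gt0.
  apply/ltW; apply: lt_le_trans (upper_nthrootP (leqnn _)) _.
  rewrite -natrX -natrX ler_nat -expnM leq_exp2l// muln2 -addnn.
  by rewrite (leq_trans (leqnSn _))// leq_addr.
exists (N k) => m km; apply: (powR_inj_ge0 p1); rewrite ?rnorm_ge0 ?(ltW e0)//.
rewrite -lee_fin rnorm_LpB.
have -> : Lpint mu p (fun x => repr (u m) x - repr l x) =
    Lpint mu p (fun x => repr (u m) x - f x).
  apply: ae_Lpint.
  - by apply: strongly_measurableB; exact: Lp_measurable.
  - by apply: strongly_measurableB => //; exact: Lp_measurable.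
  by apply: filterS lE => x ->.
apply: le_trans (dist m k km) _; rewrite lee_fin; apply: (powR_mono p1) => //.
exact: ltW.
Qed.

End LpComplete.

(** * Weighted composition operators *)

(** Multiplications, weighted translations and restrictions to measurable sets are
all of the form F |-> c (F o s).  The map [s] has to preserve null sets for this
to be defined on classes. *)
Section WeightedComposition.
Context d (T : measurableType d) (R : realType).
Context (mu : {measure set T -> \bar R}) (V : normedModType R[i]).
Context (p : R) (p1 : 1 < p).
Local Notation D := (Lp mu V p1).
Context (c : T -> bop V) (s : T -> T) (C : R).
Hypothesis mc : strongly_measurable c.
Hypothesis ms : measurable_fun [set: T] s.
Hypothesis s_ae : forall P : T -> Prop,
  {ae mu, forall x, P x} -> {ae mu, forall x, P (s x)}.
Hypothesis C0 : 0 <= C.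
Hypothesis c_bound : forall f : T -> V, strongly_measurable f ->
  (Lpint mu p (fun x => c x (f (s x))) <= (C `^ p)%:E * Lpint mu p f)%E.

Definition wcomp (F : D) : D := to_Lp mu p1 (fun x => c x (repr F (s x))).

Lemma strongly_measurable_wcomp (f : T -> V) : strongly_measurable f ->
  strongly_measurable (fun x => c x (f (s x))).
Proof.
move=> mf; apply: strongly_measurable_app => //.
exact: (strongly_measurable_comp ms mf).
Qed.

Lemma Lp_fun_wcomp (F : D) : Lp_fun mu p (fun x => c x (repr F (s x))).
Proof.
apply/(Lp_funP mu p1); split.
  by apply: strongly_measurable_wcomp; exact: Lp_measurable.
apply: le_lt_trans (c_bound (Lp_measurable F)) _.
by rewrite -rnorm_Lp -EFinM ltry.
Qed.

Lemma wcomp_repr (F : D) : {ae mu, forall x, repr (wcomp F) x = c x (repr F (s x))}.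
Proof. exact: to_LpE (Lp_fun_wcomp F). Qed.

Lemma rnorm_wcompE (F : D) :
  (rnorm (wcomp F) `^ p)%:E = Lpint mu p (fun x => c x (repr F (s x))).
Proof. exact: rnorm_to_Lp (Lp_fun_wcomp F). Qed.

Lemma rnorm_wcomp (F : D) : rnorm (wcomp F) <= C * rnorm F.
Proof.
apply: (powR_inj_ge0 p1); rewrite ?mulr_ge0 ?rnorm_ge0//.
rewrite powRM ?rnorm_ge0// -lee_fin rnorm_wcompE EFinM rnorm_Lp.
by apply: c_bound; exact: Lp_measurable.
Qed.

Lemma wcomp_bounded : bounded_linear wcomp.
Proof.
split=> [k F G|]; last by exists C; exact: rnorm_wcomp.
apply: Lp_ext.
have H1 : {ae mu, forall x, repr (wcomp (k *: F + G)) x =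
    c x (k *: repr F (s x) + repr G (s x))}.
  have := wcomp_repr (k *: F + G); have := s_ae (Lp_lin_repr k F G).
  by apply: filterS2 => x -> ->.
have H2 : {ae mu, forall x, repr (k *: wcomp F + wcomp G) x =
    k *: c x (repr F (s x)) + c x (repr G (s x))}.
  have := wcomp_repr F; have := wcomp_repr G.
  have := Lp_lin_repr k (wcomp F) (wcomp G).
  by apply: filterS3 => x -> -> ->.
by apply: filterS2 H1 H2 => x -> ->; rewrite bop_mapD bop_mapZ.
Qed.

Lemma to_bop_wcomp (F : D) : to_bop wcomp F = wcomp F.
Proof.
rewrite /to_bop /insubd insubT//=; apply/asboolP; exact: wcomp_bounded.
Qed.

End WeightedComposition.

(** * Diagonal and translation operators on p-summable families *)

Section EllpOperators.
Context (R : realType) (G : groupType) (D : normedModType R[i]).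
Context (p : R) (p1 : 1 < p).
Local Notation H := (ellp G D p1).

Lemma to_bopE (W : normedModType R[i]) (f : W -> W) :
  bounded_linear f -> (to_bop f : W -> W) = f.
Proof. by move=> bf; rewrite /to_bop /insubd insubT//=; apply/asboolP. Qed.

(** The coordinates of an operator given by formulas, once the formulas are known
to be linear and bounded, so that the default values of [to_bop] and [to_ellp] do
not occur. *)
Lemma to_bop_ellpE (f : H -> G -> D) (C : R) : 0 <= C ->
  (forall xi, ellp_fun p (f xi)) ->
  (forall c xi eta h, f (c *: xi + eta) h = c *: f xi h + f eta h) ->
  (forall xi, ellp_norm p (f xi) <= C * rnorm xi) ->
  forall xi h, to_bop (fun xi => to_ellp p1 (f xi)) xi h = f xi h.
Proof.
move=> C0 ff flin fC xi h.
have fE eta k : to_ellp p1 (f eta) k = f eta k by rewrite (to_ellpE p1 (ff eta)).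
rewrite to_bopE ?fE//; split=> [c eta zeta|].
  by apply: ellp_ext => k; rewrite ellpDE ellpZE !fE flin.
by exists C => eta; rewrite rnorm_ellp (to_ellpE p1 (ff eta)).
Qed.

Lemma diag_opE (u : G -> bop D) (C : R) : 0 <= C ->
  (forall h, opnorm (u h) <= C) -> forall xi h,
  to_bop (fun xi : H => to_ellp p1 (fun h => u h (xi h))) xi h = u h (xi h).
Proof.
move=> C0 uC.
have bound (xi : H) : ellp_fun p (fun h => u h (xi h)) /\
    ellp_norm p (fun h => u h (xi h)) <= C * rnorm xi.
  apply: (ellp_bound p1); first by rewrite mulr_ge0 ?rnorm_ge0.
  move=> K; rewrite powRM ?rnorm_ge0//.
  apply: le_trans (ler_wpM2l (powR_ge0 _ _) (ellp_fset_le xi K)).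
  rewrite mulr_sumr; apply: ler_sum => h _; rewrite -powRM ?rnorm_ge0//.
  apply: (powR_mono p1); first exact: rnorm_ge0.
  apply: le_trans (le_opnorm _ _) _.
  by apply: ler_wpM2r; [exact: rnorm_ge0|exact: uC].
apply: (@to_bop_ellpE (fun xi h => u h (xi h)) C C0).
- by move=> xi; exact: (bound xi).1.
- by move=> c xi eta h; rewrite ellpDE ellpZE bop_mapD bop_mapZ.
- by move=> xi; exact: (bound xi).2.
Qed.

Lemma transl_opE (g : G) : forall xi h,
  to_bop (fun xi : H => to_ellp p1 (fun h => xi (h * g)%g)) xi h = xi (h * g)%g.
Proof.
have bound (xi : H) : ellp_fun p (fun h => xi (h * g)%g) /\
    ellp_norm p (fun h => xi (h * g)%g) <= 1 * rnorm xi.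
  apply: (ellp_bound p1) => [|K]; rewrite mul1r ?rnorm_ge0//.
  apply: le_trans (ellp_fset_le xi [fset (h * g)%g | h in K]%fset).
  by rewrite big_imfset//= => h k _ _; exact: mulIg.
apply: (@to_bop_ellpE (fun xi h => xi (h * g)%g) 1 ler01).
- by move=> xi; exact: (bound xi).1.
- by move=> c xi eta h; rewrite ellpDE ellpZE.
- by move=> xi; exact: (bound xi).2.
Qed.

Lemma bop_invE (W : normedModType R[i]) (u v : bop W) :
  v * u = 1 -> u * v = 1 -> bop_inv u = v.
Proof.
move=> vu uv; have [iu ui] : [set w | w * u = 1 /\ u * w = 1] (bop_inv u).
  by have := @xgetI (bop W) 0 [set w | w * u = 1 /\ u * w = 1] v (conj vu uv).
by rewrite -[LHS]mulr1 -uv mulrA iu mul1r.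
Qed.

End EllpOperators.

Section BcontAlgebra.
Context (R : realType) (X : ptopologicalType) (V : normedModType R[i]).
Local Notation A := (bcont X (bop V)).

Lemma bcont_mul_subproof (a b : A) :
  (fun x => a x * b x) \in @bcont_pred R X (bop V).
Proof.
have [ca [M aM]] := bcontP a; have [cb [N bN]] := bcontP b.
apply/asboolP; split=> [x|]; last first.
  exists (M * N) => x; apply: le_trans (opnormM _ _) _.
  by apply: ler_pM; rewrite ?opnorm_ge0//; [exact: aM|exact: bN].
apply/cvgrPdist_le => e /pos_complex[-> e0].
pose C := rnorm (a x) + rnorm (b x) + 1 : R.
have C0 : 0 < C by rewrite ltr_wpDl// addr_ge0 ?rnorm_ge0.
pose d := Num.min 1 (complex.Re e / C).
have d0 : 0 < d by rewrite lt_min ltr01 divr_gt0.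
have d1 : d <= 1 by rewrite ge_min lexx.
have dC : d * C <= complex.Re e by rewrite -ler_pdivlMr// ge_min lexx orbT.
have /cvgrPdist_le /(_ d%:C) := ca x; rewrite ltcR => /(_ d0) Ha.
have /cvgrPdist_le /(_ d%:C) := cb x; rewrite ltcR => /(_ d0) Hb.
apply: filterS2 Ha Hb => y; rewrite !rnorm_le => ya yb.
exact: (rnorm_mul_near e0 (lexx _) (lexx _) (ltW d0) d1 dC ya yb).
Qed.

Definition bcont_mul (a b : A) : A := Bcont (bcont_mul_subproof a b).

Lemma bcont_comp_subproof (W : normedModType R[i]) (s : X -> X) (a : bcont X W) :
  continuous s -> (fun x => a (s x)) \in @bcont_pred R X W.
Proof.
move=> cs; have [ca [M aM]] := bcontP a.
apply/asboolP; split; last by exists M => x; exact: aM.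
by move=> x; apply: continuous_comp; [exact: cs|exact: ca].
Qed.

Definition bcont_comp (W : normedModType R[i]) (s : X -> X) (cs : continuous s)
  (a : bcont X W) : bcont X W := Bcont (bcont_comp_subproof a cs).

Lemma supnorm_comp (W : normedModType R[i]) (s : X -> X) (cs : continuous s)
  (a : bcont X W) : supnorm (bcont_comp cs a) <= supnorm a.
Proof. by apply: supnorm_lub => x; exact: (supnorm_ub a (s x)). Qed.

End BcontAlgebra.

(** * Transported measures *)

Section PushforwardMeasure.
Context d (T : measurableType d) (R : realType).
Context (mu : {measure set T -> \bar R}) (s : T -> T).

(** The measurability proof is an argument so that [push] can be registered as a
measure. *)
Definition push (_ : measurable_fun [set: T] s) : set T -> \bar R :=
  pushforward mu s.

Hypothesis ms : measurable_fun [set: T] s.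

Let push0 : (push ms set0 = 0)%E.
Proof. by rewrite /push /pushforward preimage_set0 measure0. Qed.

Let push_ge0 A : (0 <= push ms A)%E.
Proof. exact: measure_ge0. Qed.

Let push_sigma_additive : semi_sigma_additive (push ms).
Proof.
exact: (@measure_semi_sigma_additive _ _ _
  (measure_function_pushforward__canonical__measure_function_Measure mu ms)).
Qed.

HB.instance Definition _ :=
  isMeasure.Build _ _ _ (push ms) push0 push_ge0 push_sigma_additive.

Lemma push_integral (f : T -> \bar R) : measurable_fun [set: T] f ->
  (forall x, 0 <= f x)%E -> (\int[push ms]_x f x = \int[mu]_x f (s x))%E.
Proof. by move=> mf f0; rewrite ge0_integral_pushforward. Qed.

Lemma push_sigma_finite (s' : T -> T) : measurable_fun [set: T] s' ->
  cancel s s' -> sigma_finite [set: T] mu -> sigma_finite [set: T] (push ms).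
Proof.
move=> ms' ss' [F TF mF]; exists (fun n => s' @^-1` F n).
  by rewrite -preimage_bigcup -TF preimage_setT.
move=> n; have [mFn Fn] := mF n; split.
  by rewrite -[X in measurable X]setTI; exact: ms'.
rewrite /push /pushforward.
by rewrite (_ : s @^-1` _ = F n)//; apply/seteqP; split=> x /=; rewrite ss'.
Qed.

Lemma push_ae (P : T -> Prop) : push ms `<< mu ->
  {ae mu, forall x, P x} -> {ae mu, forall x, P (s x)}.
Proof.
move=> /null_content_dominatesP dom [N [mN N0 PN]].
exists (s @^-1` N); split.
- by rewrite -[X in measurable X]setTI; exact: ms.
- exact: dom.
- by move=> x /= Px; apply: PN.
Qed.

End PushforwardMeasure.

(** * Multiplications and weighted translations on the Bochner space *)

Section DynamicalSystem.
Context (R : realType) (X : ptopologicalType).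
Context (mu : {measure set (borelType X) -> \bar R}).
Hypothesis sfmu : sigma_finite [set: borelType X] mu.
Hypothesis suppmu : msupport mu = [set: X].
Context (E : normedModType R[i]) (p : R) (p1 : 1 < p).
Context (G : groupType) (t : G -> X -> X).
Hypothesis t_cont : forall g, continuous (t g).
Hypothesis t1 : forall x, t 1%g x = x.
Hypothesis tM : forall g h x, t (g * h)%g x = t g (t h x).
Hypothesis t_mu : forall g,
  pushforward mu (t g : borelType X -> borelType X) `<< mu.

Local Notation Y := (borelType X).
Local Notation D := (Lp mu E p1).
Local Notation A := (bcont X (bop E)).

Let p_gt0 : 0 < p. Proof. exact: lt_trans p1. Qed.

Lemma t_K g x : t g (t g^-1%g x) = x.
Proof. by rewrite -tM mulgV t1. Qed.

Lemma t_VK g x : t g^-1%g (t g x) = x.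
Proof. by rewrite -tM mulVg t1. Qed.

Lemma continuous_measurable_borel (s : X -> X) : continuous s ->
  measurable_fun [set: Y] (s : Y -> Y).
Proof.
move=> cs; apply: (@measurability _ _ Y Y _ _ (@open X)) => //.
move=> _ [U oU <-]; rewrite setTI; apply: open_borel.
by apply: (@open_comp _ _ s) => // x _; exact: cs.
Qed.

Lemma t_measurable g : measurable_fun [set: Y] (t g : Y -> Y).
Proof. exact: continuous_measurable_borel. Qed.

Lemma t_ae g (P : Y -> Prop) :
  {ae mu, forall x : Y, P x} -> {ae mu, forall x : Y, P (t g x)}.
Proof.
exact: (@push_ae _ _ _ mu (t g : Y -> Y) (t_measurable g) P (t_mu g)).
Qed.

Definition weight (g : G) : Y -> R := density mu (pushforward mu (t g : Y -> Y)).

Lemma t_push_sigma_finite g : sigma_finite [set: Y] (push mu (t_measurable g)).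
Proof.
apply: (push_sigma_finite _ (t_measurable g^-1%g)) => //.
exact: t_VK.
Qed.

Lemma weightP g : is_density mu (pushforward mu (t g : Y -> Y)) (weight g).
Proof.
have [h hP] := density_exists sfmu (t_push_sigma_finite g) (t_mu g).
exact: (@xgetI _ (fun=> 0)
  [set h | is_density mu (pushforward mu (t g : Y -> Y)) h] h hP).
Qed.

Lemma weight_measurable g : measurable_fun [set: Y] (weight g).
Proof. by have [] := weightP g. Qed.

Lemma weight_ge0 g x : 0 <= weight g x.
Proof. by have [] := weightP g. Qed.

Lemma weight_integral g (f : Y -> \bar R) : measurable_fun [set: Y] f ->
  (forall x, 0 <= f x)%E ->
  (\int[mu]_x (f x * (weight g x)%:E) = \int[mu]_x f (t g x))%E.
Proof.
move=> mf f0; have wP : is_density mu (push mu (t_measurable g)) (weight g).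
  exact: weightP.
by rewrite -(density_integral wP mf f0) push_integral.
Qed.

(** Both sides of this cocycle identity are densities of the same transported
measure. *)
Lemma weightM g h :
  {ae mu, forall x : Y, weight (g * h)%g x = weight g x * weight h (t g^-1%g x)}.
Proof.
have mwh : measurable_fun [set: Y] (fun x : Y => weight h (t g^-1%g x)).
  exact: measurableT_comp (weight_measurable h) (t_measurable _).
apply: (@density_ae_unique _ _ _ mu (push mu (t_measurable (g * h)%g))).
- exact: t_push_sigma_finite.
- exact: weightP.
split.
- by apply: measurable_funM => //; exact: weight_measurable.
- by move=> x; rewrite mulr_ge0 ?weight_ge0.
move=> Q mQ.
have mgQ : measurable ((t g : Y -> Y) @^-1` Q).
  by rewrite -[X in measurable X]setTI; exact: t_measurable.
pose f (x : Y) : \bar R := (\1_Q x * weight h (t g^-1%g x))%:E.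
have -> : (\int[mu]_(x in Q) (weight g x * weight h (t g^-1%g x))%:E =
    \int[mu]_x (f x * (weight g x)%:E))%E.
  rewrite integral_mkcond; apply: eq_integral => x _; rewrite /f patchE indicE.
  case: ifP => _; first by rewrite -EFinM mul1r mulrC.
  by rewrite mul0r mul0e.
rewrite weight_integral; last 2 first.
- by apply/measurable_EFinP; apply: measurable_funM => //; exact: measurable_indic.
- by move=> x; rewrite lee_fin mulr_ge0 ?weight_ge0.
have -> : (\int[mu]_x f (t g x) =
    \int[mu]_(x in (t g : Y -> Y) @^-1` Q) (weight h x)%:E)%E.
  rewrite [RHS]integral_mkcond; apply: eq_integral => x _.
  rewrite /f patchE indicE t_VK; have -> : (x \in (t g : Y -> Y) @^-1` Q) =
    (t g x \in Q) by apply/idP/idP; rewrite !inE.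
  by case: ifP => _; rewrite ?mul1r ?mul0r.
have [_ _ whP] := weightP h; rewrite -whP//.
by rewrite /push /pushforward; congr (mu _); apply/seteqP; split=> x /=;
  rewrite tM.
Qed.

Lemma bcont_strongly_measurable (a : A) : strongly_measurable (a : Y -> bop E).
Proof. exact: (continuous_strongly_measurable sfmu suppmu (bcontP a).1). Qed.

Lemma Lpint_mul (a : A) (f : Y -> E) : strongly_measurable f ->
  (Lpint mu p (fun x => a x (f x)) <= (supnorm a `^ p)%:E * Lpint mu p f)%E.
Proof.
move=> mf; have ma := bcont_strongly_measurable a.
rewrite /Lpint -ge0_integralZl_EFin ?powR_ge0//; last 2 first.
- by move=> x _; rewrite lee_fin powR_ge0.
- exact: measurable_Lpint.
apply: ge0_le_integral => //.
- by move=> x _; rewrite lee_fin powR_ge0.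
- by apply: measurable_Lpint; exact: strongly_measurable_app.
- by apply: measurable_funeM; exact: measurable_Lpint.
move=> x _; rewrite -EFinM lee_fin -powRM ?rnorm_ge0 ?supnorm_ge0//.
apply: (powR_mono p1); first exact: rnorm_ge0.
apply: le_trans (le_opnorm _ _) _.
by apply: ler_wpM2r; [exact: rnorm_ge0|exact: (supnorm_ub a x)].
Qed.

Local Notation M := (@mul_op R X mu E p p1).
Local Notation T := (shift_op mu E p1 t).

Lemma mul_opE (a : A) (F : D) : M a F = wcomp (a : Y -> bop E) id F.
Proof.
exact: (@to_bop_wcomp _ _ _ mu _ _ p1 _ id _ (bcont_strongly_measurable a)
  (@measurable_id _ _ _) (fun P aeP => aeP) (supnorm_ge0 a) (Lpint_mul a)).
Qed.

Lemma mul_op_repr (a : A) (F : D) :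
  {ae mu, forall x : Y, repr (M a F) x = a x (repr F x)}.
Proof.
rewrite mul_opE.
exact: (wcomp_repr (bcont_strongly_measurable a)
  (@measurable_id _ _ _) (Lpint_mul a)).
Qed.

Lemma mul_op_le (a : A) : rnorm (M a) <= rnorm a.
Proof.
apply: opnorm_le => [|F]; first exact: rnorm_ge0.
rewrite mul_opE.
exact: (rnorm_wcomp (bcont_strongly_measurable a)
  (@measurable_id _ _ _) (supnorm_ge0 a) (Lpint_mul a)).
Qed.

Definition shift_coef (g : G) (x : Y) : bop E := scal_bop E (weight g x `^ p^-1).

Lemma shift_coef_measurable g : strongly_measurable (shift_coef g).
Proof.
apply: strongly_measurable_scal.
apply: (@measurableT_comp _ _ _ _ _ _ (@powR R ^~ p^-1)) => //.
exact: weight_measurable.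
Qed.

Lemma shift_coefE g x v : shift_coef g x v = (weight g x `^ p^-1)%:C *: v.
Proof. exact: scal_bopE. Qed.

Lemma rnorm_shift_coef g x v :
  rnorm (shift_coef g x v) `^ p = weight g x * rnorm v `^ p.
Proof.
rewrite shift_coefE rnormZ cabs_real ger0_norm ?powR_ge0//.
by rewrite powRM ?powR_ge0 ?rnorm_ge0// (powR_invK p1) ?weight_ge0.
Qed.

(** The weight compensates the change of variables. *)
Lemma Lpint_shift g (f : Y -> E) : strongly_measurable f ->
  (Lpint mu p (fun x => shift_coef g x (f (t g^-1%g x))) = Lpint mu p f)%E.
Proof.
move=> mf; have mft : strongly_measurable (fun x : Y => f (t g^-1%g x)).
  exact: (strongly_measurable_comp (t_measurable g^-1%g) mf).
rewrite /Lpint; under eq_integral => x _ do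
  rewrite rnorm_shift_coef mulrC EFinM.
rewrite weight_integral; last 2 first.
- exact: (measurable_Lpint p mft).
- by move=> x; rewrite lee_fin powR_ge0.
by apply: eq_integral => x _; rewrite t_VK.
Qed.

Lemma Lpint_shift_le g (f : Y -> E) : strongly_measurable f ->
  (Lpint mu p (fun x => shift_coef g x (f (t g^-1%g x))) <=
    (1 `^ p)%:E * Lpint mu p f)%E.
Proof. by move=> mf; rewrite Lpint_shift// powR1 mul1e. Qed.

Lemma shift_opE g (F : D) : T g F = wcomp (shift_coef g) (t g^-1%g) F.
Proof.
exact: (@to_bop_wcomp _ _ _ mu _ _ p1 _ (t g^-1%g : Y -> Y) _
  (shift_coef_measurable g) (t_measurable g^-1%g) (@t_ae g^-1%g) ler01
  (@Lpint_shift_le g)).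
Qed.

Lemma shift_op_repr g (F : D) : {ae mu, forall x : Y,
  repr (T g F) x = shift_coef g x (repr F (t g^-1%g x))}.
Proof.
rewrite shift_opE.
exact: (wcomp_repr (shift_coef_measurable g) (t_measurable g^-1%g)
  (@Lpint_shift_le g)).
Qed.

Lemma shift_op_iso g (F : D) : rnorm (T g F) = rnorm F.
Proof.
have H : rnorm (T g F) `^ p = rnorm F `^ p.
  apply: EFin_inj; rewrite shift_opE.
  rewrite (rnorm_wcompE (shift_coef_measurable g) (t_measurable g^-1%g)
    (@Lpint_shift_le g)) rnorm_Lp Lpint_shift//.
  exact: Lp_measurable.
by apply/le_anti/andP; split; apply: (powR_inj_ge0 p1); rewrite ?rnorm_ge0// H.
Qed.

Lemma shift_opD g h : T (g * h)%g = T g * T h.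
Proof.
apply: bop_inj => F; apply: Lp_ext; rewrite bopM.
have H1 : {ae mu, forall x : Y, repr (T g (T h F)) x =
    shift_coef g x (shift_coef h (t g^-1%g x) (repr F (t h^-1%g (t g^-1%g x))))}.
  have := shift_op_repr g (T h F); have := t_ae g^-1%g (shift_op_repr h F).
  by apply: filterS2 => x -> ->.
have := weightM g h; have := shift_op_repr (g * h)%g F.
apply: filterS3 H1 => x -> -> wgh.
rewrite !shift_coefE wgh invgM tM powRM ?weight_ge0//.
by rewrite rmorphM/= scalerA.
Qed.

(** T_1 is an idempotent isometry: T_1 (T_1 F - F) = 0. *)
Lemma shift_op1 : T 1%g = 1.
Proof.
apply: bop_inj => F; apply/eqP; rewrite -subr_eq0; apply/eqP/rnorm0_eq0.
rewrite -(shift_op_iso 1%g) bop_mapB -[X in X - _]/((T 1%g * T 1%g) F).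
by rewrite -shift_opD mulg1 subrr rnorm0.
Qed.

Lemma shift_opK g F : T g (T g^-1%g F) = F.
Proof. by rewrite -bopM -shift_opD mulgV shift_op1. Qed.

Lemma shift_opVK g F : T g^-1%g (T g F) = F.
Proof. by rewrite -bopM -shift_opD mulVg shift_op1. Qed.

Definition transl (g : G) (a : A) : A := bcont_comp (@t_cont g^-1%g) a.

Lemma shift_mul g a : T g * M a = M (transl g a) * T g.
Proof.
apply: bop_inj => F; apply: Lp_ext; rewrite !bopM.
have H1 : {ae mu, forall x : Y, repr (T g (M a F)) x =
    shift_coef g x (a (t g^-1%g x) (repr F (t g^-1%g x)))}.
  have := shift_op_repr g (M a F); have := t_ae g^-1%g (mul_op_repr a F).
  by apply: filterS2 => x -> ->.
have := mul_op_repr (transl g a) (T g F); have := shift_op_repr g F.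
apply: filterS3 H1 => x -> -> ->.
by rewrite !shift_coefE bop_mapZ.
Qed.

Lemma mul_op_lin c a b : M (c *: a + b) = c *: M a + M b.
Proof.
apply: bop_inj => F; apply: Lp_ext; rewrite bopD bopZ.
have H1 : {ae mu, forall x : Y, repr (c *: M a F + M b F) x =
    c *: a x (repr F x) + b x (repr F x)}.
  have := Lp_lin_repr c (M a F) (M b F); have := mul_op_repr a F.
  by have := mul_op_repr b F; apply: filterS3 => x -> -> ->.
have := mul_op_repr (c *: a + b) F; apply: filterS2 H1 => x -> ->.
by rewrite -bopZ -bopD.
Qed.

Lemma mul_opM a b : M (bcont_mul a b) = M a * M b.
Proof.
apply: bop_inj => F; apply: Lp_ext; rewrite bopM.
have H1 : {ae mu, forall x : Y, repr (M a (M b F)) x = a x (b x (repr F x))}.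
  have := mul_op_repr a (M b F); have := mul_op_repr b F.
  by apply: filterS2 => x -> ->.
by have := mul_op_repr (bcont_mul a b) F; apply: filterS2 H1 => x -> ->.
Qed.

Lemma hat_mul g a : hat_op t g (M a) = M (transl g a).
Proof.
rewrite /hat_op (bop_invE (v := T g^-1%g)); last 2 first.
- by rewrite -shift_opD mulVg shift_op1.
- by rewrite -shift_opD mulgV shift_op1.
by rewrite shift_mul -mulrA -shift_opD mulgV shift_op1 mulr1.
Qed.

Local Notation H := (ellp G D p1).

Lemma bar_opE (a : A) (xi : H) h : bar_op mu p1 t a xi h = M (transl h a) (xi h).
Proof.
rewrite -hat_mul.
apply: (@diag_opE _ _ _ _ p1 (fun h => hat_op t h (M a)) (supnorm a)).
  exact: supnorm_ge0.
move=> k; rewrite hat_mul; apply: le_trans (mul_op_le _) _.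
exact: supnorm_comp.
Qed.

Lemma regular_opE g (xi : H) h :
  @regular_op R X mu E p p1 G g xi h = xi (h * g)%g.
Proof. exact: transl_opE. Qed.

(** * Restriction to measurable sets *)

Definition cut_coef (Q : set Y) (x : Y) : bop E := scal_bop E (\1_Q x).

Lemma cut_coefE Q x v : cut_coef Q x v = if x \in Q then v else 0.
Proof.
rewrite /cut_coef scal_bopE indicE; case: ifP => _; first by rewrite scale1r.
by rewrite scale0r.
Qed.

Lemma cut_coef_measurable Q : measurable Q -> strongly_measurable (cut_coef Q).
Proof.
by move=> mQ; apply: strongly_measurable_scal; exact: measurable_indic.
Qed.

Lemma Lpint_cut Q (f : Y -> E) : measurable Q -> strongly_measurable f ->
  (Lpint mu p (fun x => cut_coef Q x (f x)) <= (1 `^ p)%:E * Lpint mu p f)%E.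
Proof.
move=> mQ mf; rewrite powR1 mul1e; apply: ge0_le_integral => //.
- by move=> x _; rewrite lee_fin powR_ge0.
- apply: measurable_Lpint; apply: strongly_measurable_app => //.
  exact: cut_coef_measurable.
- exact: measurable_Lpint.
move=> x _; rewrite lee_fin cut_coefE; case: ifP => _; first exact: lexx.
by rewrite rnorm0 powR0 ?gt_eqF// powR_ge0.
Qed.

(** An indicator is not continuous, so this is not a [mul_op]. *)
Definition cut (Q : set Y) : bop D := to_bop (@wcomp _ Y R mu E p p1 (cut_coef Q) id).

Lemma cutE Q F : measurable Q -> cut Q F = wcomp (cut_coef Q) id F.
Proof.
move=> mQ.
exact: (@to_bop_wcomp _ _ _ mu _ _ p1 _ id _ (cut_coef_measurable mQ)
  (@measurable_id _ _ _) (fun P aeP => aeP) ler01 (fun f => @Lpint_cut Q f mQ)).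
Qed.

Lemma cut_repr Q F : measurable Q ->
  {ae mu, forall x : Y, repr (cut Q F) x = if x \in Q then repr F x else 0}.
Proof.
move=> mQ; rewrite cutE//.
have := wcomp_repr (cut_coef_measurable mQ) (@measurable_id _ _ _)
  (fun f => @Lpint_cut Q f mQ) F.
by apply: filterS => x ->; rewrite cut_coefE.
Qed.

Lemma ae_seq (I : eqType) (s : seq I) (P : I -> Y -> Prop) :
  (forall i, i \in s -> {ae mu, forall x : Y, P i x}) ->
  {ae mu, forall x : Y, forall i, i \in s -> P i x}.
Proof.
elim: s => [_|i s ih Pis]; first by apply: nearW.
have Pi := Pis i (mem_head _ _).
have Ps : {ae mu, forall x : Y, forall j, j \in s -> P j x}.
  by apply: ih => j js; apply: Pis; rewrite inE js orbT.
apply: filterS2 Pi Ps => x Pix Psx j; rewrite inE => /predU1P[->//|].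
exact: Psx.
Qed.

Lemma ae_fset (K : {fset G}) (P : G -> Y -> Prop) :
  (forall i, i \in K -> {ae mu, forall x : Y, P i x}) ->
  {ae mu, forall x : Y, forall i, i \in K -> P i x}.
Proof. exact: (@ae_seq _ (enum_fset K)). Qed.

(** Stated for all additive values at once, since it is applied both to vectors
and to powers of their norms. *)
Lemma disjoint_choice (K : {fset G}) (Q : G -> set Y) (x : Y) :
  (forall h k x, h \in K -> k \in K -> Q h x -> Q k x -> h = k) ->
  (exists2 h, h \in K & Q h x /\
    forall (Z : nmodType) (v : G -> Z),
      \sum_(k <- K) (if x \in Q k then v k else 0) = v h) \/
  (forall (Z : nmodType) (v : G -> Z),
      \sum_(k <- K) (if x \in Q k then v k else 0) = 0).
Proof.
move=> dQ; have [[h hK Qhx]|noh] := pselect (exists2 h, h \in K & Q h x).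
  left; exists h => //; split => // Z v.
  rewrite (big_fsetD1 h)//= mem_set// big1_seq ?addr0// => k.
  rewrite !inE => /andP[_ /andP[kh kK]]; rewrite ifF//.
  apply/negbTE; apply: contra kh; rewrite inE => Qkx.
  by apply/eqP; exact: (dQ k h x).
right=> Z v; rewrite big1_seq// => k /andP[_ kK]; rewrite ifF//.
by apply/negbTE/negP; rewrite inE => Qkx; apply: noh; exists k.
Qed.

Lemma Lpint_sum (I : Type) (s : seq I) (f : I -> Y -> E) :
  (forall i, strongly_measurable (f i)) ->
  (\sum_(i <- s) Lpint mu p (f i) =
   \int[mu]_x (\sum_(i <- s) rnorm (f i x) `^ p)%:E)%E.
Proof.
move=> mf; rewrite /Lpint -ge0_integral_sum//.
- by apply: eq_integral => x _; rewrite sumEFin.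
- by move=> i; exact: measurable_Lpint.
- by move=> i x _; rewrite lee_fin powR_ge0.
Qed.

Lemma measurable_sum_rnorm (I : Type) (s : seq I) (f : I -> Y -> E) :
  (forall i, strongly_measurable (f i)) ->
  measurable_fun [set: Y] (fun x => (\sum_(i <- s) rnorm (f i x) `^ p)%:E).
Proof.
move=> mf; apply/measurable_EFinP; apply: measurable_sum => i.
apply: (@measurableT_comp _ _ _ _ _ _ (@powR R ^~ p)) => //.
exact: measurable_rnorm.
Qed.

(** Over disjoint sets the p-th powers of the norms add up. *)
Lemma sum_cut_le (K : {fset G}) (Q : G -> set Y) (F : D) :
  (forall h, measurable (Q h)) ->
  (forall h k x, h \in K -> k \in K -> Q h x -> Q k x -> h = k) ->
  \sum_(h <- K) rnorm (cut (Q h) F) `^ p <= rnorm F `^ p.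
Proof.
move=> mQ dQ; rewrite -lee_fin rnorm_Lp -sumEFin.
under eq_bigr => h _ do rewrite rnorm_Lp.
have -> : (\sum_(h <- K) Lpint mu p (repr (cut (Q h) F)) =
    \sum_(h <- K) Lpint mu p (fun x => cut_coef (Q h) x (repr F x)))%E.
  apply: eq_bigr => h _; apply: ae_Lpint; first exact: Lp_measurable.
    by apply: strongly_measurable_app; [exact: cut_coef_measurable|exact: Lp_measurable].
  by have := cut_repr F (mQ h); apply: filterS => x ->; rewrite cut_coefE.
have mcF h : strongly_measurable (fun x => cut_coef (Q h) x (repr F x)).
  by apply: strongly_measurable_app; [exact: cut_coef_measurable|exact: Lp_measurable].
rewrite Lpint_sum//; apply: ge0_le_integral => //.
- by move=> x _; rewrite lee_fin sumr_ge0// => i _; rewrite powR_ge0.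
- exact: measurable_sum_rnorm.
- by apply: measurable_Lpint; exact: Lp_measurable.
move=> x _; rewrite lee_fin.
have -> : \sum_(i <- K) rnorm (cut_coef (Q i) x (repr F x)) `^ p =
    \sum_(i <- K) (if x \in Q i then rnorm (repr F x) `^ p else 0).
  apply: eq_bigr => i _; rewrite cut_coefE; case: ifP => // _.
  by rewrite rnorm0 powR0 ?gt_eqF.
by have [[h _ [_ ->]]|->] := disjoint_choice x dQ; rewrite ?powR_ge0.
Qed.

Lemma rnorm_sum_cut_le (K : {fset G}) (Q : G -> set Y) (F : G -> D) :
  (forall h, measurable (Q h)) ->
  (forall h k x, h \in K -> k \in K -> Q h x -> Q k x -> h = k) ->
  rnorm (\sum_(h <- K) cut (Q h) (F h)) `^ p <= \sum_(h <- K) rnorm (F h) `^ p.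
Proof.
move=> mQ dQ; rewrite -lee_fin rnorm_Lp -sumEFin.
rewrite [leRHS](eq_bigr (fun h => Lpint mu p (repr (F h)))); last first.
  by move=> h _; exact: rnorm_Lp.
pose f x := \sum_(h <- K) (if x \in Q h then repr (F h) x else 0).
have fE : {ae mu, forall x : Y, repr (\sum_(h <- K) cut (Q h) (F h)) x = f x}.
  have H : {ae mu, forall x : Y, forall h, h \in K ->
      repr (cut (Q h) (F h)) x = if x \in Q h then repr (F h) x else 0}.
    by apply: ae_fset => h _; exact: cut_repr.
  have := Lp_sum_repr K (fun h => cut (Q h) (F h)); apply: filterS2 H => x Hx ->.
  by apply: eq_big_seq => h hK; exact: Hx.
rewrite Lpint_sum; last by move=> h; exact: Lp_measurable.
have mS : measurable_fun [set: Y]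
    (fun x => (\sum_(h <- K) rnorm (repr (F h) x) `^ p)%:E).
  by apply: measurable_sum_rnorm => h; exact: Lp_measurable.
apply: ae_ge0_le_integral => //.
- by move=> x _; rewrite lee_fin powR_ge0.
- by apply: measurable_Lpint; exact: Lp_measurable.
- by move=> x _; rewrite lee_fin sumr_ge0// => h _; rewrite powR_ge0.
apply: filterS fE => x -> _; rewrite lee_fin /f.
have [[h hK [_ ->]]|->] := disjoint_choice x dQ.
  by rewrite (big_fsetD1 h)//= lerDl sumr_ge0// => k _; rewrite powR_ge0.
by rewrite rnorm0 powR0 ?gt_eqF// sumr_ge0// => k _; rewrite powR_ge0.
Qed.

Lemma shift_cut h (S : set Y) F : measurable S ->
  T h (cut ((t h : Y -> Y) @^-1` S) F) = cut S (T h F).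
Proof.
move=> mS; have mhS : measurable ((t h : Y -> Y) @^-1` S).
  by rewrite -[X in measurable X]setTI; exact: t_measurable.
apply: Lp_ext.
have H1 := shift_op_repr h (cut ((t h : Y -> Y) @^-1` S) F).
have H2 := t_ae h^-1%g (cut_repr F mhS).
have H3 : {ae mu, forall x : Y, repr (T h (cut ((t h : Y -> Y) @^-1` S) F)) x =
    if x \in S then shift_coef h x (repr F (t h^-1%g x)) else 0}.
  apply: filterS2 H1 H2 => x -> ->.
  have -> : ((t h^-1%g x : Y) \in (t h : Y -> Y) @^-1` S) = (x \in S).
    by apply/idP/idP; rewrite !inE/= t_K.
  by case: ifP => // _; exact: bop_map0.
have := cut_repr (T h F) mS; have := shift_op_repr h F.
by apply: filterS3 H3 => x -> -> ->.
Qed.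

(** * Topological freeness and disjoint translates *)

Hypothesis hausX : hausdorff_space X.
Hypothesis freeG : topologically_free t.

(** If t_h^-1 and t_k^-1 agreed on all of [U], then h^-1 k would fix the open set
t_k^-1(U) pointwise, against freeness.  At a point where they differ, disjoint
neighbourhoods of the two images are pulled back. *)
Lemma separate_pair (U : set X) (h k : G) : open U -> U !=set0 -> h != k ->
  exists W, [/\ open W, W !=set0, W `<=` U &
    forall x y, W x -> W y -> t h^-1%g x <> t k^-1%g y].
Proof.
move=> oU U0 hk.
have [x Ux hkx] : exists2 x, U x & t h^-1%g x != t k^-1%g x.
  apply: contrapT => nex.
  have Ueq x : U x -> t h^-1%g x = t k^-1%g x.
    by move=> Ux; apply/eqP/negPn/negP => neq; apply: nex; exists x.
  have hk1 : (h^-1 * k)%g != 1%g.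
    by apply: contra hk => /eqP hk1; rewrite -[k](mulVKg h) hk1 mulg1.
  have [x Ux] := U0.
  have : interior [set z | t (h^-1 * k)%g z = z] (t k^-1%g x).
    rewrite /interior/= nbhsE; exists (t k @^-1` U); last first.
      by move=> z /= /Ueq; rewrite tM t_VK.
    split; last by rewrite /= t_K.
    by apply: (@open_comp _ _ (t k)) => // y _; exact: t_cont.
  by rewrite freeG.
move: hausX; rewrite open_hausdorff => /(_ _ _ hkx) [[U1 U2]].
rewrite /= !inE => -[U1x U2x] [oO1 oO2 U12].
exists (U `&` (t h^-1%g @^-1` U1 `&` t k^-1%g @^-1` U2)); split.
- apply: openI => //; apply: openI; apply: open_comp => // y _; exact: t_cont.
- by exists x.
- by move=> y [].
- move=> y z [_ [U1y _]] [_ [_ U2z]] yz.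
  have : (U1 `&` U2) (t h^-1%g y) by split => //; rewrite yz.
  by rewrite (_ : U1 `&` U2 = set0)//; apply: eqP U12.
Qed.

Lemma separate_translates (K : {fset G}) (U : set X) : open U -> U !=set0 ->
  exists W, [/\ open W, W !=set0, W `<=` U &
    forall h k x y, h \in K -> k \in K -> W x -> W y ->
      t h^-1%g x = t k^-1%g y -> h = k].
Proof.
move=> oU U0.
suff sep (s : seq (G * G)) : exists W, [/\ open W, W !=set0, W `<=` U &
    forall h k x y, (h, k) \in s -> h != k -> W x -> W y ->
      t h^-1%g x <> t k^-1%g y].
  have [W [oW W0 WU Wsep]] := sep [seq (h, k) | h <- K, k <- K].
  exists W; split => // h k x y hK kK Wx Wy hxky.
  apply/eqP/negPn/negP => hk; apply: (Wsep h k x y) => //.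
  by apply/allpairsP; exists (h, k).
elim: s => [|[h k] s [W [oW W0 WU Wsep]]]; first by exists U; split.
have [->|hk] := eqVneq h k.
  exists W; split => // h' k' x y; rewrite inE => /predU1P[[-> ->]|]; last exact: Wsep.
  by rewrite eqxx.
have [W' [oW' W'0 W'W W'sep]] := separate_pair oW W0 hk.
exists W'; split => //; first exact: subset_trans WU.
move=> h' k' x y; rewrite inE => /predU1P[[-> ->] _|]; first exact: W'sep.
by move=> hks hk' W'x W'y; apply: (Wsep h' k') => //; exact: W'W.
Qed.

(** * The symbol and its pointwise bound *)

Lemma continuous_sum_fset (V : normedModType R[i]) (I : Type) (s : seq I)
    (f : I -> X -> V) : (forall i, continuous (f i)) ->
  continuous (fun x => \sum_(i <- s) f i x).
Proof.
move=> cf; elim: s => [|i s ih] x.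
  by under eq_fun do rewrite big_nil; exact: cvg_cst.
under eq_fun do rewrite big_cons.
by apply: cvgD; [exact: cf|exact: ih].
Qed.

Lemma continuous_sumR (I : Type) (s : seq I) (f : I -> X -> R) :
  (forall i, continuous (f i)) -> continuous (fun x => \sum_(i <- s) f i x).
Proof.
move=> cf; elim: s => [|i s ih] x.
  by under eq_fun do rewrite big_nil; exact: cvg_cst.
under eq_fun do rewrite big_cons.
by apply: cvgD; [exact: cf|exact: ih].
Qed.

Lemma bcont_app_continuous (a : A) (v : E) : continuous (fun x => a x v).
Proof.
move=> x; apply/cvgrPdist_le => e /pos_complex[-> e0].
have v1 : 0 < rnorm v + 1 by rewrite ltr_wpDl ?rnorm_ge0.
have [/(_ x) /cvgrPdist_le ca _] := bcontP a.
have := ca (complex.Re e / (rnorm v + 1))%:C; rewrite ltcR divr_gt0// => /(_ isT).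
apply: filterS => y; rewrite !rnorm_le => xy.
have -> : a x v - a y v = (a x - a y) v by [].
apply: le_trans (le_opnorm _ _) _.
apply: le_trans (ler_wpM2r (rnorm_ge0 v) xy) _.
by rewrite mulrAC ler_pdivrMr// ler_wpM2l ?(ltW e0)// lerDl.
Qed.

(** The regular representation of a finite sum acts fibrewise over [X]; this is its
action in the fibre over [x]. *)
Definition symbol (F : {fset G}) (a : G -> A) (eta : G -> E) (h : G) (x : X) : E :=
  \sum_(g <- F) a g (t h^-1%g x) (eta (h * g)%g).

Lemma symbol_continuous F a eta h : continuous (symbol F a eta h).
Proof.
apply: continuous_sum_fset => g x.
apply: (@continuous_comp _ _ _ (t h^-1%g) (fun y => a g y (eta (h * g)%g))).
  exact: t_cont.
exact: bcont_app_continuous.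
Qed.

Lemma symbol_sum_continuous F a eta (K : {fset G}) :
  continuous (fun x => \sum_(h <- K) rnorm (symbol F a eta h x) `^ p).
Proof.
apply: continuous_sumR => h x; apply: powR_cvg_ge0 => //.
  by move=> y; exact: rnorm_ge0.
exact: (continuous_rnorm (@symbol_continuous F a eta h)).
Qed.

Lemma small_positive_set (U : set X) : open U -> U !=set0 ->
  exists S : set Y, [/\ measurable S, S `<=` U, (0 < mu S)%E & (mu S < +oo)%E].
Proof.
move=> oU U0; have mU0 := open_pos suppmu oU U0.
have mU : measurable (U : set Y) by exact: open_borel.
have [Fn TF mF] := sfmu.
have [n Un] : exists n, (0 < mu ((U : set Y) `&` Fn n))%E.
  apply: contrapT => /forallNP nU; move: mU0.
  suff : mu.-negligible (U : set Y).
    by move=> /(negligibleP _ mU) ->; rewrite ltxx.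
  have -> : (U : set Y) = \bigcup_n ((U : set Y) `&` Fn n).
    by rewrite -setI_bigcupr -TF setIT.
  apply: negligible_bigcup => n; apply/negligibleP.
    by apply: measurableI => //; exact: (mF n).1.
  by apply/eqP; move/negP: (nU n); rewrite lt_def measure_ge0 andbT negbK.
exists ((U : set Y) `&` Fn n); split => //.
- by apply: measurableI => //; exact: (mF n).1.
- apply: le_lt_trans (mF n).2; apply: le_measure; rewrite ?inE//.
  + by apply: measurableI => //; exact: (mF n).1.
  + exact: (mF n).1.
Qed.

Definition bump (S : set Y) (v : E) : D := to_Lp mu p1 (fun x => cut_coef S x v).

Lemma bump_Lp S v : measurable S -> (mu S < +oo)%E ->
  Lp_fun mu p (fun x => cut_coef S x v) /\
  Lpint mu p (fun x => cut_coef S x v) = ((rnorm v `^ p)%:E * mu S)%E.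
Proof.
move=> mS Soo.
have E1 : Lpint mu p (fun x => cut_coef S x v) = ((rnorm v `^ p)%:E * mu S)%E.
  rewrite /Lpint -(integral_cst mu mS) [RHS]integral_mkcond; apply: eq_integral => x _.
  rewrite patchE cut_coefE; case: ifP => // _.
  by rewrite rnorm0 powR0// gt_eqF.
split => //; apply/(Lp_funP mu p1); split.
  apply: strongly_measurable_app; first exact: cut_coef_measurable.
  exact: strongly_measurable_cst.
by rewrite E1 lte_mul_pinfty// lee_fin powR_ge0.
Qed.

Lemma bump_repr S v : measurable S -> (mu S < +oo)%E ->
  {ae mu, forall x : Y, repr (bump S v) x = if x \in S then v else 0}.
Proof.
move=> mS Soo; have := to_LpE p1 (bump_Lp v mS Soo).1.
by apply: filterS => x ->; rewrite cut_coefE.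
Qed.

Lemma rnorm_bump S v : measurable S -> (mu S < +oo)%E ->
  rnorm (bump S v) `^ p = rnorm v `^ p * fine (mu S).
Proof.
move=> mS Soo; have [bL bE] := bump_Lp v mS Soo.
apply: EFin_inj; rewrite (rnorm_to_Lp p1 bL) bE EFinM fineK//.
by rewrite ge0_fin_numE ?measure_ge0.
Qed.

(** Put copies of the constants [eta k] on the disjoint sets t_k^-1(S), by means of
T_k^-1; then T_m brings the copy with k = m back to [S] and the others to sets
disjoint from [S].  The translates in [L] but not in [K] read off zeros. *)
Lemma test_function (S : set Y) (K L : {fset G}) (eta : G -> E) :
  measurable S -> (mu S < +oo)%E ->
  (forall k, k \notin K -> eta k = 0) -> (K `<=` L)%fset ->
  (forall h k x y, h \in L -> k \in L -> S x -> S y ->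
    t h^-1%g x = t k^-1%g y -> h = k) ->
  exists f : D,
    rnorm f `^ p <= fine (mu S) * \sum_(k <- K) rnorm (eta k) `^ p /\
    forall m, m \in L -> {ae mu, forall x : Y, S x -> repr (T m f) x = eta m}.
Proof.
move=> mS Soo etaK KL sepS.
pose Q k : set Y := (t k : Y -> Y) @^-1` S.
have mQ k : measurable (Q k).
  by rewrite -[X in measurable X]setTI; exact: t_measurable.
have dQ h k x : h \in K -> k \in K -> Q h x -> Q k x -> h = k.
  move=> hK kK Qh Qk; apply: (sepS h k (t h x) (t k x)) => //.
  - exact: (fsubsetP KL).
  - exact: (fsubsetP KL).
  - by rewrite !t_VK.
pose phi k := bump S (eta k).
have cut_phi k : cut S (phi k) = phi k.
  apply: Lp_ext; have := cut_repr (phi k) mS; have := bump_repr (eta k) mS Soo.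
  apply: filterS2 => x bx ->; rewrite -/(phi k) in bx; rewrite bx.
  by case: (x \in S).
pose f : D := \sum_(k <- K) T k^-1%g (phi k).
have fE : f = \sum_(k <- K) cut (Q k) (T k^-1%g (phi k)).
  apply: eq_bigr => k _.
  by rewrite -[RHS](shift_opVK k) (shift_cut _ _ mS) shift_opK cut_phi.
exists f; split.
  rewrite fE; apply: le_trans (rnorm_sum_cut_le _ mQ dQ) _.
  rewrite mulr_sumr; apply: ler_sum => k _.
  by rewrite shift_op_iso rnorm_bump// mulrC.
move=> m mL.
have fm : {ae mu, forall x : Y, forall k, k \in K -> S x ->
    repr (T m (T k^-1%g (phi k))) x = if k == m then eta m else 0}.
  apply: ae_fset => k kK; rewrite -[T m (T k^-1%g _)]bopM -shift_opD.
  have [->|km] := eqVneq k m.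
    rewrite mulgV shift_op1; have := bump_repr (eta m) mS Soo.
    by apply: filterS => x -> Sx; rewrite mem_set.
  have H1 := shift_op_repr (m * k^-1)%g (phi k).
  have H2 := t_ae (m * k^-1)^-1%g (bump_repr (eta k) mS Soo).
  apply: filterS2 H1 H2 => x -> -> Sx.
  rewrite ifF ?bop_map0//; apply/negbTE/negP; rewrite inE => Sy.
  move/eqP : km; apply; apply: (sepS k m (t (m * k^-1)^-1%g x) x) => //.
    exact: (fsubsetP KL).
  by rewrite -tM invgM invgK mulKg.
have Tf : T m f = \sum_(k <- K) T m (T k^-1%g (phi k)) by rewrite /f bop_map_sum.
have := Lp_sum_repr K (fun k => T m (T k^-1%g (phi k))); rewrite -Tf.
apply: filterS2 fm => x fmx -> Sx.
have -> : \sum_(k <- K) repr (T m (T k^-1%g (phi k))) x =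
    \sum_(k <- K) (if k == m then eta m else 0).
  by apply: eq_big_seq => k kK; exact: fmx.
have [mK|mK] := boolP (m \in K).
  rewrite (big_fsetD1 m)//= eqxx big1_seq ?addr0// => k.
  by rewrite !inE => /andP[_ /andP[/negbTE ->]].
rewrite etaK// big1_seq// => k /andP[_ kK]; case: ifP => //.
Qed.

(** If the bound failed at [x0] by [e], then it would fail on a neighbourhood [U];
the test function on a set [S] in [U] would contradict the bound by the norm of
the finite sum. *)
Lemma pointwise_bound (F : {fset G}) (a : G -> A) (x0 : X) (eta : G -> E)
    (K K' : {fset G}) : (forall k, k \notin K -> eta k = 0) ->
  \sum_(h <- K') rnorm (symbol F a eta h x0) `^ p <=
  rnorm (fin_sum M T F a) `^ p * \sum_(k <- K) rnorm (eta k) `^ p.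
Proof.
move=> etaK; set b := fin_sum M T F a.
pose Phi x := \sum_(h <- K') rnorm (symbol F a eta h x) `^ p.
apply/ler_addgt0Pr => e e0; rewrite -lerBlDr.
pose U := [set x | Phi x0 - e < Phi x].
have oU : open U.
  apply: (@open_comp _ _ Phi [set r | Phi x0 - e < r]); last exact: open_gt.
  by move=> x _; exact: symbol_sum_continuous.
have U0 : U !=set0 by exists x0; rewrite /U/= ltrBlDr ltrDl.
(* All the translates that occur: K from the test function, K' from the rows of
   the symbol, and the products h g from its columns. *)
pose L := (K `|` K' `|` [fset (h * g)%g | h in K', g in F])%fset.
have [W [oW W0 WU sepW]] := separate_translates L oU U0.
have [S [mS SW S_gt0 Soo]] := small_positive_set oW W0.
have Sfin : mu S \is a fin_num by rewrite ge0_fin_numE// measure_ge0.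
have s0 : 0 < fine (mu S) by rewrite fine_gt0// S_gt0 Soo.
have KL : (K `<=` L)%fset by rewrite /L -fsetUA fsubsetUl.
have [f [fle fE]] := @test_function S K L eta mS Soo etaK KL
  (fun h k x y hL kL Sx Sy => sepW h k x y hL kL (SW x Sx) (SW y Sy)).
pose Q k : set Y := (t k : Y -> Y) @^-1` S.
have mQ k : measurable (Q k).
  by rewrite -[X in measurable X]setTI; exact: t_measurable.
have dQ h k x : h \in K' -> k \in K' -> Q h x -> Q k x -> h = k.
  move=> hK kK Qh Qk; apply: (sepW h k (t h x) (t k x)).
  - by rewrite !inE hK !orbT.
  - by rewrite !inE kK !orbT.
  - exact: SW.
  - exact: SW.
  - by rewrite !t_VK.
(* T_h b f is the sum of the (a_g o t_h^-1) T_(hg) f, and on S the function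
   T_(hg) f is the constant eta (h g). *)
have TbE h : h \in K' ->
    {ae mu, forall x : Y, S x -> repr (T h (b f)) x = symbol F a eta h x}.
  move=> hK.
  have TbfE : T h (b f) = \sum_(g <- F) M (transl h (a g)) (T (h * g)%g f).
    rewrite /b /fin_sum bop_sumE bop_map_sum; apply: eq_bigr => g _.
    rewrite bopM -[LHS]/((T h * M (a g)) (T g f)) shift_mul bopM.
    by rewrite -[T h (T g f)]bopM -shift_opD.
  have H1 : {ae mu, forall x : Y, forall g, g \in F -> S x ->
      repr (M (transl h (a g)) (T (h * g)%g f)) x =
      a g (t h^-1%g x) (eta (h * g)%g)}.
    apply: ae_fset => g gF.
    have hgL : (h * g)%g \in L.
      by rewrite !inE; apply/orP; right; apply/imfset2P; exists h => //; exists g.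
    have := mul_op_repr (transl h (a g)) (T (h * g)%g f).
    by have := fE _ hgL; apply: filterS2 => x H -> Sx; rewrite H.
  have := Lp_sum_repr F (fun g => M (transl h (a g)) (T (h * g)%g f)).
  rewrite -TbfE; apply: filterS2 H1 => x H1 -> Sx.
  by apply: eq_big_seq => g gF; exact: H1.
have mcut h : strongly_measurable (fun x : Y => cut_coef S x (symbol F a eta h x)).
  apply: strongly_measurable_app; first exact: cut_coef_measurable.
  exact: (continuous_strongly_measurable sfmu suppmu
    (@symbol_continuous F a eta h)).
have cutE' h : h \in K' -> (rnorm (cut (Q h) (b f)) `^ p)%:E =
    Lpint mu p (fun x : Y => cut_coef S x (symbol F a eta h x)).
  move=> hK; rewrite -(shift_op_iso h) shift_cut// rnorm_Lp.
  apply: ae_Lpint => //; first exact: Lp_measurable.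
  have := cut_repr (T h (b f)) mS; have := TbE h hK.
  apply: filterS2 => x TbEx ->; rewrite cut_coefE; case: ifPn => //.
  by rewrite inE => /TbEx.
have low : ((Phi x0 - e) * fine (mu S) <= \sum_(h <- K') rnorm (cut (Q h) (b f)) `^ p).
  rewrite -lee_fin EFinM fineK// -integral_cst// -sumEFin big_seq.
  rewrite (eq_bigr (fun h => Lpint mu p
    (fun x : Y => cut_coef S x (symbol F a eta h x)))); last first.
    by move=> h hK; exact: cutE'.
  rewrite -big_seq Lpint_sum//.
  have mSum := measurable_sum_rnorm K' mcut.
  apply: (@le_trans _ _ (\int[mu]_(x in S) (Phi x)%:E)%E).
    have [Phi0|Phi0] := leP 0 (Phi x0 - e).
      apply: ge0_le_integral => //.
      - apply/measurable_funTS/measurable_EFinP.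
        apply: measurable_sum => h.
        apply: (@measurableT_comp _ _ _ _ _ _ (@powR R ^~ p)) => //.
        apply: measurable_rnorm; apply: (continuous_strongly_measurable sfmu suppmu).
        exact: (@symbol_continuous F a eta h).
      - by move=> x Sx; rewrite lee_fin; apply/ltW/WU/SW.
    rewrite integral_cst//; apply: (@le_trans _ _ 0%E).
      by rewrite mule_le0_ge0// ?lee_fin ltW.
    by apply: integral_ge0 => x _; rewrite lee_fin sumr_ge0// => h _; rewrite powR_ge0.
  rewrite integral_mkcond le_eqVlt; apply/orP; left; apply/eqP.
  apply: eq_integral => x _; rewrite patchE; case: ifPn => xS.
    congr (_%:E); apply: eq_bigr => h _; by rewrite cut_coefE xS.
  rewrite big1// => h _.
  by rewrite cut_coefE (negbTE xS) rnorm0 powR0// gt_eqF.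
rewrite -(ler_pM2r s0); apply: le_trans low _.
apply: le_trans (sum_cut_le (b f) mQ dQ) _.
rewrite -mulrA [X in _ * X]mulrC.
apply: le_trans (_ : rnorm b `^ p * rnorm f `^ p <= _).
  rewrite -powRM ?rnorm_ge0//; apply: (powR_mono p1); first exact: rnorm_ge0.
  exact: le_opnorm.
by apply: ler_wpM2l; rewrite ?powR_ge0.
Qed.

(** In row [1], the symbol of an [eta] concentrated at [g] is [a g x (eta g)]. *)
Lemma coef_bound (F : {fset G}) (a : G -> A) g :
  rnorm (fin_coef F a g) <= rnorm (fin_sum M T F a).
Proof.
rewrite /fin_coef; case: ifPn => gF; last by rewrite rnorm0 rnorm_ge0.
apply: supnorm_lub => x; apply: opnorm_le => [|v]; first exact: rnorm_ge0.
pose eta k : E := if k == g then v else 0.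
have etaK k : k \notin [fset g]%fset -> eta k = 0.
  by rewrite /eta inE => /negbTE ->.
have := @pointwise_bound F a x eta [fset g]%fset [fset 1%g]%fset etaK.
rewrite !big_seq_fset1 /eta eqxx -powRM ?rnorm_ge0// => H.
apply: (powR_inj_ge0 p1); rewrite ?mulr_ge0 ?rnorm_ge0//.
apply: le_trans H; rewrite /symbol (big_fsetD1 g)//= mul1g eqxx invg1 t1.
rewrite big1_seq ?addr0// => k; rewrite !inE => /andP[_ /andP[kg _]].
by rewrite mul1g (negbTE kg) bop_map0.
Qed.

Local Notation Mbar := (bar_op mu p1 t).
Local Notation V := (@regular_op R X mu E p p1 G).

(** The pointwise bound for the values at [x] of the finitely many coordinates of
[xi] that matter, integrated over [X]. *)
Lemma bar_bound (F : {fset G}) (a : G -> A) :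
  rnorm (fin_sum Mbar V F a) <= rnorm (fin_sum M T F a).
Proof.
set b := fin_sum M T F a.
apply: opnorm_le => [|xi]; first exact: rnorm_ge0.
apply: ellp_norm_bound => [|K']; first by rewrite mulr_ge0 ?rnorm_ge0.
pose K := [fset (h * g)%g | h in K', g in F]%fset.
have mxi k : strongly_measurable (repr (xi k) : Y -> E) by exact: Lp_measurable.
pose eta x k : E := if k \in K then repr (xi k) x else 0.
have barE h : h \in K' -> {ae mu, forall x : Y,
    repr (fin_sum Mbar V F a xi h) x = symbol F a (eta x) h x}.
  move=> hK.
  rewrite (fin_sum_barE bar_opE regular_opE).
  have H1 : {ae mu, forall x : Y, forall g, g \in F ->
      repr (M (transl h (a g)) (xi (h * g)%g)) x =
      a g (t h^-1%g x) (repr (xi (h * g)%g) x)}.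
    by apply: ae_fset => g _; exact: mul_op_repr.
  have := Lp_sum_repr F (fun g => M (transl h (a g)) (xi (h * g)%g)).
  apply: filterS2 H1 => x H1 ->; apply: eq_big_seq => g gF.
  rewrite H1// /eta ifT//; apply/imfset2P; exists h => //; exists g => //.
rewrite -lee_fin -sumEFin.
rewrite (eq_bigr (fun h => Lpint mu p (repr (fin_sum Mbar V F a xi h)))); last first.
  by move=> h _; exact: rnorm_Lp.
have mbar h : strongly_measurable (repr (fin_sum Mbar V F a xi h) : Y -> E).
  exact: Lp_measurable.
rewrite Lpint_sum//.
apply: (@le_trans _ _ (\int[mu]_x ((rnorm b `^ p)%:E *
    (\sum_(k <- K) rnorm (repr (xi k) x) `^ p)%:E))%E).
  have mS := measurable_sum_rnorm K mxi.
  apply: ae_ge0_le_integral => //.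
  - by move=> x _; rewrite lee_fin sumr_ge0// => h _; rewrite powR_ge0.
  - exact: measurable_sum_rnorm.
  - by move=> x _; rewrite -EFinM lee_fin mulr_ge0 ?powR_ge0// sumr_ge0// => k _;
      rewrite powR_ge0.
  - exact: measurable_funeM.
  have := ae_fset barE; apply: filterS => x barEx _; rewrite -EFinM lee_fin.
  have etaK k : k \notin K -> eta x k = 0 by rewrite /eta => /negbTE ->.
  have := @pointwise_bound F a x (eta x) K K' etaK.
  have -> : \sum_(k <- K) rnorm (eta x k) `^ p =
      \sum_(k <- K) rnorm (repr (xi k) x) `^ p.
    by apply: eq_big_seq => k kK; rewrite /eta kK.
  apply: le_trans; rewrite le_eqVlt; apply/orP; left; apply/eqP.
  by apply: eq_big_seq => h hK; rewrite barEx.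
rewrite ge0_integralZl_EFin ?powR_ge0//; last 2 first.
- by move=> x _; rewrite lee_fin sumr_ge0// => h _; rewrite powR_ge0.
- exact: measurable_sum_rnorm.
rewrite -Lpint_sum// (eq_bigr (fun k => (rnorm (xi k) `^ p)%:E)); last first.
  by move=> k _; rewrite rnorm_Lp.
rewrite sumEFin -EFinM lee_fin powRM ?rnorm_ge0 ?opnorm_ge0//.
apply: ler_wpM2l; first exact: powR_ge0.
exact: ellp_fset_le.
Qed.

End DynamicalSystem.

(** * The isomorphism theorem *)

Theorem theorem5p7 (R : realType) (X : ptopologicalType)
    (hausX : hausdorff_space X) (crX : completely_regular_space X)
    (mu : {measure set (borelType X) -> \bar R})
    (sfmu : sigma_finite [set: borelType X] mu)
    (suppmu : msupport mu = [set: X])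
    (E : completeNormedModType R[i]) (E_neq0 : exists e : E, e <> 0)
    (p : R) (p1 : 1 < p)
    (G : groupType) (t : G -> X -> X)
    (t_cont : forall g, continuous (t g))
    (t1 : forall x, t 1%g x = x)
    (tM : forall g h x, t (g * h)%g x = t g (t h x))
    (t_mu : forall g,
      pushforward mu (t g : borelType X -> borelType X) `<< mu)
    (amenG : amenable R G) (freeG : topologically_free t) :
  let A := bcont X (bop E) in
  let D := Lp mu E p1 in
  let M : A -> bop D := @mul_op R X mu E p p1 in
  let T : G -> bop D := shift_op mu E p1 t in
  let Mbar : A -> bop (ellp G D p1) := bar_op mu p1 t in
  let V : G -> bop (ellp G D p1) := @regular_op R X mu E p p1 G in
  [/\ exists Phi : bop D -> bop (ellp G D p1),
        isometric_isomorphism (gen_algebra M T) (gen_algebra Mbar V) Phi /\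
        forall (F : {fset G}) (a : G -> A),
          Phi (fin_sum M T F a) = fin_sum Mbar V F a,
      prop_star M T,
      prop_star_star M T &
      forall (F : {fset G}) (a : G -> A) (chi : G -> R[i]),
        group_character chi ->
        `|fin_sum M T F a| = `|fin_sum M T F (fun g => chi g *: a g)| ].
Proof.
move=> A D M T Mbar V.
have Ec : seq_complete E by exact: completeNormed_seq_complete.
have Dc : seq_complete D by exact: (Lp_seq_complete Ec).
have Ac : seq_complete A by exact: (bcont_seq_complete (bop_seq_complete Ec)).
have M_lin : forall c a b, M (c *: a + b) = c *: M a + M b.
  exact: (mul_op_lin sfmu suppmu p1).
have M_mul : forall a b, M (bcont_mul a b) = M a * M b.
  exact: (mul_opM sfmu suppmu p1).
have M_le : forall a, rnorm (M a) <= rnorm a := mul_op_le sfmu suppmu p1.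
have TD : forall g h, T (g * h)%g = T g * T h.
  exact: (shift_opD sfmu E p1 t_cont t1 tM t_mu).
have T1 : T 1%g = 1 := shift_op1 sfmu E p1 t_cont t1 tM t_mu.
have T_iso : forall g f, rnorm (T g f) = rnorm f.
  exact: (shift_op_iso sfmu t_cont t1 tM t_mu).
have TM : forall g a, T g * M a = M (transl t_cont g a) * T g.
  exact: (shift_mul sfmu suppmu p1 t_cont t1 tM t_mu).
have MbarE : forall a xi h, Mbar a xi h = M (transl t_cont h a) (xi h).
  exact: (bar_opE sfmu suppmu t_cont t1 tM t_mu).
have VE : forall g xi h, V g xi h = xi (h * g)%g by exact: regular_opE.
have bar_le : forall F a, rnorm (fin_sum Mbar V F a) <= rnorm (fin_sum M T F a).
  exact: (bar_bound sfmu suppmu p1 t_cont t1 tM t_mu hausX freeG).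
have coef_le : forall F a g,
    rnorm (fin_coef F a g) <= rnorm (fin_sum M T F a).
  exact: (coef_bound sfmu suppmu p1 t_cont t1 tM t_mu hausX freeG).
split.
- exists (bar_iso M T Mbar V); split.
    exact: (bar_iso_isometric M_lin M_mul TD T1 T_iso TM MbarE VE
      amenG Dc bar_le).
  exact: (bar_iso_fin_sum M_lin TD T1 T_iso TM MbarE VE amenG bar_le).
- exact: (covariant_prop_star coef_le).
- exact: (covariant_prop_star_star M_lin M_le TD T1 T_iso TM MbarE VE
    amenG Dc Ac bar_le coef_le).
- exact: (covariant_character M_lin TD T1 T_iso TM MbarE VE amenG bar_le).
Qed.
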